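(* Let $M_m$ be a rotationally symmetric plane with $G_m\ge 0$. Then: (i) $\mathfrak C_m$ is the closed metric ball of radius $R_m$ centered at $o$ for some $R_m\in[0,\infty]$; (ii) $R_m>0$ if and only if $\int_1^\infty m^{-2}\,dr<\infty$; (iii) $R_m<\infty$ if and only if $m'(\infty):=\lim_{r\to\infty}m'(r)<\tfrac12$; (iv) if $M_m$ is von Mangoldt and $R_m<\infty$, then the equation $m'(r)=\tfrac12$ has a unique solution $\rho_m$, and it satisfies $\rho_m>R_m$ and $G_m(\rho_m)>0$; (v) if $M_m$ is von Mangoldt and $0<R_m<\infty$, then $R_m$ is the unique solution $x$ of the equation $\int_x^\infty \frac{m(x)\,dr}{m(r)\sqrt{m(r)^2-m(x)^2}}=\pi$.
   Context: For a smooth function $m\colon[0,\infty)\to[0,\infty)$ with $m(0)=0$, $m'(0)=1$, $m>0$ on $(0,\infty)$ and smooth odd extension, $M_m$ is $\mathbb R^2$ with the complete metric $dr^2+m(r)^2d\theta^2$ (polar coordinates about the origin $o$), with Gaussian curvature $G_m=-m''/m$; $M_m$ is von Mangoldt if $G_m$ is non-increasing in $r$. When $G_m\ge0$, $m'$ is non-increasing so $m'(\infty)$ exists. A ray is a unit speed geodesic on $[0,\infty)$ minimizing between any two of its points. $\mathfrak C_m$ is the set of points $q\in M_m$ such that every unit tangent vector at $q$ makes angle $\le\pi/2$ with some ray starting at $q$. *)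

(* Defs.v *)
(* Concrete model of the rotationally symmetric
   plane M_m: the underlying set is R^2 (Cartesian coordinates), with origin o
   = (0,0), polar radius r = |q| and the Riemannian metric dr^2 + m(r)^2 dθ^2. *)
From Stdlib Require Import Reals.
From Coquelicot Require Import Coquelicot.
Open Scope R_scope.

Definition pt := (R * R)%type.
Definition origin : pt := (0, 0).

Definition smooth (f : R -> R) : Prop :=
  forall (n : nat) (x : R), ex_derive (Derive_n f n) x.

(* m defines a rotationally symmetric plane: m is the restriction to [0,oo)
   of a smooth odd function, m(0)=0, m'(0)=1, m>0 on (0,oo). *)
Definition rot_sym_profile (m : R -> R) : Prop :=
  smooth m /\ (forall x, m (- x) = - m x) /\ m 0 = 0 /\ Derive m 0 = 1 /\
  (forall r, 0 < r -> 0 < m r).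

Definition Gm (m : R -> R) (r : R) : R := - (Derive_n m 2 r) / m r.

Definition nonneg_curvature (m : R -> R) : Prop :=
  forall r, 0 < r -> 0 <= Gm m r.

Definition von_Mangoldt (m : R -> R) : Prop :=
  forall r s, 0 < r -> r <= s -> Gm m s <= Gm m r.

(* the Riemannian metric g_q(v,w) at q, written in Cartesian coordinates:
   g = (radial part)^2 + (m(r)/r)^2 (angular part)^2, Euclidean at o *)
Definition gm (m : R -> R) (q v w : pt) : R :=
  let r := sqrt (fst q ^ 2 + snd q ^ 2) in
  if Req_EM_T r 0 then fst v * fst w + snd v * snd w
  else
    let vr := (fst v * fst q + snd v * snd q) / r in
    let wr := (fst w * fst q + snd w * snd q) / r in
    let vt := (snd v * fst q - fst v * snd q) / r in
    let wt := (snd w * fst q - fst w * snd q) / r in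
    vr * wr + (m r / r) ^ 2 * (vt * wt).

Definition C1_curve (c1 c2 : R -> R) : Prop :=
  forall t, 0 <= t <= 1 ->
    ex_derive c1 t /\ continuous (Derive c1) t /\
    ex_derive c2 t /\ continuous (Derive c2) t.

Definition curve_length (m : R -> R) (c1 c2 : R -> R) : R :=
  RInt (fun t => sqrt (gm m (c1 t, c2 t) (Derive c1 t, Derive c2 t)
                                          (Derive c1 t, Derive c2 t))) 0 1.

Definition dist_m (m : R -> R) (p q : pt) : R :=
  real (Glb_Rbar (fun L => exists c1 c2 : R -> R,
     C1_curve c1 c2 /\ (c1 0, c2 0) = p /\ (c1 1, c2 1) = q /\
     L = curve_length m c1 c2)).

Definition is_ray (m : R -> R) (q : pt) (g1 g2 : R -> R) : Prop :=
  (g1 0, g2 0) = q /\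
  forall s t, 0 <= s -> 0 <= t -> dist_m m (g1 s, g2 s) (g1 t, g2 t) = Rabs (s - t).

Definition init_velocity (g1 g2 : R -> R) (w : pt) : Prop :=
  filterlim (fun h => (g1 h - g1 0) / h) (at_right 0) (locally (fst w)) /\
  filterlim (fun h => (g2 h - g2 0) / h) (at_right 0) (locally (snd w)).

(* angle between tangent vectors v, w at q (for unit vectors) *)
Definition angle_m (m : R -> R) (q v w : pt) : R := acos (gm m q v w).

Definition in_Cm (m : R -> R) (q : pt) : Prop :=
  forall v : pt, gm m q v v = 1 ->
    exists (g1 g2 : R -> R) (w : pt),
      is_ray m q g1 g2 /\ init_velocity g1 g2 w /\ angle_m m q v w <= PI / 2.

(* Main.v *)
Require Import Defs.
From Stdlib Require Import Reals Lra Psatz ClassicalEpsilon.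
From Coquelicot Require Import Coquelicot.
Open Scope R_scope.

(** A ray is known only through the distances between its points and a right derivative at 0, so
    neither the geodesic equation nor the first variation formula is at hand. Necessity of T(x) <=
    PI therefore compares an explicit path from q to a far point of the ray with nearly minimal
    curves from the point of the ray at a small time h. The bound is PI because the two geodesics
    leaving q along its parallel are mirror images and meet once each has turned by PI. Sufficiency
    uses three rays: these two and the outward radial one.

    On a cone with m' = 1/2 the function N is constantly 2 and the total turn is twice PI / 2. This
    is the origin of the threshold 1/2 and of the factor 2 in the turning inequality.

    T(x) is improper at both ends and N requires m to be unbounded. Hence [turn_bounded] speaks of
    Clairaut constants K < m(x) and finite radii; it forces m to be unbounded, and only then are the
    inverse of m and the parameter s introduced.

    For uniqueness in (v), equal total turns at levels c < c' force N(v) = N(c' v / c) for v > c.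
    Iterating gives N > 2 above c, and the total turn exceeds PI. *)

(* Since G_m >= 0, m' is nonincreasing with values in [0, 1]. For q at radius x let T(x) be the angle
   swept by the geodesic leaving q along its parallel. Then q lies in C_m iff T(x) <= PI, and the rest
   is about T: substituting m(r) = m(x) sqrt (1 + s^2), T(x) is the integral over s > 0 of
   N (m(x) sqrt (1 + s^2)) / (1 + s^2), where N, that is 1 / m' as a function of m, is nondecreasing.

   Lengths are bounded below by calibration with k theta +- int sqrt (1 - k^2 / m^2), of unit gradient
   where m >= k. If y is the least radius along a curve, calibrating with k <= m(y) on both sides of
   the point of radius y shows that the curve is longer than the tangential geodesic, provided the
   turning inequality holds: for k < K, calibrating an outward geodesic of Clairaut constant K and
   turn at most PI with k instead of K loses at most twice int_k^K sqrt (1 - k^2 / v^2) dv; going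
   inwards to the level m = k and back costs at least that much because m' <= 1. The inequality
   follows from the convexity of the turn as a function of the Euclidean turn arctan s. *)

(** * Calculus on the real line *)

Lemma derive_continuous (f : R -> R) (x l : R) : is_derive f x l -> continuous f x.
Proof. intros H; apply (ex_derive_continuous (V := R_NormedModule)); now exists l. Qed.

Lemma is_derive_eq (f : R -> R) (x l l' : R) : is_derive f x l -> l = l' -> is_derive f x l'.
Proof. now intros H <-. Qed.

Lemma continuity_pt_of (f : R -> R) (x : R) : continuous f x -> continuity_pt f x.
Proof. intros H; now apply continuity_pt_filterlim. Qed.

Lemma continuous_eps (f : R -> R) (x eps : R) :
  continuous f x -> 0 < eps ->
  exists d, 0 < d /\ forall y, Rabs (y - x) < d -> Rabs (f y - f x) < eps.
Proof.
  intros H He.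
  destruct (proj1 (filterlim_locally f (f x)) H (mkposreal eps He)) as [d Hd].
  exists d; split; [apply cond_pos |]; intros y Hy; exact (Hd y Hy).
Qed.

Lemma eps_continuous (f : R -> R) (x : R) :
  (forall eps, 0 < eps ->
     exists d, 0 < d /\ forall y, Rabs (y - x) < d -> Rabs (f y - f x) < eps) ->
  continuous f x.
Proof.
  intros H; apply (proj2 (filterlim_locally f (f x))); intros [eps He].
  destruct (H eps He) as [d [Hd Hf]].
  exists (mkposreal d Hd); intros y Hy; exact (Hf y Hy).
Qed.

Lemma MVT_everywhere (f df : R -> R) (a b : R) : (forall x, is_derive f x (df x)) ->
  exists c, Rmin a b <= c <= Rmax a b /\ f b - f a = df c * (b - a).
Proof.
  intros Hd; apply MVT_gen; intros; [apply Hd |].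
  apply continuity_pt_of, derive_continuous with (1 := Hd x).
Qed.

Lemma incr_of_derive (f df : R -> R) (a b : R) :
  a <= b -> (forall x, a < x < b -> is_derive f x (df x)) ->
  (forall x, a < x < b -> 0 <= df x) ->
  (forall x, a <= x <= b -> continuous f x) -> f a <= f b.
Proof.
  intros Hab Hd Hp Hc.
  (* The point returned by [MVT_gen] may be an endpoint, where nothing is known about [df]; the
     derivative is replaced by 0 there. *)
  destruct (MVT_gen f a b (fun x => if Rlt_dec a x then if Rlt_dec x b then df x else 0 else 0))
    as [c [Hc1 Hc2]].
  - rewrite Rmin_left, Rmax_right by lra; intros x Hx.
    destruct (Rlt_dec a x); [| lra]; destruct (Rlt_dec x b); [| lra]; auto.
  - rewrite Rmin_left, Rmax_right by lra; intros x Hx.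
    apply continuity_pt_of; auto.
  - assert (0 <= f b - f a); [| lra].
    rewrite Hc2; apply Rmult_le_pos; [| lra].
    destruct (Rlt_dec a c); [| lra]; destruct (Rlt_dec c b); [| lra]; auto.
Qed.

Lemma incr_of_derive_closed (f df : R -> R) (a b : R) :
  a <= b -> (forall x, a <= x <= b -> is_derive f x (df x)) ->
  (forall x, a <= x <= b -> 0 <= df x) -> f a <= f b.
Proof.
  intros Hab Hd Hp; apply incr_of_derive with df; auto.
  - intros x Hx; apply Hd; lra.
  - intros x Hx; apply Hp; lra.
  - intros x Hx; apply derive_continuous with (df x); auto.
Qed.

Lemma constant_of_derive (f : R -> R) (a b : R) :
  a <= b -> (forall x, a <= x <= b -> is_derive f x 0) -> f b = f a.
Proof.
  intros Hab Hd; apply Rle_antisym.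
  - assert (- f a <= - f b); [| lra].
    apply (incr_of_derive_closed (fun x => - f x) (fun _ => 0)); auto; [| intros; lra].
    intros x Hx; apply is_derive_eq with (opp 0); [| simpl; unfold opp; simpl; ring].
    apply (is_derive_opp f); auto.
  - apply (incr_of_derive_closed f (fun _ => 0)); auto; intros; lra.
Qed.

(** The bound [l] in [Rbar] lets one statement serve the whole line ([m_infty]), the half-line r >
    0, and the half-lines where m > K. *)
Lemma ex_RInt_continuous_on (f : R -> R) (l : Rbar) (a b : R) :
  (forall u : R, Rbar_lt l u -> continuous f u) -> Rbar_lt l a -> Rbar_lt l b -> ex_RInt f a b.
Proof.
  intros Hf Ha Hb; apply (ex_RInt_continuous (V := R_CompleteNormedModule)).
  intros z [Hz _]; apply Hf.
  unfold Rmin in Hz; destruct (Rle_dec a b);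
    [apply Rbar_lt_le_trans with (1 := Ha) | apply Rbar_lt_le_trans with (1 := Hb)]; exact Hz.
Qed.

Lemma is_derive_RInt_on (f : R -> R) (l : Rbar) (a r : R) :
  (forall u : R, Rbar_lt l u -> continuous f u) -> Rbar_lt l a -> Rbar_lt l r ->
  is_derive (fun t => RInt f a t) r (f r).
Proof.
  intros Hf Ha Hr.
  apply (is_derive_RInt (V := R_NormedModule) f (fun t => RInt f a t) a r); [| now apply Hf].
  assert (Hl : locally r (fun u => Rbar_lt l u)) by (apply open_Rbar_gt; exact Hr).
  revert Hl; apply filter_imp; intros u Hu.
  apply (RInt_correct (V := R_CompleteNormedModule)).
  now apply ex_RInt_continuous_on with l.
Qed.

Lemma RInt_Rconst (c a b : R) : RInt (fun _ => c) a b = (b - a) * c.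
Proof. apply (RInt_const (V := R_CompleteNormedModule)). Qed.

Lemma RInt_Rpoint (f : R -> R) (a : R) : RInt f a a = 0.
Proof. apply (RInt_point (V := R_CompleteNormedModule)). Qed.

Lemma RInt_Rchasles (f : R -> R) (a b c : R) :
  ex_RInt f a b -> ex_RInt f b c -> RInt f a b + RInt f b c = RInt f a c.
Proof. apply (RInt_Chasles (V := R_CompleteNormedModule)). Qed.

Lemma RInt_pos_le (f : R -> R) (a b : R) :
  a <= b -> ex_RInt f a b -> (forall x, a < x < b -> 0 <= f x) -> 0 <= RInt f a b.
Proof.
  intros Hab Hf Hp.
  replace 0 with (RInt (fun _ => 0) a b).
  - apply RInt_le; auto; apply ex_RInt_const.
  - rewrite RInt_Rconst; apply Rmult_0_r.
Qed.

(** Curves are regular only on [0, 1]. Composing with [clamp] makes an integrand continuous on the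
    line, so that its primitive has two-sided derivatives at 0 and 1 as well. *)
Definition clamp (t : R) : R := Rmax 0 (Rmin t 1).

Lemma clamp_in (t : R) : 0 <= clamp t <= 1.
Proof.
  unfold clamp; split; [apply Rmax_l |].
  apply Rmax_lub; [lra | apply Rmin_r].
Qed.

Lemma clamp_id (t : R) : 0 <= t <= 1 -> clamp t = t.
Proof. intros Ht; unfold clamp; rewrite Rmin_left, Rmax_right; lra. Qed.

Lemma lipschitz_continuous (f : R -> R) (C x : R) :
  0 <= C -> (forall y, Rabs (f y - f x) <= C * Rabs (y - x)) -> continuous f x.
Proof.
  intros HC Hf; apply eps_continuous; intros eps He.
  exists (eps / (C + 1)); split; [apply Rdiv_lt_0_compat; lra |]; intros y Hy.
  apply Rlt_div_r in Hy; [| lra]; apply Rle_lt_trans with (1 := Hf y).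
  assert (H := Rabs_pos (y - x)); lra.
Qed.

Lemma clamp_lipschitz (t y : R) : Rabs (clamp y - clamp t) <= 1 * Rabs (y - t).
Proof.
  destruct (Rle_lt_dec t y); unfold clamp, Rmin;
    [rewrite (Rabs_pos_eq (y - t)) by lra | rewrite (Rabs_left (y - t)) by lra];
    destruct (Rle_dec t 1), (Rle_dec y 1); unfold Rmax;
    repeat (match goal with |- context [Rle_dec ?a ?b] => destruct (Rle_dec a b) end);
    apply Rabs_le; lra.
Qed.

Lemma clamp_continuous (f : R -> R) (t : R) :
  (forall u, 0 <= u <= 1 -> continuous f u) -> continuous (fun u => f (clamp u)) t.
Proof.
  intros Hf; apply (continuous_comp clamp f); [| apply Hf, clamp_in].
  apply lipschitz_continuous with 1; [lra | apply clamp_lipschitz].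
Qed.

Lemma RInt_clamp (f : R -> R) (a b : R) :
  0 <= a -> a <= b -> b <= 1 -> RInt (fun u => f (clamp u)) a b = RInt f a b.
Proof.
  intros Ha Hab Hb; apply RInt_ext; intros u Hu.
  rewrite Rmin_left, Rmax_right in Hu by lra; rewrite clamp_id; lra.
Qed.

Lemma is_derive_RInt_clamp (f : R -> R) (t : R) :
  (forall u, 0 <= u <= 1 -> continuous f u) ->
  is_derive (fun t => RInt (fun u => f (clamp u)) 0 t) t (f (clamp t)).
Proof.
  intros Hf.
  apply (is_derive_RInt_on (fun u => f (clamp u)) m_infty); try exact I.
  intros u _; now apply clamp_continuous.
Qed.

(** The primitive of [f] minus [F] has nonnegative derivative. In use [f] is the speed of a curve
    and [F] the value along it of a function of gradient at most 1: this is the calibration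
    argument. *)
Lemma RInt_ge_increment (f F dF : R -> R) (a b : R) :
  0 <= a -> a <= b -> b <= 1 ->
  (forall u, 0 <= u <= 1 -> continuous f u) ->
  (forall u, a <= u <= b -> is_derive F u (dF u)) ->
  (forall u, a <= u <= b -> dF u <= f u) ->
  F b - F a <= RInt f a b.
Proof.
  intros Ha Hab Hb Hf HF Hle.
  set (G := fun t => RInt (fun u => f (clamp u)) 0 t).
  assert (HG : forall t, is_derive G t (f (clamp t)))
    by (intros t; now apply is_derive_RInt_clamp).
  assert (E : RInt f a b = G b - G a).
  { rewrite <- RInt_clamp by lra; unfold G.
    assert (Hex : forall u v, ex_RInt (fun u => f (clamp u)) u v).
    { intros u v; apply (ex_RInt_continuous_on _ m_infty); try exact I.
      intros w _; now apply clamp_continuous. }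
    assert (H := RInt_Rchasles (fun u => f (clamp u)) 0 a b (Hex _ _) (Hex _ _)); lra. }
  rewrite E.
  assert (G a - F a <= G b - F b); [| lra].
  apply (incr_of_derive_closed (fun t => G t - F t) (fun t => f (clamp t) - dF t)); auto.
  - intros t Ht; apply (is_derive_minus G F); auto.
  - intros t Ht; rewrite clamp_id by lra; specialize (Hle t Ht); lra.
Qed.

(** Serves twice: for the profile [m], and for the arc length of the tangential geodesic. *)
Lemma inverse_function (f df : R -> R) :
  (forall x, is_derive f x (df x)) -> (forall x, continuous df x) ->
  (forall x, 0 < df x) -> (forall v, exists x, f x = v) ->
  exists g : R -> R, (forall v, f (g v) = v) /\ (forall x, g (f x) = x) /\
    (forall v, is_derive g v (/ df (g v))) /\ (forall u v, u < v -> g u < g v).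
Proof.
  intros Hd Hdc Hp Hs.
  assert (Hinc : forall x y, x < y -> f x < f y).
  { intros x y Hxy.
    destruct (MVT_everywhere f df x y Hd) as [c [_ Hc]].
    assert (0 < df c * (y - x)) by (apply Rmult_lt_0_compat; [apply Hp | lra]); lra. }
  set (g := fun v => proj1_sig (constructive_indefinite_description _ (Hs v))).
  assert (Hg : forall v, f (g v) = v)
    by (intros v; unfold g; apply (proj2_sig (constructive_indefinite_description _ (Hs v)))).
  assert (Hginc : forall u v, u < v -> g u < g v).
  { intros u v Huv; destruct (Rlt_le_dec (g u) (g v)) as [H | H]; auto; exfalso.
    destruct H as [H | H].
    - apply Hinc in H; rewrite 2!Hg in H; lra.
    - apply (f_equal f) in H; rewrite 2!Hg in H; lra. }
  assert (Hgf : forall x, g (f x) = x).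
  { intros x; destruct (Rtotal_order (g (f x)) x) as [H | [H | H]]; auto; exfalso;
      apply Hinc in H; rewrite Hg in H; lra. }
  exists g; split; [auto | split; [auto | split; [| auto]]].
  assert (Hgc : forall v, continuous g v).
  { intros v; apply eps_continuous; intros eps He.
    assert (H1 : f (g v - eps) < v) by (rewrite <- (Hg v) at 2; apply Hinc; lra).
    assert (H2 : v < f (g v + eps)) by (rewrite <- (Hg v) at 1; apply Hinc; lra).
    exists (Rmin (v - f (g v - eps)) (f (g v + eps) - v)); split.
    - apply Rmin_pos; lra.
    - intros y Hy.
      assert (Hy1 := Rlt_le_trans _ _ _ Hy (Rmin_l _ _)).
      assert (Hy2 := Rlt_le_trans _ _ _ Hy (Rmin_r _ _)).
      apply Rabs_def2 in Hy1; apply Rabs_def2 in Hy2.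
      apply Rabs_def1.
      + assert (g y < g (f (g v + eps))) by (apply Hginc; lra); rewrite Hgf in H; lra.
      + assert (g (f (g v - eps)) < g y) by (apply Hginc; lra); rewrite Hgf in H; lra. }
  intros v; apply is_derive_Reals; intros eps He.
  (* By the mean value theorem the difference quotient of [g] is 1 / df(c) with c between g(v) and
     g(v + h); continuity of [g] and of 1 / df gives the limit. *)
  assert (Hc : continuous (fun u => / df u) (g v)).
  { apply (continuous_comp df Rinv); auto.
    apply continuity_pt_filterlim, continuity_pt_inv; [apply continuity_pt_id |].
    apply Rgt_not_eq, Hp. }
  destruct (continuous_eps _ _ _ Hc He) as [d [Hdp Hdd]].
  destruct (continuous_eps _ _ _ (Hgc v) Hdp) as [d' [Hdp' Hdd']].
  exists (mkposreal d' Hdp'); intros h Hh0 Hh; simpl in Hh.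
  destruct (MVT_everywhere f df (g v) (g (v + h)) Hd) as [c [Hc1 Hc2]].
  rewrite 2!Hg in Hc2.
  assert (Hcc := Hp c).
  assert (Hne : g (v + h) - g v <> 0) by (intros E; rewrite E, Rmult_0_r in Hc2; lra).
  replace ((g (v + h) - g v) / h) with (/ df c).
  + apply Hdd.
    assert (Hgh : Rabs (g (v + h) - g v) < d).
    { apply Hdd'; replace (v + h - v) with h by ring; auto. }
    apply Rle_lt_trans with (2 := Hgh).
    unfold Rmin, Rmax in Hc1; destruct (Rle_dec (g v) (g (v + h)));
      unfold Rabs; repeat destruct Rcase_abs; lra.
  + set (D := g (v + h) - g v) in *.
    assert (Eh : df c * D = h) by lra.
    transitivity (D / (df c * D)); [field; split; auto; lra | now rewrite Eh].
Qed.

Section RealRules.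
Context (f g : R -> R) (x df dg : R).

Lemma continuous_Rdiv :
  continuous f x -> continuous g x -> g x <> 0 -> continuous (fun t => f t / g t) x.
Proof.
  intros Hf Hg H; apply (continuous_mult f (fun t => / g t)); auto.
  now apply continuous_Rinv_comp.
Qed.
Lemma continuous_sqr : continuous f x -> continuous (fun t => f t ^ 2) x.
Proof.
  intros Hf; apply (continuous_ext (fun t => f t * f t)); [intros t; change (f t * f t = f t ^ 2); ring |].
  now apply (continuous_mult f f).
Qed.

Lemma is_derive_Rplus :
  is_derive f x df -> is_derive g x dg -> is_derive (fun t => f t + g t) x (df + dg).
Proof. apply (is_derive_plus f g). Qed.
Lemma is_derive_Rminus :
  is_derive f x df -> is_derive g x dg -> is_derive (fun t => f t - g t) x (df - dg).
Proof. apply (is_derive_minus f g). Qed.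
Lemma is_derive_Ropp : is_derive f x df -> is_derive (fun t => - f t) x (- df).
Proof. apply (is_derive_opp f). Qed.
Lemma is_derive_Rmult :
  is_derive f x df -> is_derive g x dg ->
  is_derive (fun t => f t * g t) x (df * g x + f x * dg).
Proof. intros; apply (is_derive_mult f g); auto; intros; apply Rmult_comm. Qed.
Lemma is_derive_sqr : is_derive f x df -> is_derive (fun t => f t ^ 2) x (2 * f x * df).
Proof.
  intros H; apply (is_derive_ext (fun t => f t * f t)); [intros t; change (f t * f t = f t ^ 2); ring |].
  apply is_derive_eq with (df * f x + f x * df); [| ring].
  apply (is_derive_mult f f); auto; intros; apply Rmult_comm.
Qed.
Lemma is_derive_Rcomp :
  is_derive f (g x) df -> is_derive g x dg -> is_derive (fun t => f (g t)) x (dg * df).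
Proof. apply (is_derive_comp f g). Qed.
Lemma is_derive_cos_comp : is_derive g x dg -> is_derive (fun t => cos (g t)) x (- sin (g x) * dg).
Proof.
  intros H; apply is_derive_eq with (dg * - sin (g x)); [| ring].
  apply (is_derive_comp cos g); auto; apply is_derive_cos.
Qed.
Lemma is_derive_sin_comp : is_derive g x dg -> is_derive (fun t => sin (g t)) x (cos (g x) * dg).
Proof.
  intros H; apply is_derive_eq with (dg * cos (g x)); [| ring].
  apply (is_derive_comp sin g); auto; apply is_derive_sin.
Qed.
Lemma is_derive_atan_comp :
  is_derive g x dg -> is_derive (fun t => atan (g t)) x (dg / (1 + g x ^ 2)).
Proof.
  intros H; apply is_derive_eq with (dg * / (1 + (g x)²)); [| unfold Rsqr, Rdiv; do 2 f_equal; ring].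
  apply (is_derive_comp atan g); auto; apply is_derive_atan.
Qed.
End RealRules.

Lemma is_derive_Rconst (a x : R) : is_derive (fun _ : R => a) x 0.
Proof. apply (is_derive_const (V := R_NormedModule)). Qed.
Lemma is_derive_Rid (x : R) : is_derive (fun t : R => t) x 1.
Proof. apply (is_derive_id (K := R_AbsRing)). Qed.

Ltac cont :=
  lazymatch goal with
  | |- continuous (fun _ => ?c) _ => apply continuous_const
  | |- continuous (fun t => t) _ => apply continuous_id
  | |- continuous (fun t => @?f t + @?g t) _ => apply (continuous_plus f g); cont
  | |- continuous (fun t => @?f t - @?g t) _ => apply (continuous_minus f g); cont
  | |- continuous (fun t => - @?f t) _ => apply (continuous_opp f); cont
  | |- continuous (fun t => @?f t * @?g t) _ => apply (continuous_mult f g); cont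
  | |- continuous (fun t => @?f t / @?g t) _ => apply (continuous_Rdiv f g); [cont | cont |]
  | |- continuous (fun t => / @?f t) _ => apply (continuous_Rinv_comp f); [cont |]
  | |- continuous (fun t => @?f t ^ 2) _ => apply (continuous_sqr f); cont
  | |- continuous (fun t => sqrt (@?f t)) _ => apply (continuous_sqrt_comp f); cont
  | |- continuous (fun t => cos (@?f t)) _ => apply (continuous_cos_comp f); cont
  | |- continuous (fun t => sin (@?f t)) _ => apply (continuous_sin_comp f); cont
  | |- continuous (fun t => atan (@?f t)) _ => apply (continuous_atan_comp f); cont
  | |- _ => try assumption
  end.

Ltac deriv :=
  lazymatch goal with
  | |- is_derive (fun _ => ?c) _ _ => apply is_derive_Rconst
  | |- is_derive (fun t => t) _ _ => apply is_derive_Rid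
  | |- is_derive (fun t => @?f t + @?g t) _ _ => eapply (is_derive_Rplus f g); deriv
  | |- is_derive (fun t => @?f t - @?g t) _ _ => eapply (is_derive_Rminus f g); deriv
  | |- is_derive (fun t => - @?f t) _ _ => eapply (is_derive_Ropp f); deriv
  | |- is_derive (fun t => @?f t * @?g t) _ _ => eapply (is_derive_Rmult f g); deriv
  | |- is_derive (fun t => @?f t / @?g t) _ _ => eapply (is_derive_div f g); [deriv | deriv |]
  | |- is_derive (fun t => / @?f t) _ _ => eapply (is_derive_inv f); [deriv |]
  | |- is_derive (fun t => @?f t ^ 2) _ _ => eapply (is_derive_sqr f); deriv
  | |- is_derive (fun t => sqrt (@?f t)) _ _ => eapply (is_derive_sqrt f); [deriv |]
  | |- is_derive (fun t => cos (@?f t)) _ _ => eapply (is_derive_cos_comp f); deriv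
  | |- is_derive (fun t => sin (@?f t)) _ _ => eapply (is_derive_sin_comp f); deriv
  | |- is_derive (fun t => atan (@?f t)) _ _ => eapply (is_derive_atan_comp f); deriv
  | |- _ => try eassumption
  end.

Ltac deriv_eq := eapply is_derive_eq; [deriv |].

(** Cauchy-Schwarz; in use [a] and [b] are the angular and radial components of a calibrating
    gradient, [Y] and [X] those of a velocity. *)
Lemma le_sqrt_sum_sqr (a b X Y : R) : a ^ 2 + b ^ 2 <= 1 -> a * Y + b * X <= sqrt (X ^ 2 + Y ^ 2).
Proof.
  intros H; apply Rsqr_incr_0_var; [| apply sqrt_pos].
  rewrite Rsqr_sqrt by nra; unfold Rsqr.
  assert (0 <= (a * X - b * Y) ^ 2) by apply pow2_ge_0.
  assert (0 <= (1 - (a ^ 2 + b ^ 2)) * (X ^ 2 + Y ^ 2)) by (apply Rmult_le_pos; nra).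
  nra.
Qed.

Lemma sqrt_sqr_eq (x : R) : 0 <= x -> sqrt x ^ 2 = x.
Proof. intros; now apply pow2_sqrt. Qed.

(** * Rotationally symmetric metrics and distances *)

(** The first-order form of the hypotheses: nonnegative curvature appears as monotonicity of m' on
    the half-line. Second derivatives return only in the von Mangoldt part. *)
Definition concave_profile (m : R -> R) : Prop :=
  (forall x, is_derive m x (Derive m x)) /\ (forall x, continuous (Derive m) x) /\
  (forall x, m (- x) = - m x) /\ m 0 = 0 /\ Derive m 0 = 1 /\
  (forall r, 0 < r -> 0 < m r) /\
  (forall r s, 0 <= r -> r <= s -> Derive m s <= Derive m r) /\
  (forall r, 0 <= r -> 0 <= Derive m r).

Definition rad (q : pt) : R := sqrt (fst q ^ 2 + snd q ^ 2).
Definition pol (r t : R) : pt := (r * cos t, r * sin t).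
Definition speed (m : R -> R) (c1 c2 : R -> R) (t : R) : R :=
  sqrt (gm m (c1 t, c2 t) (Derive c1 t, Derive c2 t) (Derive c1 t, Derive c2 t)).

Lemma rad_pos (q : pt) : 0 <= rad q.
Proof. apply sqrt_pos. Qed.

Lemma rad_sqr (q : pt) : rad q ^ 2 = fst q ^ 2 + snd q ^ 2.
Proof. apply sqrt_sqr_eq; nra. Qed.

Lemma rad_pol (r t : R) : 0 <= r -> rad (pol r t) = r.
Proof.
  intros Hr; unfold rad, pol; simpl fst; simpl snd.
  replace ((r * cos t) ^ 2 + (r * sin t) ^ 2) with (r ^ 2 * ((sin t)² + (cos t)²))
    by (unfold Rsqr; ring).
  rewrite sin2_cos2, Rmult_1_r; now apply sqrt_pow2.
Qed.

Lemma polar_form (q : pt) : exists a, q = pol (rad q) a.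
Proof.
  destruct q as [u v]; set (r := rad (u, v)).
  destruct (Req_dec r 0) as [E | E].
  { exists 0; rewrite E; unfold pol.
    assert (H := rad_sqr (u, v)); fold r in H; rewrite E in H; simpl in H.
    f_equal; nra. }
  assert (Hr : 0 < r) by (assert (H := rad_pos (u, v)); fold r in H; lra).
  assert (H := rad_sqr (u, v)); fold r in H; simpl fst in H; simpl snd in H.
  assert (Hu : -1 <= u / r <= 1).
  { split; [apply Rle_div_r | apply Rle_div_l]; try lra; nra. }
  assert (Hs : sin (acos (u / r)) = Rabs v / r).
  { rewrite sin_acos by lra.
    replace (1 - (u / r)²) with ((v / r)²).
    - rewrite sqrt_Rsqr_abs; unfold Rdiv; rewrite Rabs_mult, Rabs_inv, (Rabs_pos_eq r) by lra; auto.
    - unfold Rsqr; apply Rmult_eq_reg_r with (r ^ 2); [field_simplify; try lra; nra | nra]. }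
  destruct (Rle_lt_dec 0 v) as [Hv | Hv].
  - exists (acos (u / r)); unfold pol.
    rewrite cos_acos, Hs, Rabs_pos_eq by lra; f_equal; field; lra.
  - exists (- acos (u / r)); unfold pol.
    rewrite cos_neg, sin_neg, cos_acos, Hs, Rabs_left by lra; f_equal; field; lra.
Qed.

Section Profile.
Context (m : R -> R) (Hm : concave_profile m).

Lemma profile_derive x : is_derive m x (Derive m x).
Proof. apply Hm. Qed.
Lemma profile_derive_continuous x : continuous (Derive m) x.
Proof. apply Hm. Qed.
Lemma profile_continuous x : continuous m x.
Proof. apply derive_continuous with (1 := profile_derive x). Qed.
Lemma profile_0 : m 0 = 0.
Proof. apply Hm. Qed.
Lemma profile_pos r : 0 < r -> 0 < m r.
Proof. apply Hm. Qed.
Lemma profile_derive_decr r s : 0 <= r -> r <= s -> Derive m s <= Derive m r.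
Proof. apply Hm. Qed.
Lemma profile_derive_pos r : 0 <= r -> 0 <= Derive m r.
Proof. apply Hm. Qed.
Lemma profile_derive_le_1 r : 0 <= r -> Derive m r <= 1.
Proof.
  intros Hr; assert (E : Derive m 0 = 1) by apply Hm; rewrite <- E.
  apply profile_derive_decr; lra.
Qed.

Lemma profile_incr r s : 0 <= r -> r <= s -> m r <= m s.
Proof.
  intros Hr Hs; apply (incr_of_derive_closed m (Derive m)); auto.
  - intros; apply profile_derive.
  - intros; apply profile_derive_pos; lra.
Qed.

Lemma profile_lipschitz r s : 0 <= r -> r <= s -> m s - m r <= s - r.
Proof.
  intros Hr Hs.
  assert (r - m r <= s - m s); [| lra].
  apply (incr_of_derive_closed (fun t => t - m t) (fun t => 1 - Derive m t)); auto.
  - intros t Ht; assert (Hd := profile_derive t); deriv.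
  - intros t Ht; assert (H := profile_derive_le_1 t); lra.
Qed.

Lemma profile_le_id r : 0 <= r -> m r <= r.
Proof. intros Hr; assert (H := profile_lipschitz 0 r); rewrite profile_0 in H; lra. Qed.

Lemma profile_nonneg r : 0 <= r -> 0 <= m r.
Proof. intros [H | <-]; [left; now apply profile_pos | rewrite profile_0; lra]. Qed.

Lemma profile_null_or_pos k y : 0 <= y -> 0 <= k <= m y -> k = 0 \/ 0 < y.
Proof. intros [Hy | <-] Hk; [auto | rewrite profile_0 in Hk; lra]. Qed.

Lemma gm_self_origin q v : rad q = 0 -> gm m q v v = fst v ^ 2 + snd v ^ 2.
Proof.
  intros E; unfold gm; fold (rad q); destruct (Req_EM_T (rad q) 0); [ring | contradiction].
Qed.

Lemma gm_self_polar q v : rad q <> 0 ->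
  gm m q v v =
  ((fst v * fst q + snd v * snd q) / rad q) ^ 2 +
  (m (rad q) * ((snd v * fst q - fst v * snd q) / rad q ^ 2)) ^ 2.
Proof.
  intros E; unfold gm; fold (rad q); destruct (Req_EM_T (rad q) 0); [contradiction |].
  field; auto.
Qed.

(** Since m(r) <= r, passing from the Euclidean metric to [gm] shrinks the angular component by m(r)
    / r and keeps the radial one. At the origin the left side is 0, because m 0 / 0 is 0. *)
Lemma gm_self_bounds q v :
  (m (rad q) / rad q) ^ 2 * (fst v ^ 2 + snd v ^ 2) <= gm m q v v <= fst v ^ 2 + snd v ^ 2.
Proof.
  destruct (Req_dec (rad q) 0) as [E | E].
  - rewrite gm_self_origin, E, profile_0 by auto; unfold Rdiv; rewrite Rmult_0_l; nra.
  - rewrite gm_self_polar by auto.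
    assert (Hr := rad_pos q); assert (Hs := rad_sqr q).
    set (r := rad q) in *; destruct q as [a b], v as [u w]; simpl fst in *; simpl snd in *.
    assert (Hmr : 0 <= m r / r <= 1).
    { split; [apply Rdiv_le_0_compat; [apply profile_nonneg |]; lra |].
      apply Rle_div_l; [lra |]; rewrite Rmult_1_l; now apply profile_le_id. }
    set (e := m r / r) in *.
    replace (m r * ((w * a - u * b) / r ^ 2)) with (e * ((w * a - u * b) / r))
      by (unfold e; field; auto).
    assert (Es : u ^ 2 + w ^ 2 = ((u * a + w * b) / r) ^ 2 + ((w * a - u * b) / r) ^ 2).
    { transitivity ((u ^ 2 + w ^ 2) * (a ^ 2 + b ^ 2) / r ^ 2);
        [rewrite <- Hs; field; auto | field; auto]. }
    rewrite Es; set (X := (u * a + w * b) / r); set (Y := (w * a - u * b) / r).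
    assert (0 <= e ^ 2 <= 1) by nra.
    assert (0 <= X ^ 2) by apply pow2_ge_0; assert (0 <= Y ^ 2) by apply pow2_ge_0.
    rewrite Rpow_mult_distr; nra.
Qed.

Lemma continuous_rad_curve (c1 c2 : R -> R) (t : R) :
  continuous c1 t -> continuous c2 t -> continuous (fun u : R => rad (c1 u, c2 u)) t.
Proof. intros H1 H2; unfold rad; simpl fst; simpl snd; cont. Qed.

(** Extended by the limit m'(0) = 1, which makes it continuous at 0. *)
Definition radial_ratio (r : R) : R := if Req_EM_T r 0 then 1 else m r / r.

Lemma quotient_continuous : continuous radial_ratio 0.
Proof.
  unfold radial_ratio; apply eps_continuous; intros eps He.
  assert (Hd := profile_derive 0); apply is_derive_Reals in Hd.
  destruct (Hd eps He) as [d Hdd]; exists d; split; [apply cond_pos |].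
  intros y Hy; destruct (Req_EM_T 0 0) as [_ | n]; [| now destruct n].
  destruct (Req_EM_T y 0) as [E | E].
  - rewrite Rminus_diag, Rabs_R0; auto.
  - replace (m y / y) with ((m (0 + y) - m 0) / y) by (rewrite Rplus_0_l, profile_0, Rminus_0_r; auto).
    assert (E1 : Derive m 0 = 1) by apply Hm; rewrite <- E1.
    apply Hdd; auto; now rewrite Rminus_0_r in Hy.
Qed.

(** The polar expression of the metric is singular at the origin. There the squared speed is
    squeezed between the squared Euclidean speed and its product with [radial_ratio] squared;
    elsewhere the polar expression is continuous. *)
Lemma continuous_speed c1 c2 t :
  C1_curve c1 c2 -> 0 <= t <= 1 -> continuous (speed m c1 c2) t.
Proof.
  intros HC Ht; destruct (HC t Ht) as [H1 [H1' [H2 H2']]].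
  apply (ex_derive_continuous (V := R_NormedModule)) in H1, H2.
  unfold speed; apply continuous_sqrt_comp.
  assert (Hr := continuous_rad_curve c1 c2 t H1 H2).
  destruct (Req_dec (rad (c1 t, c2 t)) 0) as [E | E].
  - set (n2 := fun u => Derive c1 u ^ 2 + Derive c2 u ^ 2).
    assert (Hn : continuous n2 t) by (unfold n2; cont).
    set (e := radial_ratio).
    assert (Hq : continuous (fun u => e (rad (c1 u, c2 u))) t).
    { apply (continuous_comp (fun u => rad (c1 u, c2 u)) e); auto.
      rewrite E; apply quotient_continuous. }
    assert (Eq : e (rad (c1 t, c2 t)) = 1)
      by (rewrite E; unfold e, radial_ratio; now destruct (Req_EM_T 0 0)).
    assert (Hl : continuous (fun u => e (rad (c1 u, c2 u)) ^ 2 * n2 u) t) by cont.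
    assert (Ev : gm m (c1 t, c2 t) (Derive c1 t, Derive c2 t) (Derive c1 t, Derive c2 t) = n2 t)
      by now rewrite gm_self_origin.
    unfold continuous in *; rewrite Ev; rewrite Eq in Hl.
    replace (1 ^ 2 * n2 t) with (n2 t) in Hl by ring.
    apply (filterlim_le_le (F := locally t) (fun u => e (rad (c1 u, c2 u)) ^ 2 * n2 u) _ n2 (n2 t));
      [| exact Hl | exact Hn].
    apply filter_forall; intros u; split.
    + unfold e, radial_ratio; destruct (Req_EM_T (rad (c1 u, c2 u)) 0) as [E0 | E0].
      * rewrite gm_self_origin by auto; unfold n2; simpl; lra.
      * apply (gm_self_bounds (c1 u, c2 u) (Derive c1 u, Derive c2 u)).
    + apply (gm_self_bounds (c1 u, c2 u) (Derive c1 u, Derive c2 u)).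
  - apply (continuous_ext_loc _ (fun u =>
      ((Derive c1 u * c1 u + Derive c2 u * c2 u) / rad (c1 u, c2 u)) ^ 2 +
      (m (rad (c1 u, c2 u)) *
       ((Derive c2 u * c1 u - Derive c1 u * c2 u) / rad (c1 u, c2 u) ^ 2)) ^ 2)).
    + assert (Hn : locally (rad (c1 t, c2 t)) (fun r => r <> 0)).
      { apply (open_neq 0); auto. }
      apply (filter_imp (F := locally t) (fun u => rad (c1 u, c2 u) <> 0)); [| exact (Hr _ Hn)].
      intros u Hu; now rewrite gm_self_polar.
    + assert (Hmr : continuous (fun u => m (rad (c1 u, c2 u))) t)
        by (apply (continuous_comp (fun u => rad (c1 u, c2 u)) m); auto; apply profile_continuous).
      assert (rad (c1 t, c2 t) ^ 2 <> 0) by (apply pow_nonzero; auto).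
      cont; assumption.
Qed.

Lemma speed_nonneg c1 c2 t : 0 <= speed m c1 c2 t.
Proof. apply sqrt_pos. Qed.

Lemma speed_ex_RInt c1 c2 a b :
  C1_curve c1 c2 -> 0 <= a -> a <= b -> b <= 1 -> ex_RInt (speed m c1 c2) a b.
Proof.
  intros HC Ha Hab Hb; apply (ex_RInt_continuous (V := R_CompleteNormedModule)).
  intros z Hz; rewrite Rmin_left, Rmax_right in Hz by lra; apply continuous_speed; auto; lra.
Qed.

Lemma curve_length_split c1 c2 s :
  C1_curve c1 c2 -> 0 <= s <= 1 ->
  curve_length m c1 c2 = RInt (speed m c1 c2) 0 s + RInt (speed m c1 c2) s 1.
Proof.
  intros HC Hs; symmetry.
  apply (RInt_Rchasles (speed m c1 c2) 0 s 1); apply speed_ex_RInt; auto; lra.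
Qed.

Lemma curve_length_nonneg c1 c2 : C1_curve c1 c2 -> 0 <= curve_length m c1 c2.
Proof.
  intros HC; apply RInt_pos_le; [lra | apply speed_ex_RInt; auto; lra | intros; apply speed_nonneg].
Qed.

Definition segment (a b : R) (t : R) : R := a + t * (b - a).

Lemma segment_derive a b t : is_derive (segment a b) t (b - a).
Proof. unfold segment; deriv_eq; ring. Qed.

Lemma segment_C1 p q : C1_curve (segment (fst p) (fst q)) (segment (snd p) (snd q)).
Proof.
  assert (H : forall a b t, ex_derive (segment a b) t /\ continuous (Derive (segment a b)) t).
  { intros a b t; split; [exists (b - a); apply segment_derive |].
    apply (continuous_ext (fun _ => b - a)); [| apply continuous_const].
    intros u; symmetry; apply is_derive_unique, segment_derive. }
  intros t _; destruct (H (fst p) (fst q) t), (H (snd p) (snd q) t); auto.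
Qed.

Lemma segment_length p q :
  curve_length m (segment (fst p) (fst q)) (segment (snd p) (snd q)) <=
  sqrt ((fst q - fst p) ^ 2 + (snd q - snd p) ^ 2).
Proof.
  apply Rle_trans with (RInt (fun _ => sqrt ((fst q - fst p) ^ 2 + (snd q - snd p) ^ 2)) 0 1).
  - apply RInt_le; [lra | apply speed_ex_RInt; [apply segment_C1 | lra | lra | lra]
                   | apply ex_RInt_const |].
    intros t _; apply sqrt_le_1_alt.
    eapply Rle_trans; [apply gm_self_bounds |].
    simpl fst; simpl snd.
    rewrite (is_derive_unique _ _ _ (segment_derive (fst p) (fst q) t)).
    rewrite (is_derive_unique _ _ _ (segment_derive (snd p) (snd q) t)); lra.
  - rewrite RInt_Rconst; lra.
Qed.

Lemma curve_exists p q :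
  exists c1 c2, C1_curve c1 c2 /\ (c1 0, c2 0) = p /\ (c1 1, c2 1) = q /\
    curve_length m c1 c2 <= sqrt ((fst q - fst p) ^ 2 + (snd q - snd p) ^ 2).
Proof.
  exists (segment (fst p) (fst q)), (segment (snd p) (snd q)).
  split; [apply segment_C1 |]; split; [| split; [| apply segment_length]];
    [destruct p | destruct q]; unfold segment; simpl; f_equal; ring.
Qed.

(** The set of lengths is nonempty, by the straight segment, and bounded below by 0. Its infimum is
    therefore finite, and [real] does not return its default value. *)
Lemma dist_m_glb p q :
  is_glb_Rbar (fun L => exists c1 c2 : R -> R,
     C1_curve c1 c2 /\ (c1 0, c2 0) = p /\ (c1 1, c2 1) = q /\ L = curve_length m c1 c2)
    (dist_m m p q).
Proof.
  unfold dist_m; set (E := fun L => _).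
  destruct (Glb_Rbar_correct E) as [Hlb Hg].
  destruct (curve_exists p q) as [c1 [c2 [HC [H0 [H1 _]]]]].
  assert (HE : E (curve_length m c1 c2)) by (exists c1, c2; auto).
  assert (H2 := Hlb _ HE).
  assert (H3 : Rbar_le 0 (Glb_Rbar E)).
  { apply Hg; intros L [d1 [d2 [HD [_ [_ ->]]]]]; simpl; now apply curve_length_nonneg. }
  destruct (Glb_Rbar E); simpl in *; try contradiction; split; auto.
Qed.

Lemma dist_m_le p q c1 c2 :
  C1_curve c1 c2 -> (c1 0, c2 0) = p -> (c1 1, c2 1) = q -> dist_m m p q <= curve_length m c1 c2.
Proof.
  intros HC H0 H1; apply (proj1 (dist_m_glb p q)); exists c1, c2; auto.
Qed.

Lemma dist_m_ge p q D :
  (forall c1 c2, C1_curve c1 c2 -> (c1 0, c2 0) = p -> (c1 1, c2 1) = q ->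
     D <= curve_length m c1 c2) -> D <= dist_m m p q.
Proof.
  intros H; apply (proj2 (dist_m_glb p q) D); intros L [c1 [c2 [HC [H0 [H1 ->]]]]].
  now apply H.
Qed.

Lemma dist_m_approx p q eps : 0 < eps ->
  exists c1 c2, C1_curve c1 c2 /\ (c1 0, c2 0) = p /\ (c1 1, c2 1) = q /\
    curve_length m c1 c2 < dist_m m p q + eps.
Proof.
  intros He; apply NNPP; intros HN.
  assert (dist_m m p q + eps <= dist_m m p q); [| lra].
  apply dist_m_ge; intros c1 c2 HC H0 H1.
  destruct (Rle_lt_dec (dist_m m p q + eps) (curve_length m c1 c2)); auto.
  exfalso; apply HN; exists c1, c2; auto.
Qed.

Lemma dist_m_le_euclid p q :
  dist_m m p q <= sqrt ((fst q - fst p) ^ 2 + (snd q - snd p) ^ 2).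
Proof.
  destruct (curve_exists p q) as [c1 [c2 [HC [H0 [H1 H]]]]].
  apply Rle_trans with (2 := H); now apply dist_m_le.
Qed.

(** * Bounds for the length of curves *)

(** Radial speed of a unit speed geodesic of Clairaut constant k, and radial component of the
    calibrating gradient whose angular component is k / m. Where 0 < m r < k the square root makes
    it 0. *)
Definition slope (k r : R) : R := sqrt (1 - (k / m r) ^ 2).
Definition slope_int (k a b : R) : R := RInt (slope k) a b.

Lemma slope_bounds k r : 0 <= slope k r <= 1.
Proof.
  split; [apply sqrt_pos |]; unfold slope.
  rewrite <- sqrt_1 at 2; apply sqrt_le_1_alt; assert (H := pow2_ge_0 (k / m r)); lra.
Qed.

Lemma slope_0 r : slope 0 r = 1.
Proof. unfold slope, Rdiv; rewrite Rmult_0_l; replace (1 - 0 ^ 2) with 1 by ring; apply sqrt_1. Qed.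

(** The disjunction is there for curves through the origin: they are calibrated with k = 0, where
    [slope] is constantly 1, while a positive k confines the radii to r > 0. *)
Lemma slope_continuous k r : k = 0 \/ 0 < r -> continuous (slope k) r.
Proof.
  intros [-> | Hr].
  - apply (continuous_ext (fun _ => 1)); [intros u; symmetry; apply slope_0 | apply continuous_const].
  - assert (H := profile_continuous r); assert (H1 := profile_pos r Hr).
    unfold slope; cont; lra.
Qed.

Lemma slope_ex_RInt k a b : k = 0 \/ 0 < a /\ 0 < b -> ex_RInt (slope k) a b.
Proof.
  intros [-> | [Ha Hb]].
  - apply ex_RInt_continuous_on with m_infty; try exact I.
    intros; apply slope_continuous; auto.
  - apply ex_RInt_continuous_on with 0; auto.
    intros u Hu; apply slope_continuous; auto.
Qed.

Lemma slope_int_derive k a r : k = 0 \/ 0 < a /\ 0 < r ->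
  is_derive (fun r => slope_int k a r) r (slope k r).
Proof.
  intros [-> | [Ha Hb]].
  - apply is_derive_RInt_on with m_infty; try exact I.
    intros; apply slope_continuous; auto.
  - apply is_derive_RInt_on with 0; auto.
    intros u Hu; apply slope_continuous; auto.
Qed.

Lemma slope_int_chasles k a b c : k = 0 \/ 0 < a /\ 0 < b /\ 0 < c ->
  slope_int k a b + slope_int k b c = slope_int k a c.
Proof.
  intros H; apply (RInt_Rchasles (slope k)); apply slope_ex_RInt; tauto.
Qed.

Lemma slope_int_self k a : slope_int k a a = 0.
Proof. apply RInt_Rpoint. Qed.

Lemma slope_int_swap k a b : k = 0 \/ 0 < a /\ 0 < b -> slope_int k a b = - slope_int k b a.
Proof.
  intros H; assert (E := slope_int_chasles k a b a); rewrite slope_int_self in E.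
  assert (slope_int k a b + slope_int k b a = 0) by (apply E; tauto); lra.
Qed.

Lemma slope_int_bounds k a b : k = 0 \/ 0 < a -> a <= b -> 0 <= slope_int k a b <= b - a.
Proof.
  intros H Hab; assert (Hex : ex_RInt (slope k) a b)
    by (apply slope_ex_RInt; destruct H; [tauto | right; lra]).
  split.
  - apply RInt_pos_le; auto; intros; apply slope_bounds.
  - apply Rle_trans with (RInt (fun _ => 1) a b).
    + apply RInt_le; auto; [apply ex_RInt_const | intros; apply slope_bounds].
    + rewrite RInt_Rconst; lra.
Qed.

Lemma slope_int_0 a b : slope_int 0 a b = b - a.
Proof.
  unfold slope_int; rewrite (RInt_ext (slope 0) (fun _ => 1)) by (intros; apply slope_0).
  rewrite RInt_Rconst; ring.
Qed.

Lemma C1_curve_derive c1 c2 t : C1_curve c1 c2 -> 0 <= t <= 1 ->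
  is_derive c1 t (Derive c1 t) /\ is_derive c2 t (Derive c2 t) /\
  continuous c1 t /\ continuous c2 t /\ continuous (Derive c1) t /\ continuous (Derive c2) t.
Proof.
  intros HC Ht; destruct (HC t Ht) as [H1 [H1' [H2 H2']]].
  repeat split; auto; try (now apply Derive_correct);
    apply (ex_derive_continuous (V := R_NormedModule)); auto.
Qed.

(** [rad] is not differentiable at the origin. It is replaced by sqrt (e^2 + rad^2), which is
    smooth, has derivative at most the speed along the curve, and differs from [rad] by at most
    e. *)
Lemma rad_increment_le c1 c2 a b :
  C1_curve c1 c2 -> 0 <= a -> a <= b -> b <= 1 ->
  Rabs (rad (c1 b, c2 b) - rad (c1 a, c2 a)) <= RInt (speed m c1 c2) a b.
Proof.
  intros HC Ha Hab Hb.
  assert (Hspeed : forall t, 0 <= t <= 1 -> forall e, 0 < e ->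
    Rabs ((Derive c1 t * c1 t + Derive c2 t * c2 t) / sqrt (e ^ 2 + c1 t ^ 2 + c2 t ^ 2))
      <= speed m c1 c2 t).
  { intros t Ht e He; assert (Hr := rad_pos (c1 t, c2 t)); assert (Hr2 := rad_sqr (c1 t, c2 t)).
    simpl fst in Hr2; simpl snd in Hr2.
    assert (Hq : rad (c1 t, c2 t) <= sqrt (e ^ 2 + c1 t ^ 2 + c2 t ^ 2)).
    { unfold rad; simpl fst; simpl snd; apply sqrt_le_1_alt; nra. }
    assert (Hqp : 0 < sqrt (e ^ 2 + c1 t ^ 2 + c2 t ^ 2)) by (apply sqrt_lt_R0; nra).
    destruct (Req_dec (rad (c1 t, c2 t)) 0) as [E | E].
    - rewrite E in Hr2; assert (E1 : c1 t = 0) by nra; assert (E2 : c2 t = 0) by nra.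
      rewrite E1, E2, 2!Rmult_0_r, Rplus_0_r; unfold Rdiv; rewrite Rmult_0_l, Rabs_R0.
      apply sqrt_pos.
    - unfold speed; rewrite gm_self_polar by auto; simpl fst; simpl snd.
      set (r := rad (c1 t, c2 t)) in *.
      set (X := Derive c1 t * c1 t + Derive c2 t * c2 t).
      apply Rle_trans with (Rabs (X / r)).
      + unfold Rdiv; rewrite 2!Rabs_mult; apply Rmult_le_compat_l; [apply Rabs_pos |].
        rewrite 2!Rabs_inv, 2!Rabs_pos_eq by lra; apply Rinv_le_contravar; lra.
      + rewrite <- sqrt_Rsqr_abs; apply sqrt_le_1_alt.
        unfold Rsqr; match goal with |- _ <= _ + ?Y ^ 2 => assert (H := pow2_ge_0 Y) end; nra. }
  assert (Hinc : forall e, 0 < e -> forall s, s = 1 \/ s = -1 ->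
    s * (rad (c1 b, c2 b) - rad (c1 a, c2 a)) <= RInt (speed m c1 c2) a b + e).
  { intros e He s Hs.
    set (F := fun t => s * sqrt (e ^ 2 + c1 t ^ 2 + c2 t ^ 2)).
    assert (HF : F b - F a <= RInt (speed m c1 c2) a b).
    { apply RInt_ge_increment with (dF := fun t => s *
        ((Derive c1 t * c1 t + Derive c2 t * c2 t) / sqrt (e ^ 2 + c1 t ^ 2 + c2 t ^ 2))); auto.
      - intros u Hu; now apply continuous_speed.
      - intros u Hu; destruct (C1_curve_derive c1 c2 u HC) as [H1 [H2 _]]; [lra |].
        assert (Hqp : 0 < sqrt (e ^ 2 + c1 u ^ 2 + c2 u ^ 2)) by (apply sqrt_lt_R0; nra).
        unfold F; eapply is_derive_eq; [deriv; nra | field; lra].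
      - intros u Hu; apply Rle_trans with (2 := Hspeed u ltac:(lra) e He).
        match goal with |- s * ?Z <= _ => assert (H1 := Rle_abs Z); assert (H2 := Rle_abs (- Z)) end.
        rewrite Rabs_Ropp in H2; destruct Hs; subst s; lra. }
    assert (Hb2 : forall t, rad (c1 t, c2 t) <= sqrt (e ^ 2 + c1 t ^ 2 + c2 t ^ 2)
                            <= rad (c1 t, c2 t) + e).
    { intros t; assert (Hr := rad_pos (c1 t, c2 t)); assert (Hr2 := rad_sqr (c1 t, c2 t)).
      simpl fst in Hr2; simpl snd in Hr2; split.
      - unfold rad; simpl fst; simpl snd; apply sqrt_le_1_alt; nra.
      - rewrite <- (sqrt_pow2 (rad (c1 t, c2 t) + e)) by lra; apply sqrt_le_1_alt; nra. }
    assert (Ba := Hb2 a); assert (Bb := Hb2 b); unfold F in HF.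
    destruct Hs; subst s; lra. }
  apply Rnot_lt_le; intros Hlt.
  set (D := rad (c1 b, c2 b) - rad (c1 a, c2 a)) in *.
  set (I := RInt (speed m c1 c2) a b) in *.
  assert (H1 := Hinc ((Rabs D - I) / 2) ltac:(lra) 1 ltac:(auto)).
  assert (H2 := Hinc ((Rabs D - I) / 2) ltac:(lra) (-1) ltac:(auto)).
  unfold Rabs in *; destruct (Rcase_abs D); lra.
Qed.

Lemma dist_m_ge_rad p q : Rabs (rad q - rad p) <= dist_m m p q.
Proof.
  apply dist_m_ge; intros c1 c2 HC H0 H1.
  rewrite <- H0, <- H1; apply rad_increment_le; auto; lra.
Qed.

Lemma dist_m_origin q : dist_m m origin q = rad q.
Proof.
  assert (E : rad origin = 0).
  { assert (H := rad_sqr origin); simpl in H; nra. }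
  apply Rle_antisym.
  - eapply Rle_trans; [apply dist_m_le_euclid; auto |]; unfold rad, origin; simpl fst; simpl snd.
    right; f_equal; ring.
  - assert (H := dist_m_ge_rad origin q); rewrite E, Rminus_0_r, Rabs_pos_eq in H; auto.
    apply rad_pos.
Qed.

Lemma rad_derive c1 c2 t : C1_curve c1 c2 -> 0 <= t <= 1 -> 0 < rad (c1 t, c2 t) ->
  is_derive (fun t => rad (c1 t, c2 t)) t
    ((Derive c1 t * c1 t + Derive c2 t * c2 t) / rad (c1 t, c2 t)).
Proof.
  intros HC Ht Hr; destruct (C1_curve_derive c1 c2 t HC Ht) as [H1 [H2 _]].
  assert (Hr2 := rad_sqr (c1 t, c2 t)); cbn [fst snd] in Hr2.
  assert (0 < c1 t ^ 2 + c2 t ^ 2) by nra.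
  unfold rad in *; cbn [fst snd] in *.
  eapply is_derive_eq; [deriv; assumption | field; lra].
Qed.

(** The angle is the integral of (x dy - y dx) / r^2. The unit vector (X, Y) obtained by rotating
    the position back by this angle has zero derivative, hence keeps its initial value (1, 0). *)
Lemma polar_lift c1 c2 a : C1_curve c1 c2 ->
  (forall t, 0 <= t <= 1 -> 0 < rad (c1 t, c2 t)) ->
  (c1 0, c2 0) = pol (rad (c1 0, c2 0)) a ->
  exists th : R -> R, th 0 = a /\
    (forall t, 0 <= t <= 1 ->
       is_derive th t ((Derive c2 t * c1 t - Derive c1 t * c2 t) / rad (c1 t, c2 t) ^ 2)) /\
    (forall t, 0 <= t <= 1 -> (c1 t, c2 t) = pol (rad (c1 t, c2 t)) (th t)).
Proof.
  intros HC Hr H0.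
  set (w := fun t => (Derive c2 t * c1 t - Derive c1 t * c2 t) / rad (c1 t, c2 t) ^ 2).
  assert (Hw : forall u, 0 <= u <= 1 -> continuous w u).
  { intros u Hu; destruct (C1_curve_derive c1 c2 u HC Hu) as [_ [_ [H1 [H2 [H3 H4]]]]].
    assert (Hc := continuous_rad_curve c1 c2 u H1 H2).
    assert (rad (c1 u, c2 u) ^ 2 <> 0) by (apply pow_nonzero, Rgt_not_eq, Hr, Hu).
    unfold w; cont; assumption. }
  set (th := fun t => a + RInt (fun u => w (clamp u)) 0 t).
  assert (Hth : forall t, 0 <= t <= 1 -> is_derive th t (w t)).
  { intros t Ht; assert (H := is_derive_RInt_clamp w t Hw); rewrite clamp_id in H by auto.
    unfold th; deriv_eq; ring. }
  assert (E0 : th 0 = a).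
  { unfold th; rewrite RInt_Rpoint; ring. }
  exists th; split; [exact E0 | split; [exact Hth |]].
  intros t Ht.
  set (X := fun t => (c1 t * cos (th t) + c2 t * sin (th t)) / rad (c1 t, c2 t)).
  set (Y := fun t => (c2 t * cos (th t) - c1 t * sin (th t)) / rad (c1 t, c2 t)).
  assert (HX : X t = X 0 /\ Y t = Y 0).
  { assert (Hd : forall u, 0 <= u <= t -> is_derive X u 0 /\ is_derive Y u 0).
    { intros u Hu; destruct (C1_curve_derive c1 c2 u HC) as [H1 [H2 _]]; [lra |].
      assert (Hru := Hr u ltac:(lra)); assert (Hrd := rad_derive c1 c2 u HC ltac:(lra) Hru).
      assert (Ht' := Hth u ltac:(lra)).
      assert (Hr2 := rad_sqr (c1 u, c2 u)); simpl fst in Hr2; simpl snd in Hr2.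
      set (r := rad (c1 u, c2 u)) in *.
      set (rd := (Derive c1 u * c1 u + Derive c2 u * c2 u) / r) in *.
      assert (Ew : w u * r ^ 2 = Derive c2 u * c1 u - Derive c1 u * c2 u)
        by (unfold w; fold r; field; lra).
      assert (Erd : rd * r = Derive c1 u * c1 u + Derive c2 u * c2 u) by (unfold rd; field; lra).
      assert (Hz : forall N, N * r = 0 -> N / r ^ 2 = 0).
      { intros N HN; assert (N = 0) by nra; subst N; unfold Rdiv; ring. }
      split; unfold X, Y; (eapply is_derive_eq; [deriv; fold r; lra |]);
        fold r; apply Hz; rewrite Rmult_minus_distr_r, (Rmult_assoc _ rd r), Erd.
      - transitivity ((Derive c1 u * cos (th u) + Derive c2 u * sin (th u)) * r ^ 2 +
          (w u * r ^ 2) * (c2 u * cos (th u) - c1 u * sin (th u)) -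
          (c1 u * cos (th u) + c2 u * sin (th u)) *
          (Derive c1 u * c1 u + Derive c2 u * c2 u)); [ring |].
        rewrite Ew, Hr2; ring.
      - transitivity ((Derive c2 u * cos (th u) - Derive c1 u * sin (th u)) * r ^ 2 -
          (w u * r ^ 2) * (c1 u * cos (th u) + c2 u * sin (th u)) -
          (c2 u * cos (th u) - c1 u * sin (th u)) *
          (Derive c1 u * c1 u + Derive c2 u * c2 u)); [ring |].
        rewrite Ew, Hr2; ring. }
    split; apply constant_of_derive; try lra; intros u Hu; now apply Hd. }
  assert (E : X 0 = 1 /\ Y 0 = 0).
  { assert (Hr0 := Hr 0 ltac:(lra)); injection H0; intros E2 E1; unfold X, Y; rewrite E0.
    set (r := rad (c1 0, c2 0)) in *; rewrite E1, E2; split; [| field; lra].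
    rewrite <- (sin2_cos2 a); unfold Rsqr; field; lra. }
  destruct HX as [HX HY], E as [EX EY]; rewrite EX in HX; rewrite EY in HY.
  assert (Hrt := Hr t Ht); unfold X, Y in HX, HY; set (r := rad (c1 t, c2 t)) in *.
  assert (HX' : c1 t * cos (th t) + c2 t * sin (th t) = r).
  { transitivity ((c1 t * cos (th t) + c2 t * sin (th t)) / r * r); [field | rewrite HX]; lra. }
  assert (HY' : c2 t * cos (th t) - c1 t * sin (th t) = 0).
  { transitivity ((c2 t * cos (th t) - c1 t * sin (th t)) / r * r); [field | rewrite HY]; lra. }
  assert (Hsc := sin2_cos2 (th t)); unfold Rsqr in Hsc.
  unfold pol; rewrite <- HX'; f_equal; apply Rminus_diag_uniq.
  - transitivity (c1 t * (1 - (sin (th t) * sin (th t) + cos (th t) * cos (th t))) -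
      sin (th t) * (c2 t * cos (th t) - c1 t * sin (th t))); [ring | rewrite Hsc, HY'; ring].
  - transitivity (c2 t * (1 - (sin (th t) * sin (th t) + cos (th t) * cos (th t))) +
      cos (th t) * (c2 t * cos (th t) - c1 t * sin (th t))); [ring | rewrite Hsc, HY'; ring].
Qed.

(* [y] is the least radius along the curve and [D] its total angle. On the region
   [m >= k] the functions [k * theta + slope_int k y r] and [k * theta - slope_int k y r]
   have unit gradient; they calibrate the parts after and before the time of least radius. *)
Lemma curve_length_ge c1 c2 r0 a r1 b : 0 < r0 -> 0 < r1 ->
  C1_curve c1 c2 -> (c1 0, c2 0) = pol r0 a -> (c1 1, c2 1) = pol r1 b ->
  exists y D, 0 <= y <= r0 /\ y <= r1 /\ (forall g, cos (a + D - g) = cos (b - g)) /\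
    forall k, 0 <= k <= m y ->
      k * Rabs D + slope_int k y r0 + slope_int k y r1 <= curve_length m c1 c2.
Proof.
  intros Hr0 Hr1 HC H0 H1.
  assert (R0 : rad (c1 0, c2 0) = r0) by (rewrite H0; apply rad_pol; lra).
  assert (R1 : rad (c1 1, c2 1) = r1) by (rewrite H1; apply rad_pol; lra).
  destruct (continuity_ab_min (fun t => rad (c1 t, c2 t)) 0 1) as [t0 [Hmin Ht0]]; [lra | |].
  { intros t Ht; apply continuity_pt_of.
    destruct (C1_curve_derive c1 c2 t HC Ht) as [_ [_ [H3 [H4 _]]]].
    now apply continuous_rad_curve. }
  set (y := rad (c1 t0, c2 t0)) in *.
  assert (Hy0 : y <= r0) by (rewrite <- R0; apply Hmin; lra).
  assert (Hy1 : y <= r1) by (rewrite <- R1; apply Hmin; lra).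
  assert (Hy : 0 <= y) by apply rad_pos.
  exists y; rewrite (curve_length_split c1 c2 t0 HC Ht0).
  destruct Hy as [Hy | Hy].
  - destruct (polar_lift c1 c2 a HC) as [th [E0 [Hth Hpol]]].
    { intros t Ht; apply Rlt_le_trans with (1 := Hy); now apply Hmin. }
    { now rewrite R0. }
    exists (th 1 - th 0); split; [lra |]; split; [auto |]; split.
    { intros g; assert (HE := Hpol 1 ltac:(lra)); rewrite R1, H1 in HE.
      injection HE; intros E2 E1.
      apply Rmult_eq_reg_l in E1; [| lra]; apply Rmult_eq_reg_l in E2; [| lra].
      rewrite E0; replace (a + (th 1 - a) - g) with (th 1 - g) by ring.
      now rewrite 2!cos_minus, E1, E2. }
    intros k Hk.
    assert (Hcal : forall s e u v, 0 <= u -> u <= v -> v <= 1 -> s ^ 2 = 1 -> e ^ 2 = 1 ->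
      (s * k * th v + e * slope_int k y (rad (c1 v, c2 v))) -
      (s * k * th u + e * slope_int k y (rad (c1 u, c2 u))) <= RInt (speed m c1 c2) u v).
    { intros s e u v Hu Huv Hv Hs He.
      apply (RInt_ge_increment (speed m c1 c2)
        (fun t => s * k * th t + e * slope_int k y (rad (c1 t, c2 t)))
        (fun t => s * k * ((Derive c2 t * c1 t - Derive c1 t * c2 t) / rad (c1 t, c2 t) ^ 2) +
           e * ((Derive c1 t * c1 t + Derive c2 t * c2 t) / rad (c1 t, c2 t) *
                slope k (rad (c1 t, c2 t))))); auto.
      - intros t Ht; now apply continuous_speed.
      - intros t Ht; assert (Hrt := Hmin t ltac:(lra)); cbv beta in Hrt.
        assert (Hd1 := Hth t ltac:(lra)).
        assert (Hd2 : is_derive (fun t => slope_int k y (rad (c1 t, c2 t))) t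
          ((Derive c1 t * c1 t + Derive c2 t * c2 t) / rad (c1 t, c2 t) *
                slope k (rad (c1 t, c2 t)))).
        { apply (is_derive_Rcomp (slope_int k y) (fun t => rad (c1 t, c2 t))).
          - apply slope_int_derive; right; fold y in Hrt; lra.
          - apply rad_derive; auto; fold y in Hrt; lra. }
        deriv_eq; ring.
      - intros t Ht; assert (Hrt := Hmin t ltac:(lra)); cbv beta in Hrt; fold y in Hrt.
        unfold speed; rewrite gm_self_polar by lra; cbn [fst snd].
        set (r := rad (c1 t, c2 t)) in *.
        set (W := (Derive c2 t * c1 t - Derive c1 t * c2 t) / r ^ 2).
        set (V := (Derive c1 t * c1 t + Derive c2 t * c2 t) / r).
        assert (Hmr : 0 < m r) by (apply profile_pos; lra).
        assert (Hkr : k <= m r) by (apply Rle_trans with (m y); [lra | apply profile_incr; lra]).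
        assert (Hkm : (k / m r) ^ 2 <= 1).
        { assert (0 <= k / m r <= 1); [| nra]; split.
          - apply Rdiv_le_0_compat; lra.
          - apply Rle_div_l; lra. }
        replace (s * k * W + e * (V * slope k r)) with (s * (k / m r) * (m r * W) + e * slope k r * V)
          by (field; lra).
        apply le_sqrt_sum_sqr; rewrite 2!Rpow_mult_distr, Hs, He; unfold slope.
        rewrite sqrt_sqr_eq; lra. }
    assert (Hs : exists s, s ^ 2 = 1 /\ s * (th 1 - th 0) = Rabs (th 1 - th 0)).
    { destruct (Rle_lt_dec 0 (th 1 - th 0)).
      - exists 1; rewrite Rabs_pos_eq by auto; split; ring.
      - exists (-1); rewrite Rabs_left by auto; split; ring. }
    destruct Hs as [s [Hs1 Hs2]]; rewrite <- Hs2.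
    assert (C0 := Hcal s (-1) 0 t0 ltac:(lra) ltac:(lra) ltac:(lra) Hs1 ltac:(ring)).
    assert (C1 := Hcal s 1 t0 1 ltac:(lra) ltac:(lra) ltac:(lra) Hs1 ltac:(ring)).
    rewrite R0 in C0; rewrite R1 in C1; fold y in C0, C1; rewrite slope_int_self in C0, C1; lra.
  (* The curve meets the origin, so k <= m 0 = 0. The angle is then multiplied by 0 and any lift
     such as b - a will do; what remains is the radial estimate on both parts. *)
  - exists (b - a); split; [lra |]; split; [auto |]; split.
    { intros g; f_equal; ring. }
    intros k Hk; rewrite <- Hy, profile_0 in Hk.
    replace k with 0 by lra; rewrite 2!slope_int_0, <- Hy.
    assert (C0 := rad_increment_le c1 c2 0 t0 HC ltac:(lra) ltac:(lra) ltac:(lra)).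
    assert (C1 := rad_increment_le c1 c2 t0 1 HC ltac:(lra) ltac:(lra) ltac:(lra)).
    rewrite R0 in C0; rewrite R1 in C1; fold y in C0, C1; rewrite <- Hy in C0, C1.
    rewrite Rabs_left1 in C0 by lra; rewrite Rabs_pos_eq in C1 by lra; lra.
Qed.

(* The path extends to the left of [a] because [C1_curve] asks for two-sided derivatives at the ends. *)
Lemma dist_m_le_polar (Rr Th dR dTh len : R -> R) (l : Rbar) (a b : R) :
  Rbar_lt l a -> a <= b ->
  (forall u : R, Rbar_lt l u -> is_derive Rr u (dR u) /\ is_derive Th u (dTh u) /\ 0 < Rr u /\
     continuous dR u /\ continuous dTh u) ->
  (forall u, a <= u <= b -> is_derive len u (sqrt (dR u ^ 2 + (m (Rr u) * dTh u) ^ 2))) ->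
  dist_m m (pol (Rr a) (Th a)) (pol (Rr b) (Th b)) <= len b - len a.
Proof.
  intros Hla Hab Hp Hlen.
  set (sg := fun t => a + t * (b - a)).
  assert (Hsg : forall t, is_derive sg t (b - a))
    by (intros t; unfold sg; deriv_eq; ring).
  set (c1 := fun t => Rr (sg t) * cos (Th (sg t))).
  set (c2 := fun t => Rr (sg t) * sin (Th (sg t))).
  set (d1 := fun t => (b - a) * (dR (sg t) * cos (Th (sg t)) - Rr (sg t) * (sin (Th (sg t)) * dTh (sg t)))).
  set (d2 := fun t => (b - a) * (dR (sg t) * sin (Th (sg t)) + Rr (sg t) * (cos (Th (sg t)) * dTh (sg t)))).
  assert (Hd : forall t : R, Rbar_lt l (sg t) -> is_derive c1 t (d1 t) /\ is_derive c2 t (d2 t)).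
  { intros t Ht; destruct (Hp _ Ht) as [H1 [H2 _]].
    assert (E1 := is_derive_Rcomp Rr sg t _ _ H1 (Hsg t)).
    assert (E2 := is_derive_Rcomp Th sg t _ _ H2 (Hsg t)).
    split; unfold c1, c2, d1, d2; (deriv_eq; ring). }
  assert (Hloc : forall t, 0 <= t <= 1 -> Rbar_lt l (sg t)).
  { intros t Ht; apply Rbar_lt_le_trans with (1 := Hla); unfold sg; simpl; nra. }
  assert (Hnear : forall t, 0 <= t <= 1 -> locally t (fun u => Rbar_lt l (sg u))).
  { intros t Ht; assert (Hc := derive_continuous _ _ _ (Hsg t)).
    exact (Hc _ (open_Rbar_gt l (sg t) (Hloc t Ht))). }
  assert (HC : C1_curve c1 c2).
  { intros t Ht; assert (Hl := Hloc t Ht).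
    assert (Hcd : continuous d1 t /\ continuous d2 t).
    { destruct (Hp _ Hl) as [H1 [H2 [_ [H3 H4]]]].
      assert (Hs := derive_continuous _ _ _ (Hsg t)).
      assert (K1 := continuous_comp sg Rr t Hs (derive_continuous _ _ _ H1)).
      assert (K2 := continuous_comp sg Th t Hs (derive_continuous _ _ _ H2)).
      assert (K3 := continuous_comp sg dR t Hs H3).
      assert (K4 := continuous_comp sg dTh t Hs H4).
      unfold d1, d2; split; cont. }
    destruct (Hd t Hl) as [H1 H2].
    split; [now exists (d1 t) | split; [| split; [now exists (d2 t) |]]];
      [apply (continuous_ext_loc _ d1) | apply (continuous_ext_loc _ d2)]; try apply Hcd;
      generalize (Hnear t Ht); apply filter_imp; intros u Hu;
      symmetry; apply is_derive_unique, Hd, Hu. }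
  assert (S0 : sg 0 = a) by (unfold sg; ring).
  assert (S1 : sg 1 = b) by (unfold sg; ring).
  apply Rle_trans with (curve_length m c1 c2).
  { apply dist_m_le; auto; unfold c1, c2, pol; now rewrite ?S0, ?S1. }
  right; unfold curve_length; fold (speed m c1 c2).
  assert (Hsp : forall t, 0 <= t <= 1 -> speed m c1 c2 t =
    (b - a) * sqrt (dR (sg t) ^ 2 + (m (Rr (sg t)) * dTh (sg t)) ^ 2)).
  { intros t Ht; assert (Hl := Hloc t Ht); destruct (Hd t Hl) as [H1 H2].
    destruct (Hp _ Hl) as [_ [_ [Hr _]]].
    assert (E : (c1 t, c2 t) = pol (Rr (sg t)) (Th (sg t))) by reflexivity.
    unfold speed; rewrite (is_derive_unique _ _ _ H1), (is_derive_unique _ _ _ H2), E.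
    rewrite gm_self_polar by (rewrite rad_pol; lra).
    rewrite rad_pol by lra; unfold pol; cbn [fst snd]; unfold d1, d2.
    rewrite <- (sqrt_pow2 (b - a)) by lra; rewrite <- sqrt_mult_alt by apply pow2_ge_0.
    rewrite sqrt_pow2 by lra.
    assert (Hsc := sin2_cos2 (Th (sg t))); unfold Rsqr in Hsc.
    set (C := cos (Th (sg t))) in *; set (S := sin (Th (sg t))) in *.
    set (r := Rr (sg t)) in *; set (h := dR (sg t)); set (w := dTh (sg t)).
    f_equal.
    replace (((b - a) * (h * C - r * (S * w)) * (r * C) + (b - a) * (h * S + r * (C * w)) * (r * S)) / r)
      with ((b - a) * h * (S * S + C * C)) by (field; lra).
    replace (((b - a) * (h * S + r * (C * w)) * (r * C) - (b - a) * (h * C - r * (S * w)) * (r * S)) / r ^ 2)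
      with ((b - a) * w * (S * S + C * C)) by (field; lra).
    rewrite Hsc; ring. }
  rewrite <- S1, <- S0.
  apply is_RInt_unique, (is_RInt_derive (V := R_CompleteNormedModule) (fun t => len (sg t)) (speed m c1 c2)).
  - intros t Ht; rewrite Rmin_left, Rmax_right in Ht by lra; rewrite Hsp by auto.
    apply (is_derive_Rcomp len sg); auto.
    apply Hlen; unfold sg; split; nra.
  - intros t Ht; rewrite Rmin_left, Rmax_right in Ht by lra; now apply continuous_speed.
Qed.

(** * The turning inequality *)

(* [flat_leg k v] is the integral of [sqrt (1 - (k/u)^2)] over [u] in [k, v]: the length of the
   segment of a Euclidean line from its point closest to the origin, at distance k, to radius v,
   minus k times the angle it subtends. *)
Definition flat_leg (k v : R) : R :=
  let A := sqrt (v ^ 2 - k ^ 2) in A - k * (PI / 2) + k * atan (k / A).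

Lemma atan_pos_bounds x : 0 <= x -> 0 <= atan x < PI / 2.
Proof.
  intros Hx; split; [| apply atan_bound].
  rewrite <- atan_0; destruct Hx as [H | <-]; [left; now apply atan_increasing | lra].
Qed.

(** Controls [flat_leg] near v = k by a quantity tending to 0. At v = k itself the formula contains
    k / 0 = 0 and returns -k PI / 2 in place of the limit 0. *)
Lemma flat_leg_le_self k v : 0 <= k < v -> flat_leg k v <= sqrt (v ^ 2 - k ^ 2).
Proof.
  intros H; unfold flat_leg; assert (Hb := atan_bound (k / sqrt (v ^ 2 - k ^ 2))).
  assert (k * atan (k / sqrt (v ^ 2 - k ^ 2)) <= k * (PI / 2)) by (apply Rmult_le_compat_l; lra).
  lra.
Qed.

Lemma flat_leg_derive k v : 0 <= k < v -> is_derive (flat_leg k) v (sqrt (v ^ 2 - k ^ 2) / v).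
Proof.
  intros H; assert (Hp : 0 < v ^ 2 - k ^ 2) by nra; assert (HA := sqrt_lt_R0 _ Hp).
  assert (HA2 := sqrt_sqr_eq _ (Rlt_le _ _ Hp)).
  unfold flat_leg; eapply is_derive_eq; [deriv; lra |].
  set (A := sqrt (v ^ 2 - k ^ 2)) in *.
  replace (v / A * (A ^ 2 / v ^ 2)) with (A / v) by (field; lra).
  transitivity (v / A * (A ^ 2 / (A ^ 2 + k ^ 2))).
  - field; repeat split; nra.
  - rewrite HA2; replace (v ^ 2 - k ^ 2 + k ^ 2) with (v ^ 2) by ring.
    rewrite <- HA2; field; lra.
Qed.

(** Concavity of sin on [0, PI]: its slope on [p, q] is at least the one at q. *)
Lemma sin_chord p q : 0 <= p -> p <= q -> q <= PI -> cos q * (q - p) <= sin q - sin p.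
Proof.
  intros Hp Hpq Hq.
  assert (sin p - cos q * p <= sin q - cos q * q); [| lra].
  apply (incr_of_derive_closed (fun t => sin t - cos q * t) (fun t => cos t - cos q)); auto.
  - intros t Ht; deriv_eq; ring.
  - intros t Ht; assert (cos q <= cos t) by (apply cos_decr_1; lra); lra.
Qed.

Section TurningInequality.
Context (k K : R) (HkK : 0 <= k < K).

(* With v = K sqrt (1 + s^2): A s = sqrt (v^2 - k^2), and K s = sqrt (v^2 - K^2). *)
Let A (s : R) : R := sqrt (K ^ 2 * (1 + s ^ 2) - k ^ 2).
(** Loss per unit of turn when k replaces K: along the geodesic, [slope K] contributes K s^2 and
    [slope k] contributes A s per unit angle, so the rate is K - k + K s^2 - A s. *)
Definition gap_rate (s : R) : R := K - k - (sqrt (K ^ 2 * (1 + s ^ 2) - k ^ 2) - K * s) * s.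
(** The loss in the flat plane, where the turn is atan s: the primitive of gap_rate(s) / (1 + s^2)
    that vanishes at 0. *)
Let V (s : R) : R :=
  flat_leg k K - (A s - k * (PI / 2) + k * atan (k / A s)) + K * s - k * atan s.

Lemma gap_A_pos s : 0 < K ^ 2 * (1 + s ^ 2) - k ^ 2.
Proof. assert (k ^ 2 < K ^ 2) by nra; assert (0 <= K ^ 2 * s ^ 2) by nra; lra. Qed.

Lemma gap_A s : 0 < A s /\ A s ^ 2 = K ^ 2 * (1 + s ^ 2) - k ^ 2 /\ K * s < A s.
Proof.
  assert (H := gap_A_pos s); split; [now apply sqrt_lt_R0 |].
  assert (E : A s ^ 2 = K ^ 2 * (1 + s ^ 2) - k ^ 2) by (apply sqrt_sqr_eq; lra).
  split; auto; assert (0 < A s) by now apply sqrt_lt_R0.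
  apply Rnot_le_lt; intros Hle; assert (A s ^ 2 <= (K * s) ^ 2) by nra; nra.
Qed.

Lemma gap_A_derive s : is_derive A s (K ^ 2 * s / A s).
Proof.
  assert (H := gap_A s); unfold A in *; eapply is_derive_eq; [deriv; apply gap_A_pos |].
  field; lra.
Qed.

Lemma gap_rate_derive s : is_derive gap_rate s (- ((A s - K * s) ^ 2 / A s)).
Proof.
  destruct (gap_A s) as [H1 [H2 _]]; assert (Hd := gap_A_derive s).
  change (is_derive (fun s => K - k - (A s - K * s) * s) s (- ((A s - K * s) ^ 2 / A s))).
  eapply is_derive_eq; [deriv | field; lra].
Qed.

(** From (A - K s)(A + K s) = K^2 - k^2 and A >= K s one gets 2 K s (A - K s) <= K^2 - k^2 <= 2 K (K
    - k). *)
Lemma gap_rate_nonneg s : 0 <= s -> 0 <= gap_rate s.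
Proof.
  intros Hs; destruct (gap_A s) as [H1 [H2 H3]].
  change (0 <= K - k - (A s - K * s) * s).
  assert (0 <= (A s - K * s) * (A s - K * s)) by nra.
  assert ((A s - K * s) * s * (2 * K) <= (K - k) * (2 * K)); [| nra].
  nra.
Qed.

Lemma gap_V_derive s : is_derive V s (gap_rate s / (1 + s ^ 2)).
Proof.
  destruct (gap_A s) as [H1 [H2 _]]; assert (Hd := gap_A_derive s).
  assert (0 <= s ^ 2) by apply pow2_ge_0.
  unfold V; eapply is_derive_eq; [deriv; lra |].
  change (gap_rate s) with (K - k - (A s - K * s) * s).
  set (a := A s) in *.
  transitivity (- (K ^ 2 * s / a * (a ^ 2 / (a ^ 2 + k ^ 2))) + K - k * (1 / (1 + s ^ 2))).
  - field; repeat split; nra.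
  - rewrite H2 at 2; replace (K ^ 2 * (1 + s ^ 2) - k ^ 2 + k ^ 2) with (K ^ 2 * (1 + s ^ 2)) by ring.
    field; repeat split; nra.
Qed.

Lemma gap_V_0 : V 0 = 0.
Proof.
  unfold V, flat_leg, A; replace (K ^ 2 * (1 + 0 ^ 2) - k ^ 2) with (K ^ 2 - k ^ 2) by ring.
  rewrite atan_0; ring.
Qed.

(** The derivative of V - gap_rate atan is -gap_rate' atan, which is nonnegative because [gap_rate]
    decreases. *)
Lemma gap_V_ge s : 0 <= s -> gap_rate s * atan s <= V s.
Proof.
  intros Hs.
  assert (V 0 - gap_rate 0 * atan 0 <= V s - gap_rate s * atan s).
  { apply (incr_of_derive_closed (fun s => V s - gap_rate s * atan s)
      (fun s => (A s - K * s) ^ 2 / A s * atan s)); auto.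
    - intros t _; assert (H1 := gap_V_derive t); assert (H2 := gap_rate_derive t).
      assert (0 <= t ^ 2) by apply pow2_ge_0; destruct (gap_A t) as [H3 _].
      eapply is_derive_eq; [deriv | field; lra].
    - intros t Ht; destruct (gap_A t) as [H3 _].
      apply Rmult_le_pos; [| apply atan_pos_bounds; lra].
      apply Rdiv_le_0_compat; [apply pow2_ge_0 | auto]. }
  rewrite gap_V_0, atan_0 in H; lra.
Qed.

(** With v^2 = A^2 + k^2, let p and q be the angles with cos p = K / v and cos q = k / v. The claim
    reads k (q - p) <= A - K s, that is [sin_chord] multiplied by v. *)
Lemma gap_V_le s : 0 <= s -> V s <= flat_leg k K.
Proof.
  intros Hs; destruct (gap_A s) as [H1 [H2 H3]].
  unfold V; set (a := A s) in *.
  set (p := atan s); set (q := PI / 2 - atan (k / a)).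
  assert (Hka : 0 <= k / a) by (apply Rdiv_le_0_compat; lra).
  assert (Hq := atan_pos_bounds _ Hka); assert (Hp := atan_pos_bounds s Hs).
  assert (Hpq : p <= q).
  { unfold p, q; destruct (Req_dec k 0) as [E | E].
    - rewrite E; unfold Rdiv; rewrite Rmult_0_l, atan_0; lra.
    - assert (Hk : 0 < k / a) by (apply Rdiv_lt_0_compat; lra).
      rewrite <- atan_inv by auto.
      assert (Hle : s <= / (k / a)).
      { replace (/ (k / a)) with (a / k) by (field; lra); apply Rle_div_r; nra. }
      destruct Hle as [Hlt | <-]; [left; now apply atan_increasing | lra]. }
  assert (Hsin := sin_chord p q ltac:(unfold p; lra) Hpq ltac:(unfold q; lra)).
  set (v := sqrt (a ^ 2 + k ^ 2)).
  assert (Hv : 0 < v) by (apply sqrt_lt_R0; nra).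
  assert (Hv2 : v ^ 2 = a ^ 2 + k ^ 2) by (apply sqrt_sqr_eq; nra).
  assert (Ecos : v * cos q = k).
  { unfold q; rewrite cos_shift, sin_atan.
    replace (sqrt (1 + (k / a)²)) with (v / a); [field; lra |].
    unfold v; rewrite <- (sqrt_pow2 a) at 2 by lra; rewrite <- sqrt_div_alt by nra.
    f_equal; unfold Rsqr; field; lra. }
  assert (Esin : v * sin q = a).
  { unfold q; rewrite sin_shift, cos_atan.
    replace (sqrt (1 + (k / a)²)) with (v / a); [field; lra |].
    unfold v; rewrite <- (sqrt_pow2 a) at 2 by lra; rewrite <- sqrt_div_alt by nra.
    f_equal; unfold Rsqr; field; lra. }
  assert (Esin' : v * sin p = K * s).
  { unfold p; rewrite sin_atan.
    replace v with (K * sqrt (1 + s²)); [field; apply Rgt_not_eq, sqrt_lt_R0; unfold Rsqr; nra |].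
    unfold v; rewrite <- (sqrt_pow2 K) at 1 by lra; rewrite <- sqrt_mult_alt by nra.
    f_equal; rewrite H2; unfold Rsqr; ring. }
  assert (v * (cos q * (q - p)) <= v * (sin q - sin p)) by (apply Rmult_le_compat_l; lra).
  assert (H' : k * (q - p) <= a - K * s) by (rewrite <- Ecos, <- Esin, <- Esin'; lra).
  unfold q in H'; lra.
Qed.

(* [Q] is the loss in length when the Clairaut constant K is replaced by k < K; integrating
   Q' = gap_rate(s) T' by parts against the decreasing function gap_rate compares it with the
   flat cone of total turn M PI/2. *)
Lemma turning_inequality (M : R) (s T Q ds dT : R -> R) (a b : R) :
  0 <= M -> a <= b ->
  (forall t, a <= t <= b -> is_derive s t (ds t) /\ is_derive T t (dT t) /\
     is_derive Q t (gap_rate (s t) * dT t)) ->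
  (forall t, a <= t <= b -> 0 <= s t /\ 0 <= ds t /\ T t <= M * atan (s t)) ->
  T a = 0 -> Q a = 0 -> Q b <= M * flat_leg k K.
Proof.
  intros HM Hab Hd Hp HTa HQa.
  (* All terms of F' cancel except gap_rate'(s) s' (T - M atan s), which is nonnegative since
     gap_rate' and T - M atan s are both nonpositive. *)
  set (F := fun t => M * V (s t) + gap_rate (s t) * (T t - M * atan (s t)) - Q t).
  assert (HF : F a <= F b).
  { apply (incr_of_derive_closed F (fun t =>
      ds t * (- ((A (s t) - K * s t) ^ 2 / A (s t))) * (T t - M * atan (s t)))); auto.
    - intros t Ht; destruct (Hd t Ht) as [H1 [H2 H3]].
      assert (K1 := is_derive_Rcomp V s t _ _ (gap_V_derive (s t)) H1).
      assert (K2 := is_derive_Rcomp gap_rate s t _ _ (gap_rate_derive (s t)) H1).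
      destruct (gap_A (s t)) as [H4 _].
      assert (0 <= s t ^ 2) by apply pow2_ge_0.
      unfold F; eapply is_derive_eq; [deriv | field; lra].
    - intros t Ht; destruct (Hp t Ht) as [H1 [H2 H3]]; destruct (gap_A (s t)) as [H4 _].
      assert (0 <= (A (s t) - K * s t) ^ 2 / A (s t))
        by (apply Rdiv_le_0_compat; [apply pow2_ge_0 | auto]).
      replace (ds t * - ((A (s t) - K * s t) ^ 2 / A (s t)) * (T t - M * atan (s t)))
        with (ds t * ((A (s t) - K * s t) ^ 2 / A (s t)) * (M * atan (s t) - T t)) by ring.
      apply Rmult_le_pos; [apply Rmult_le_pos; auto | lra]. }
  destruct (Hp a ltac:(lra)) as [Ha1 _]; destruct (Hp b ltac:(lra)) as [Hb1 [_ Hb2]].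
  unfold F in HF; rewrite HTa, HQa in HF.
  assert (H1 := gap_V_ge (s a) Ha1); assert (H2 := gap_V_le (s b) Hb1).
  assert (H3 := gap_rate_nonneg (s b) Hb1).
  assert (H4 : 0 <= M * (V (s a) - gap_rate (s a) * atan (s a))) by (apply Rmult_le_pos; lra).
  assert (H5 : 0 <= M * (flat_leg k K - V (s b))) by (apply Rmult_le_pos; lra).
  assert (H6 : 0 <= gap_rate (s b) * (M * atan (s b) - T b)) by (apply Rmult_le_pos; lra).
  lra.
Qed.
End TurningInequality.

(* T is a convex function of phi, since dphi = mu dT with mu nonincreasing. *)
Lemma convex_chord (T phi mu dT : R -> R) (a r b : R) :
  a <= r -> r <= b ->
  (forall t, a <= t <= b -> is_derive T t (dT t) /\ is_derive phi t (mu t * dT t) /\ 0 <= dT t) ->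
  (forall t u, a <= t -> t <= u -> u <= b -> mu u <= mu t) ->
  T a = 0 -> 0 <= phi a -> T r * phi b <= T b * phi r.
Proof.
  intros Har Hrb Hd Hmu HT Hphi.
  assert (H1 : mu r * T a - phi a >= mu r * T r - phi r).
  { assert (phi a - mu r * T a <= phi r - mu r * T r); [| lra].
    apply (incr_of_derive_closed (fun t => phi t - mu r * T t) (fun t => (mu t - mu r) * dT t)); auto.
    - intros t Ht; destruct (Hd t) as [K1 [K2 _]]; [lra |].
      deriv_eq; ring.
    - intros t Ht; destruct (Hd t) as [_ [_ K3]]; [lra |].
      apply Rmult_le_pos; auto; assert (mu r <= mu t) by (apply Hmu; lra); lra. }
  assert (H2 : mu r * T r - phi r <= mu r * T b - phi b).
  { apply (incr_of_derive_closed (fun t => mu r * T t - phi t) (fun t => (mu r - mu t) * dT t)); auto.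
    - intros t Ht; destruct (Hd t) as [K1 [K2 _]]; [lra |].
      deriv_eq; ring.
    - intros t Ht; destruct (Hd t) as [_ [_ K3]]; [lra |].
      apply Rmult_le_pos; auto; assert (mu t <= mu r) by (apply Hmu; lra); lra. }
  assert (H3 : T a <= T r).
  { apply (incr_of_derive_closed T dT); auto; intros t Ht; apply Hd; lra. }
  assert (H4 : T r <= T b).
  { apply (incr_of_derive_closed T dT); auto; intros t Ht; apply Hd; lra. }
  rewrite HT in *.
  assert (0 <= T r * (mu r * (T b - T r) - (phi b - phi r))) by (apply Rmult_le_pos; lra).
  assert (0 <= (T b - T r) * (phi r - phi a - mu r * T r)) by (apply Rmult_le_pos; lra).
  assert (0 <= (T b - T r) * phi a) by (apply Rmult_le_pos; lra).
  nra.
Qed.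

Lemma slope_eq k r : 0 < r -> slope k r = sqrt (m r ^ 2 - k ^ 2) / m r.
Proof.
  intros Hr; assert (H := profile_pos r Hr); unfold slope.
  replace (1 - (k / m r) ^ 2) with ((m r ^ 2 - k ^ 2) / m r ^ 2) by (field; lra).
  rewrite sqrt_div_alt by nra; rewrite sqrt_pow2; lra.
Qed.

(* Since m' <= 1, the leg in M_m is at least as long as the flat one. *)
Lemma slope_int_ge_flat_leg y x : 0 <= y -> y <= x -> m y < m x ->
  flat_leg (m y) (m x) <= slope_int (m y) y x.
Proof.
  intros Hy Hyx Hlt; set (k := m y) in *.
  assert (Hk : 0 <= k) by (apply profile_nonneg; lra).
  apply Rnot_lt_le; intros Hgap.
  set (e := flat_leg k (m x) - slope_int k y x) in *.
  assert (He : 0 < e) by (unfold e; lra).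
  (* The comparison of derivatives starts at a level v > k so close to k that sqrt (v^2 - k^2),
     hence flat_leg k v, is below the supposed deficit e. *)
  assert (Hc : continuous (fun v => sqrt (v ^ 2 - k ^ 2)) k).
  { cont. }
  destruct (continuous_eps _ _ _ Hc He) as [d [Hd Hdd]].
  set (v := Rmin (k + d / 2) ((k + m x) / 2)).
  assert (Hv : k < v < m x /\ v < k + d).
  { unfold v; split; [split; [apply Rmin_glb_lt; lra |] |];
      eapply Rle_lt_trans; [apply Rmin_r | lra | apply Rmin_l | lra]. }
  destruct (IVT_gen m y x v) as [r0 [Hr0 Er0]].
  { intros u; apply continuity_pt_of, profile_continuous. }
  { fold k; rewrite Rmin_left, Rmax_right; lra. }
  rewrite Rmin_left, Rmax_right in Hr0 by lra.
  assert (Hyr : y < r0) by (destruct Hr0 as [[H | H] _]; auto; subst r0; unfold k in *; lra).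
  assert (H1 : flat_leg k v <= sqrt (v ^ 2 - k ^ 2)) by (apply flat_leg_le_self; lra).
  assert (H2 : Rabs (sqrt (v ^ 2 - k ^ 2) - sqrt (k ^ 2 - k ^ 2)) < e)
    by (apply Hdd; rewrite Rabs_pos_eq; lra).
  rewrite Rminus_diag, sqrt_0, Rminus_0_r, Rabs_pos_eq in H2 by apply sqrt_pos.
  assert (H3 : slope_int k r0 r0 - flat_leg k (m r0) <= slope_int k r0 x - flat_leg k (m x)).
  { apply (incr_of_derive_closed (fun r => slope_int k r0 r - flat_leg k (m r))
      (fun r => slope k r * (1 - Derive m r))); [lra | |].
    - intros r Hr.
      assert (Hmr : v <= m r) by (rewrite <- Er0; apply profile_incr; lra).
      assert (K1 := slope_int_derive k r0 r ltac:(right; lra)).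
      assert (K2 := is_derive_Rcomp (flat_leg k) m r _ _ (flat_leg_derive k (m r) ltac:(lra))
                      (profile_derive r)).
      deriv_eq; rewrite slope_eq by lra; ring.
    - intros r Hr; apply Rmult_le_pos; [apply slope_bounds |].
      assert (H := profile_derive_le_1 r); lra. }
  rewrite slope_int_self, Er0 in H3.
  destruct (Req_dec k 0) as [Ek | Ek].
  - assert (H5 := slope_int_chasles k y r0 x ltac:(auto)).
    assert (H6 := slope_int_bounds k y r0 ltac:(auto) ltac:(lra)).
    unfold e in *; lra.
  - assert (0 < y).
    { destruct Hy as [H | H]; auto; exfalso; apply Ek; unfold k; rewrite <- H; now apply profile_0. }
    assert (H5 := slope_int_chasles k y r0 x ltac:(right; lra)).
    assert (H6 := slope_int_bounds k y r0 ltac:(auto) ltac:(lra)).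
    unfold e in *; lra.
Qed.

(** * The turn of outward geodesics *)

(* [turn K a b] is the angle swept between radii a and b by an outward geodesic with Clairaut
   constant K. *)
Definition turn_rate (K r : R) : R := K / (m r * sqrt (m r ^ 2 - K ^ 2)).
Definition turn (K a b : R) : R := RInt (turn_rate K) a b.
(** Encodes T(x) <= PI by proper integrals: K < m(x) keeps away from the singularity at m = K, and r
    is finite. The limiting form is [turn_bounded_iff]. *)
Definition turn_bounded (x : R) : Prop :=
  forall K r, 0 < K < m x -> x < r -> turn K x r <= PI.

Lemma clairaut_pos K v : 0 <= K < v -> 0 < v ^ 2 - K ^ 2 /\ 0 < sqrt (v ^ 2 - K ^ 2).
Proof. intros H; assert (0 < v ^ 2 - K ^ 2) by nra; split; auto; now apply sqrt_lt_R0. Qed.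

Lemma clairaut_sqrt_le K v : 0 <= v -> sqrt (v ^ 2 - K ^ 2) <= v.
Proof.
  intros Hv; rewrite <- (sqrt_pow2 v) at 2 by auto; apply sqrt_le_1_alt.
  assert (H := pow2_ge_0 K); lra.
Qed.

Lemma turn_rate_pos K r : 0 <= K < m r -> 0 <= turn_rate K r.
Proof.
  intros H; apply Rdiv_le_0_compat; [lra | apply Rmult_lt_0_compat; [lra | now apply clairaut_pos]].
Qed.

Lemma turn_rate_continuous K r : 0 <= K < m r -> continuous (turn_rate K) r.
Proof.
  intros H; assert (H1 := profile_continuous r); destruct (clairaut_pos _ _ H) as [_ H2].
  unfold turn_rate; cont; apply Rmult_integral_contrapositive; lra.
Qed.

(** Leaves room to the left of x, so that [turn] has a two-sided derivative at x and geodesics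
    extend past their starting point. *)
Lemma level_nbhd K x : 0 < x -> K < m x -> exists l, 0 < l < x /\ forall r, l < r -> K < m r.
Proof.
  intros Hx HK.
  destruct (continuous_eps m x (m x - K) (profile_continuous x) ltac:(lra)) as [d [Hd Hdd]].
  exists (Rmax (x - d / 2) (x / 2)).
  assert (Hl : Rmax (x - d / 2) (x / 2) < x) by (apply Rmax_lub_lt; lra).
  assert (H1 := Rmax_l (x - d / 2) (x / 2)); assert (H2 := Rmax_r (x - d / 2) (x / 2)).
  split; [lra |]; intros r Hr.
  apply Rlt_le_trans with (m (Rmax (x - d / 2) (x / 2))).
  - assert (H := Hdd (Rmax (x - d / 2) (x / 2)) ltac:(rewrite Rabs_left; lra)).
    apply Rabs_def2 in H; lra.
  - apply profile_incr; lra.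
Qed.

Lemma turn_ex_RInt K x a b : 0 < x -> 0 <= K < m x -> x <= a -> x <= b -> ex_RInt (turn_rate K) a b.
Proof.
  intros Hx HK Ha Hb; destruct (level_nbhd K x Hx ltac:(lra)) as [l [Hl Hlm]].
  apply ex_RInt_continuous_on with l; simpl; try lra.
  intros u Hu; apply turn_rate_continuous; split; [lra | now apply Hlm].
Qed.

Lemma turn_derive K x r : 0 < x -> 0 <= K < m x -> x <= r ->
  is_derive (fun r => turn K x r) r (turn_rate K r).
Proof.
  intros Hx HK Hr; destruct (level_nbhd K x Hx ltac:(lra)) as [l [Hl Hlm]].
  apply is_derive_RInt_on with l; simpl; try lra.
  intros u Hu; apply turn_rate_continuous; split; [lra | now apply Hlm].
Qed.

Lemma turn_chasles K x r s : 0 < x -> 0 <= K < m x -> x <= r -> r <= s ->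
  turn K x r + turn K r s = turn K x s.
Proof.
  intros Hx HK Hr Hs; apply (RInt_Rchasles (turn_rate K));
    apply turn_ex_RInt with x; auto; lra.
Qed.

Lemma turn_nonneg K a b : 0 < a -> 0 <= K < m a -> a <= b -> 0 <= turn K a b.
Proof.
  intros Ha HK Hab; apply RInt_pos_le; auto; [apply turn_ex_RInt with a; auto; lra |].
  intros r Hr; apply turn_rate_pos; assert (H := profile_incr a r ltac:(lra) ltac:(lra)); lra.
Qed.

Lemma turn_self K a : turn K a a = 0.
Proof. apply RInt_Rpoint. Qed.

Lemma turn_incr K x r s : 0 < x -> 0 <= K < m x -> x <= r -> r <= s -> turn K x r <= turn K x s.
Proof.
  intros Hx HK Hr Hs; rewrite <- (turn_chasles K x r s); auto.
  assert (H := profile_incr x r ltac:(lra) ltac:(lra)).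
  assert (H1 := turn_nonneg K r s ltac:(lra) ltac:(lra) Hs); lra.
Qed.

(** The derivative in the Clairaut constant u is m r / sqrt (m r^2 - u^2)^3; it is positive, and the
    root is at least sqrt (m a^2 - K^2). *)
Lemma turn_rate_lipschitz K1 K2 K r a : 0 <= K1 -> K1 <= K2 -> K2 <= K -> 0 < a -> K < m a -> a <= r ->
  0 <= turn_rate K2 r - turn_rate K1 r <= m r / sqrt (m a ^ 2 - K ^ 2) ^ 3 * (K2 - K1).
Proof.
  intros H1 H12 H2 Ha HK Hr.
  assert (Hmr := profile_incr a r ltac:(lra) Hr).
  destruct (clairaut_pos K (m a)) as [_ Hb]; [lra |]; set (b := sqrt (m a ^ 2 - K ^ 2)) in *.
  assert (Hd : forall u, K1 <= u <= K2 ->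
    is_derive (fun u => turn_rate u r) u (m r / sqrt (m r ^ 2 - u ^ 2) ^ 3) /\
    b <= sqrt (m r ^ 2 - u ^ 2)).
  { intros u Hu; destruct (clairaut_pos u (m r)) as [H3 H4]; [lra |].
    assert (H5 := sqrt_sqr_eq _ (Rlt_le _ _ H3)).
    split.
    - unfold turn_rate; eapply is_derive_eq; [deriv; auto; apply Rmult_integral_contrapositive; lra |].
      set (B := sqrt (m r ^ 2 - u ^ 2)) in *.
      transitivity ((B ^ 2 + u ^ 2) / (m r * B ^ 3)); [field; lra |].
      rewrite H5; field; lra.
    - apply sqrt_le_1_alt; nra. }
  split.
  - assert (turn_rate K1 r <= turn_rate K2 r); [| lra].
    apply (incr_of_derive_closed (fun u => turn_rate u r) (fun u => m r / sqrt (m r ^ 2 - u ^ 2) ^ 3)); auto.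
    + intros u Hu; now apply Hd.
    + intros u Hu; destruct (Hd u Hu) as [_ H]; apply Rdiv_le_0_compat; [lra | apply pow_lt; lra].
  - assert (m r / b ^ 3 * K1 - turn_rate K1 r <= m r / b ^ 3 * K2 - turn_rate K2 r); [| lra].
    apply (incr_of_derive_closed (fun u => m r / b ^ 3 * u - turn_rate u r)
      (fun u => m r / b ^ 3 - m r / sqrt (m r ^ 2 - u ^ 2) ^ 3)); auto.
    + intros u Hu; destruct (Hd u Hu) as [H _]; deriv_eq; ring.
    + intros u Hu; destruct (Hd u Hu) as [_ H].
      assert (/ sqrt (m r ^ 2 - u ^ 2) ^ 3 <= / b ^ 3).
      { apply Rinv_le_contravar; [apply pow_lt; lra | apply pow_incr; lra]. }
      unfold Rdiv; rewrite <- Rmult_minus_distr_l; apply Rmult_le_pos; lra.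
Qed.

Lemma turn_lipschitz K1 K2 K a b : 0 <= K1 -> K1 <= K2 -> K2 <= K -> 0 < a -> K < m a -> a <= b ->
  0 <= turn K2 a b - turn K1 a b <=
    (b - a) * (m b / sqrt (m a ^ 2 - K ^ 2) ^ 3) * (K2 - K1).
Proof.
  intros H1 H12 H2 Ha HK Hab; set (L := m b / sqrt (m a ^ 2 - K ^ 2) ^ 3).
  assert (HL : 0 < sqrt (m a ^ 2 - K ^ 2) ^ 3) by (apply pow_lt, clairaut_pos; lra).
  assert (E1 : ex_RInt (turn_rate K1) a b) by (apply turn_ex_RInt with a; auto; lra).
  assert (E2 : ex_RInt (turn_rate K2) a b) by (apply turn_ex_RInt with a; auto; lra).
  assert (E : turn K2 a b - turn K1 a b = RInt (fun r => turn_rate K2 r - turn_rate K1 r) a b).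
  { symmetry; apply (RInt_minus (V := R_CompleteNormedModule)); auto. }
  assert (E3 : ex_RInt (fun r => turn_rate K2 r - turn_rate K1 r) a b)
    by (apply (ex_RInt_minus (V := R_NormedModule)); auto).
  rewrite E; split.
  - apply RInt_pos_le; auto; intros r Hr; apply (turn_rate_lipschitz K1 K2 K r a); lra.
  - apply Rle_trans with (RInt (fun _ => L * (K2 - K1)) a b).
    + apply RInt_le; auto; [apply ex_RInt_const |]; intros r Hr.
      destruct (turn_rate_lipschitz K1 K2 K r a) as [_ H]; try lra.
      apply Rle_trans with (1 := H); apply Rmult_le_compat_r; [lra |]; unfold L, Rdiv.
      apply Rmult_le_compat_r; [left; now apply Rinv_0_lt_compat | apply profile_incr; lra].
    + rewrite RInt_Rconst; lra.
Qed.

(** Intermediate values in the Clairaut constant, from 0 (radial geodesic, no turn) to K. [IVT_gen]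
    asks for continuity on the whole line, which [clamp] provides. *)
Lemma turn_attained K x r w : 0 < x -> 0 <= K < m x -> x <= r -> 0 <= w <= turn K x r ->
  exists k, 0 <= k <= K /\ turn k x r = w.
Proof.
  intros Hx HK Hr Hw.
  set (C := (r - x) * (m r / sqrt (m x ^ 2 - K ^ 2) ^ 3)).
  assert (HL : 0 < sqrt (m x ^ 2 - K ^ 2) ^ 3) by (apply pow_lt, clairaut_pos; lra).
  assert (HC : 0 <= C).
  { apply Rmult_le_pos; [lra |]; apply Rdiv_le_0_compat; auto; apply profile_nonneg; lra. }
  assert (Hin : forall t, 0 <= clamp t * K <= K) by (intros t; assert (H := clamp_in t); nra).
  destruct (IVT_gen (fun t => turn (clamp t * K) x r) 0 1 w) as [k [_ Ek]].
  - intros t; apply continuity_pt_of, lipschitz_continuous with (C * K); [nra |]; intros y.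
    apply Rle_trans with (C * Rabs (clamp y * K - clamp t * K)).
    + assert (H1 := Hin t); assert (H2 := Hin y); destruct (Rle_lt_dec (clamp t * K) (clamp y * K)).
      * destruct (turn_lipschitz (clamp t * K) (clamp y * K) K x r) as [H3 H4]; try lra.
        rewrite 2!Rabs_pos_eq by lra; exact H4.
      * destruct (turn_lipschitz (clamp y * K) (clamp t * K) K x r) as [H3 H4]; try lra.
        rewrite 2!Rabs_left1 by lra; fold C in H4; lra.
    + rewrite <- Rmult_minus_distr_r, Rabs_mult, (Rabs_pos_eq K), Rmult_assoc by lra.
      apply Rmult_le_compat_l; auto; rewrite (Rmult_comm K); apply Rmult_le_compat_r; [lra |].
      rewrite <- (Rmult_1_l (Rabs (y - t))); apply clamp_lipschitz.
  - rewrite 2!clamp_id, Rmult_0_l, Rmult_1_l by lra.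
    assert (ET : turn 0 x r = 0).
    { unfold turn; rewrite (RInt_ext _ (fun _ => 0)).
      - rewrite RInt_Rconst; ring.
      - intros u _; apply Rmult_0_l. }
    rewrite ET, Rmin_left, Rmax_right; lra.
  - exists (clamp k * K); split; auto.
Qed.

(** A crude bound, m sqrt (m^2 - K^2) <= m(r)^2 on [x, r]. It makes the turn large when r is large
    while m(r) stays bounded or comparable to K. *)
Lemma turn_ge K x r : 0 < x -> 0 <= K < m x -> x <= r -> K * (r - x) <= turn K x r * m r ^ 2.
Proof.
  intros Hx HK Hr; assert (Hmr := profile_incr x r ltac:(lra) Hr).
  assert (H : RInt (fun _ => K / m r ^ 2) x r <= turn K x r).
  { apply RInt_le; auto; [apply ex_RInt_const | apply turn_ex_RInt with x; auto; lra |].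
    intros u Hu; unfold turn_rate, Rdiv; apply Rmult_le_compat_l; [lra |].
    assert (H1 := profile_incr x u ltac:(lra) ltac:(lra)).
    assert (H2 := profile_incr u r ltac:(lra) ltac:(lra)).
    destruct (clairaut_pos K (m u)) as [H3 H4]; [lra |].
    assert (H5 := clairaut_sqrt_le K (m u) ltac:(lra)).
    apply Rinv_le_contravar; [apply Rmult_lt_0_compat; lra | nra]. }
  rewrite RInt_Rconst in H.
  apply Rmult_le_compat_r with (r := m r ^ 2) in H; [| apply pow2_ge_0].
  apply Rle_trans with (2 := H); right; field; lra.
Qed.

(* In the flat plane the angle swept from the closest point to radius r is atan of this parameter. *)
Definition clairaut_par (K r : R) : R := sqrt (m r ^ 2 - K ^ 2) / K.

Lemma clairaut_par_derive K r : 0 < K < m r ->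
  is_derive (clairaut_par K) r (m r * Derive m r / (K * sqrt (m r ^ 2 - K ^ 2))).
Proof.
  intros H; destruct (clairaut_pos K (m r)) as [H1 H2]; [lra |].
  assert (Hd := profile_derive r).
  unfold clairaut_par; eapply is_derive_eq; [deriv; auto; lra | field; lra].
Qed.

Lemma clairaut_par_sqr K r : 0 < K <= m r -> 1 + clairaut_par K r ^ 2 = m r ^ 2 / K ^ 2.
Proof.
  intros H; unfold clairaut_par; assert (0 <= m r ^ 2 - K ^ 2) by nra.
  unfold Rdiv at 1; rewrite Rpow_mult_distr, sqrt_sqr_eq by auto; field; lra.
Qed.

Lemma clairaut_par_nonneg K r : 0 < K -> 0 <= clairaut_par K r.
Proof. intros H; apply Rdiv_le_0_compat; auto; apply sqrt_pos. Qed.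

(** The Euclidean turn grows m' times as fast as the turn. Monotonicity of m' is thus exactly the
    hypothesis of [convex_chord]. *)
Lemma atan_clairaut_derive K r : 0 < K < m r ->
  is_derive (fun r => atan (clairaut_par K r)) r (Derive m r * turn_rate K r).
Proof.
  intros H; destruct (clairaut_pos K (m r)) as [H1 H2]; [lra |].
  assert (Hd := clairaut_par_derive K r H).
  deriv_eq.
  rewrite clairaut_par_sqr by lra; unfold turn_rate; field; lra.
Qed.

Lemma turn_chord K x r s : 0 < x -> 0 < K < m x -> x <= r -> r <= s ->
  turn K x r * atan (clairaut_par K s) <= turn K x s * atan (clairaut_par K r).
Proof.
  intros Hx HK Hr Hs.
  apply (convex_chord (fun r => turn K x r) (fun r => atan (clairaut_par K r))
           (Derive m) (turn_rate K) x r s); auto.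
  - intros t Ht; assert (Hmt := profile_incr x t ltac:(lra) ltac:(lra)).
    split; [| split].
    + apply turn_derive; auto; lra.
    + apply atan_clairaut_derive; lra.
    + apply turn_rate_pos; lra.
  - intros t u Ht Htu _; apply profile_derive_decr; lra.
  - apply turn_self.
  - apply atan_pos_bounds, clairaut_par_nonneg; lra.
Qed.

Lemma outward_turning_inequality k K M x r : 0 < x -> 0 <= k < K -> K < m x -> x <= r -> 0 <= M ->
  (forall u, x <= u <= r -> turn K x u <= M * atan (clairaut_par K u)) ->
  (K - k) * turn K x r + slope_int K x r - slope_int k x r <= M * flat_leg k K.
Proof.
  intros Hx Hk HK Hr HM HT.
  apply (turning_inequality k K Hk M (clairaut_par K) (fun r => turn K x r)
    (fun r => (K - k) * turn K x r + slope_int K x r - slope_int k x r)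
    (fun r => m r * Derive m r / (K * sqrt (m r ^ 2 - K ^ 2))) (turn_rate K) x r); auto.
  - intros t Ht; assert (Hmt := profile_incr x t ltac:(lra) ltac:(lra)).
    assert (Hd := turn_derive K x t Hx ltac:(lra) ltac:(lra)).
    split; [apply clairaut_par_derive; lra | split; [auto |]].
    assert (D1 := slope_int_derive K x t ltac:(right; lra)).
    assert (D2 := slope_int_derive k x t ltac:(right; lra)).
    deriv_eq.
    rewrite 2!slope_eq by (auto; lra); unfold gap_rate.
    rewrite clairaut_par_sqr by lra.
    replace (K ^ 2 * (m t ^ 2 / K ^ 2) - k ^ 2) with (m t ^ 2 - k ^ 2) by (field; lra).
    unfold clairaut_par, turn_rate; destruct (clairaut_pos K (m t)) as [H1 H2]; [lra |].
    field; lra.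
  - intros t Ht; assert (Hmt := profile_incr x t ltac:(lra) ltac:(lra)).
    split; [apply clairaut_par_nonneg; lra | split; [| auto]].
    destruct (clairaut_pos K (m t)) as [H1 H2]; [lra |].
    apply Rdiv_le_0_compat; [| nra].
    apply Rmult_le_pos; [lra | apply profile_derive_pos; lra].
  - apply turn_self.
  - rewrite turn_self, 2!slope_int_self; ring.
Qed.

(** If m stayed below v, the turn up to r would be at least K (r - x) / v^2; r is chosen so that K
    (r - x) = PI v^2 + 1. *)
Lemma turn_bounded_unbounded x : 0 < x -> turn_bounded x -> forall v, exists r, 0 <= r /\ v <= m r.
Proof.
  intros Hx HT v; apply NNPP; intros HN.
  assert (Hv : forall r, 0 <= r -> m r < v).
  { intros r Hr; apply Rnot_le_lt; intros H; apply HN; exists r; auto. }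
  assert (Hmx := profile_pos x Hx); assert (Hvx := Hv x ltac:(lra)).
  set (K := m x / 2).
  set (r := x + (PI * v ^ 2 + 1) / K).
  assert (HP := PI_RGT_0).
  assert (Hr : x < r).
  { assert (0 < (PI * v ^ 2 + 1) / K); [| unfold r; lra].
    apply Rdiv_lt_0_compat; unfold K; nra. }
  assert (H1 := turn_ge K x r Hx ltac:(unfold K; lra) ltac:(lra)).
  assert (H2 := HT K r ltac:(unfold K; lra) Hr).
  assert (H3 := Hv r ltac:(lra)); assert (H4 := profile_incr x r ltac:(lra) ltac:(lra)).
  assert (H5 : turn K x r * m r ^ 2 <= PI * v ^ 2).
  { apply Rle_trans with (PI * m r ^ 2); [apply Rmult_le_compat_r; auto; apply pow2_ge_0 |].
    apply Rmult_le_compat_l; [lra | apply pow_incr; lra]. }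
  replace (K * (r - x)) with (PI * v ^ 2 + 1) in H1 by (unfold r; field; unfold K; lra).
  lra.
Qed.

(** * Rays and the turn bound *)

(** Equality of angles modulo 2 PI is encoded by the cosines of all their shifts, which avoids
    naming the integer multiple. *)
Lemma pol_congr r a b : (forall g, cos (a - g) = cos (b - g)) -> pol r a = pol r b.
Proof.
  intros H; assert (H0 := H 0); assert (H1 := H (PI / 2)); rewrite 2!Rminus_0_r in H0.
  unfold pol; rewrite H0; do 2 f_equal.
  rewrite <- 2!cos_shift; rewrite <- (cos_neg (PI / 2 - a)), <- (cos_neg (PI / 2 - b)).
  now replace (- (PI / 2 - a)) with (a - PI / 2) by ring;
    replace (- (PI / 2 - b)) with (b - PI / 2) by ring.
Qed.

Lemma polar_relative (a : R) (p : pt) :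
  exists s w, (s = 1 \/ s = -1) /\ 0 <= w <= PI /\ p = pol (rad p) (a + s * w).
Proof.
  destruct (polar_form p) as [b Hb].
  set (w := acos (cos (b - a))).
  assert (Hw : 0 <= w <= PI) by apply acos_bound.
  assert (Hcb := COS_bound (b - a)).
  assert (Hc : cos w = cos (b - a)) by (apply cos_acos; lra).
  assert (Hs : sin w = sin (b - a) \/ sin w = - sin (b - a)).
  { assert (E1 := sin2_cos2 w); assert (E2 := sin2_cos2 (b - a)); unfold Rsqr in *.
    rewrite Hc in E1.
    assert (E : (sin w - sin (b - a)) * (sin w + sin (b - a)) = 0) by lra.
    apply Rmult_integral in E; lra. }
  assert (Hg : exists s, (s = 1 \/ s = -1) /\ cos (s * w) = cos (b - a) /\ sin (s * w) = sin (b - a)).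
  { destruct Hs as [Hs | Hs].
    - exists 1; rewrite Rmult_1_l; auto.
    - exists (-1); replace (-1 * w) with (- w) by ring; rewrite cos_neg, sin_neg; split; [auto | lra]. }
  destruct Hg as [s [Hs1 [Hs2 Hs3]]]; exists s, w; split; [auto | split; [auto |]].
  rewrite Hb at 1; apply pol_congr; intros g.
  replace (b - g) with ((b - a) + (a - g)) by ring; replace (a + s * w - g) with (s * w + (a - g)) by ring.
  now rewrite 2!cos_plus, Hs2, Hs3.
Qed.

Lemma euclid_triangle p q :
  sqrt ((fst q - fst p) ^ 2 + (snd q - snd p) ^ 2) <= rad p + rad q.
Proof.
  assert (H1 := rad_pos p); assert (H2 := rad_pos q).
  assert (E1 := rad_sqr p); assert (E2 := rad_sqr q).
  rewrite <- (sqrt_pow2 (rad p + rad q)) by lra; apply sqrt_le_1_alt.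
  set (a := rad p) in *; set (b := rad q) in *; destruct p as [p1 p2], q as [q1 q2]; cbn [fst snd] in *.
  assert (- (p1 * q1 + p2 * q2) <= a * b); [| nra].
  apply Rsqr_incr_0_var; [| nra]; unfold Rsqr.
  assert (a ^ 2 * b ^ 2 = (p1 ^ 2 + p2 ^ 2) * (q1 ^ 2 + q2 ^ 2)) by now rewrite E1, E2.
  assert (0 <= (p1 * q2 - p2 * q1) ^ 2) by apply pow2_ge_0; nra.
Qed.

(** As w <= PI, it is the least absolute value in its class modulo 2 PI and sign: if |th| + |D| < w,
    strict decrease of cos on [0, PI] gives cos (th + D) > cos w. *)
Lemma angle_lift_ge (th D w s : R) : (s = 1 \/ s = -1) -> 0 <= w <= PI ->
  cos (th + D) = cos (s * w) -> w - Rabs th <= Rabs D.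
Proof.
  intros Hs Hw Hc; apply Rnot_lt_le; intros Hlt.
  assert (Hcw : cos (s * w) = cos w).
  { destruct Hs as [-> | ->]; [now rewrite Rmult_1_l |].
    now replace (-1 * w) with (- w) by ring; rewrite cos_neg. }
  assert (Hsum := Rabs_triang th D).
  assert (Hca : cos (Rabs (th + D)) = cos (th + D)).
  { unfold Rabs; destruct Rcase_abs; auto; apply cos_neg. }
  assert (cos w < cos (Rabs (th + D))).
  { apply cos_decreasing_1; try lra; apply Rabs_pos. }
  lra.
Qed.

(** First-order expansion of the squared radius; only the right derivative at 0 is available. The
    direction points inwards or along the parallel, so the radius grows by o(h) at most. *)
Lemma initial_radius_bound q g1 g2 w d : 0 < rad q -> 0 < d ->
  (g1 0, g2 0) = q -> init_velocity g1 g2 w -> fst w * fst q + snd w * snd q <= 0 ->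
  exists h0, 0 < h0 /\ forall h, 0 < h < h0 -> rad (g1 h, g2 h) <= rad q + d * h.
Proof.
  intros Hr Hd Hq [Hw1 Hw2] Hwq.
  destruct q as [a b]; injection Hq; intros Eb Ea; rewrite Ea in Hw1; rewrite Eb in Hw2.
  destruct w as [w1 w2]; cbn [fst snd] in *.
  set (x := rad (a, b)) in *; assert (Ex : x ^ 2 = a ^ 2 + b ^ 2) by apply (rad_sqr (a, b)).
  set (u1 := fun h => (g1 h - a) / h); set (u2 := fun h => (g2 h - b) / h).
  set (F := at_right 0).
  assert (Lp : forall (f g : R -> R) (y z : R), filterlim f F (locally y) ->
    filterlim g F (locally z) -> filterlim (fun h => f h + g h) F (locally (y + z))).
  { intros f g y z Hf Hg; apply filterlim_comp_2 with (1 := Hf) (2 := Hg), (filterlim_plus (V := R_NormedModule) y z). }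
  assert (Lm : forall (f g : R -> R) (y z : R), filterlim f F (locally y) ->
    filterlim g F (locally z) -> filterlim (fun h => f h * g h) F (locally (y * z))).
  { intros f g y z Hf Hg; apply filterlim_comp_2 with (1 := Hf) (2 := Hg), (filterlim_mult (K := R_AbsRing) y z). }
  assert (Lc : forall c : R, filterlim (fun _ : R => c) F (locally c)) by (intros c; apply filterlim_const).
  assert (Li : filterlim (fun h : R => h) F (locally 0)) by (intros P HP; apply filter_le_within, HP).
  (* The limit of 2 <q, u> + h |u|^2, where u is the difference quotient at h; multiplied by h this
     is the increment of the squared radius. *)
  assert (L := Lp _ _ _ _ (Lm _ _ _ _ (Lc 2) (Lp _ _ _ _ (Lm _ _ _ _ (Lc a) Hw1) (Lm _ _ _ _ (Lc b) Hw2)))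
    (Lm _ _ _ _ Li (Lp _ _ _ _ (Lm _ _ _ _ Hw1 Hw1) (Lm _ _ _ _ Hw2 Hw2)))).
  assert (Hlt : 2 * (a * w1 + b * w2) + 0 * (w1 * w1 + w2 * w2) < 2 * (x * d)) by nra.
  destruct (L _ (open_lt _ _ Hlt)) as [h0 Hh0].
  exists h0; split; [apply cond_pos |]; intros h Hh.
  assert (Hs := Hh0 h ltac:(change (Rabs (h - 0) < h0); rewrite Rabs_pos_eq; lra) (proj1 Hh)).
  cbv beta in Hs; fold (u1 h) (u2 h) in Hs.
  assert (G1 : g1 h = a + h * u1 h) by (unfold u1; field; lra).
  assert (G2 : g2 h = b + h * u2 h) by (unfold u2; field; lra).
  apply (Rmult_lt_compat_l h) in Hs; [| lra].
  rewrite <- (sqrt_pow2 (x + d * h)) by nra; unfold rad; cbn [fst snd].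
  assert (0 <= (d * h) ^ 2) by apply pow2_ge_0.
  apply sqrt_le_1_alt; rewrite G1, G2; lra.
Qed.

(** [flat_leg k] increases up to v and has derivative at least sqrt (v^2 - K1^2) / c from v to c.
    The margin is uniform in k and K, which are chosen only later. *)
Lemma flat_leg_gap k K K1 v c : 0 <= k < K -> K <= K1 -> K1 < v -> v < c ->
  (c - v) * (sqrt (v ^ 2 - K1 ^ 2) / c) <= flat_leg k c - flat_leg k K.
Proof.
  intros Hk HK Hv Hc.
  assert (H1 : flat_leg k K <= flat_leg k v).
  { apply (incr_of_derive_closed (flat_leg k) (fun v => sqrt (v ^ 2 - k ^ 2) / v)); [lra | |].
    - intros u Hu; apply flat_leg_derive; lra.
    - intros u Hu; apply Rdiv_le_0_compat; [apply sqrt_pos | lra]. }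
  set (L := sqrt (v ^ 2 - K1 ^ 2) / c).
  assert (flat_leg k v - L * v <= flat_leg k c - L * c); [| lra].
  apply (incr_of_derive_closed (fun u => flat_leg k u - L * u)
           (fun u => sqrt (u ^ 2 - k ^ 2) / u - L)); [lra | |].
  - intros u Hu; assert (H := flat_leg_derive k u ltac:(lra)).
    deriv_eq; ring.
  - intros u Hu.
    assert (sqrt (v ^ 2 - K1 ^ 2) <= sqrt (u ^ 2 - k ^ 2)) by (apply sqrt_le_1_alt; nra).
    assert (0 <= sqrt (v ^ 2 - K1 ^ 2)) by apply sqrt_pos.
    assert (/ c <= / u) by (apply Rinv_le_contravar; lra).
    assert (0 < / c) by (apply Rinv_0_lt_compat; lra).
    unfold L, Rdiv.
    assert (sqrt (v ^ 2 - K1 ^ 2) * / c <= sqrt (u ^ 2 - k ^ 2) * / u); [| lra].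
    apply Rmult_le_compat; lra.
Qed.

(** Parametrized by the radius, the geodesic has speed m / sqrt (m^2 - K^2); writing m^2 = K^2 +
    (m^2 - K^2) splits it into K [turn_rate] + [slope]. *)
Lemma dist_m_le_outward K x r a s : 0 < x -> 0 <= K < m x -> x <= r -> (s = 1 \/ s = -1) ->
  dist_m m (pol x a) (pol r (a + s * turn K x r)) <= K * turn K x r + slope_int K x r.
Proof.
  intros Hx HK Hr Hs; destruct (level_nbhd K x Hx ltac:(lra)) as [l [Hl Hlm]].
  assert (Hs2 : s ^ 2 = 1) by (destruct Hs; subst s; ring).
  assert (HT : forall u : R, l < u -> is_derive (fun r => turn K x r) u (turn_rate K u)).
  { intros u Hu; apply is_derive_RInt_on with l; simpl; try lra.
    intros v Hv; apply turn_rate_continuous; auto; split; [lra | now apply Hlm]. }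
  assert (H := dist_m_le_polar (fun u => u) (fun u => a + s * turn K x u)
    (fun _ => 1) (fun u => s * turn_rate K u)
    (fun u => K * turn K x u + slope_int K x u) l x r).
  cbv beta in H; rewrite turn_self, slope_int_self, 2!Rmult_0_r, 2!Rplus_0_r, Rminus_0_r in H.
  apply H; clear H; auto; [simpl; lra | |].
  { intros u Hu; simpl in Hu; assert (K1 := HT u Hu); assert (K2 := Hlm u Hu).
    assert (K3 := turn_rate_continuous K u ltac:(lra)).
    split; [deriv | split; [eapply is_derive_eq; [deriv | cbv beta; ring] | split; [lra | split; cont]]]. }
  intros u Hu; assert (K1 := HT u ltac:(lra)); assert (K2 := Hlm u ltac:(lra)).
  assert (K3 := slope_int_derive K x u ltac:(right; lra)).
  deriv_eq.
  rewrite slope_eq by (auto; lra).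
  destruct (clairaut_pos K (m u)) as [H1 H2]; [lra |].
  assert (E := sqrt_sqr_eq _ (Rlt_le _ _ H1)).
  set (B := sqrt (m u ^ 2 - K ^ 2)) in *.
  replace (1 ^ 2 + (m u * (s * turn_rate K u)) ^ 2) with ((m u / B) ^ 2).
  - rewrite sqrt_pow2 by (apply Rdiv_le_0_compat; lra).
    unfold turn_rate; fold B; transitivity ((K ^ 2 + B ^ 2) / (m u * B)); [field; lra |].
    rewrite E; field; lra.
  - unfold turn_rate; fold B.
    transitivity ((B ^ 2 + s ^ 2 * K ^ 2) / B ^ 2); [| field; lra].
    rewrite Hs2, E at 1; field; lra.
Qed.

(* As r grows with the turn bounded by PI, the ratio K / m(r) tends to 0, so the Euclidean turn
   atan s tends to PI/2; convexity ([turn_chord]) then bounds the turn at smaller radii. *)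
Lemma euclidean_turn_large x e : 0 < x -> 0 < e ->
  exists r0, x < r0 /\ forall K r, 0 < K < m x -> r0 <= r -> turn K x r <= PI ->
    forall u, x <= u <= r -> turn K x u <= (2 + e) * atan (clairaut_par K u).
Proof.
  intros Hx He; assert (HP := PI_RGT_0); assert (Hmx := profile_pos x Hx).
  set (z := PI / (2 + e)).
  assert (Hz : 0 < z < PI / 2).
  { unfold z; split; [apply Rdiv_lt_0_compat; lra |].
    apply Rmult_lt_compat_l; [lra | apply Rinv_lt_contravar; lra]. }
  set (T := 1 + tan z).
  assert (Htz : 0 < tan z) by (apply tan_gt_0; lra).
  assert (HrT : 0 < PI * m x * T ^ 2).
  { apply Rmult_lt_0_compat; [apply Rmult_lt_0_compat; lra | apply pow_lt; unfold T; lra]. }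
  exists (x + PI * m x * T ^ 2); split; [lra |].
  intros K r HK Hr HT u Hu.
  assert (Hmr := profile_incr x r ltac:(lra) ltac:(lra)).
  (* Otherwise [turn_ge] gives K (r - x) <= PI m(r)^2 < PI (K T) (m(x) T), against the choice of the
     threshold for r. *)
  assert (HKT : K * T <= m r).
  { apply Rnot_lt_le; intros Hlt.
    assert (H1 := turn_ge K x r Hx ltac:(lra) ltac:(lra)).
    assert (H2 : turn K x r * m r ^ 2 <= PI * m r ^ 2)
      by (apply Rmult_le_compat_r; auto; apply pow2_ge_0).
    assert (H3 : m r ^ 2 < (K * T) * (m x * T)).
    { replace (m r ^ 2) with (m r * m r) by ring.
      assert (K * T <= m x * T) by (apply Rmult_le_compat_r; unfold T; lra).
      apply Rmult_le_0_lt_compat; try lra. }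
    assert (H4 : PI * m r ^ 2 < PI * (K * T * (m x * T))) by (apply Rmult_lt_compat_l; auto).
    assert (H5 : K * (PI * m x * T ^ 2) <= K * (r - x)) by (apply Rmult_le_compat_l; lra).
    lra. }
  assert (Hz2 : z <= atan (clairaut_par K r)).
  { rewrite <- (atan_tan z) by lra.
    assert (Hle : tan z < clairaut_par K r); [| left; now apply atan_increasing].
    assert (E := clairaut_par_sqr K r ltac:(lra)).
    assert (Hp := clairaut_par_nonneg K r ltac:(lra)).
    assert (HT2 : T ^ 2 <= m r ^ 2 / K ^ 2).
    { replace (m r ^ 2 / K ^ 2) with ((m r / K) ^ 2) by (field; lra).
      apply pow_incr; split; [unfold T; lra | apply Rle_div_r; lra]. }
    apply Rnot_le_lt; intros Hle; unfold T in HT2; nra. }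
  assert (H1 := turn_chord K x u r Hx HK ltac:(lra) ltac:(lra)).
  assert (Hau := atan_pos_bounds _ (clairaut_par_nonneg K u ltac:(lra))).
  assert (H0 := turn_nonneg K x u Hx ltac:(lra) ltac:(lra)).
  assert (H2 : turn K x u * z <= turn K x u * atan (clairaut_par K r))
    by (apply Rmult_le_compat_l; auto).
  assert (H3 : turn K x r * atan (clairaut_par K u) <= PI * atan (clairaut_par K u))
    by (apply Rmult_le_compat_r; lra).
  apply Rmult_le_reg_r with z; [lra |].
  replace ((2 + e) * atan (clairaut_par K u) * z) with (PI * atan (clairaut_par K u))
    by (unfold z; field; lra).
  lra.
Qed.
(* If geodesics with Clairaut constant K1 < m(x) turn by more than PI, then a far away point p is
   joined to q by an outward geodesic with Clairaut constant K <= K1, of length J. Curves from a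
   point near q, at essentially the same radius, to p have length greater than J - h: those that stay
   in [m >= K] by calibration, the others by the turning inequality. *)
Lemma ray_turn_bounded q g1 g2 w : 0 < rad q -> is_ray m q g1 g2 -> init_velocity g1 g2 w ->
  fst w * fst q + snd w * snd q <= 0 -> turn_bounded (rad q).
Proof.
  intros Hx [Hg0 Hray] Hw Hwq; set (x := rad q) in *; assert (HP := PI_RGT_0).
  intros k1 r1 Hk1 Hr1; apply Rnot_lt_le; intros Hturn.
  set (c := m x) in *; set (k2 := (k1 + c) / 2).
  assert (Hk2 : k1 < k2 < c) by (unfold k2; lra).
  (* Thus k1 / k2 = 1 - 2 d. Twice d is the first-order gain from k1 < k2; it pays for the radial
     error d h and the two approximation errors d h / 4. *)
  set (d := (1 - k1 / k2) / 2).
  assert (Hk12 : k1 / k2 < 1) by (apply Rlt_div_l; lra).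
  assert (Hk12' : 0 < k1 / k2) by (apply Rdiv_lt_0_compat; lra).
  assert (Hd : 0 < d < 1 / 2) by (unfold d; lra).
  (* The margin of [flat_leg_gap]. Using M = 2 + eta / c in the turning inequality costs at most
     eta, since flat_leg k K <= c. *)
  set (eta := (c - k2) * (sqrt (k2 ^ 2 - k1 ^ 2) / c)).
  assert (Heta : 0 < eta).
  { apply Rmult_lt_0_compat; [lra | apply Rdiv_lt_0_compat; [apply sqrt_lt_R0; nra | lra]]. }
  destruct (level_nbhd k2 x Hx ltac:(fold c; lra)) as [l [Hl Hlm]].
  destruct (initial_radius_bound q g1 g2 w d Hx ltac:(lra) Hg0 Hw Hwq) as [h0 [Hh0 Hrad]].
  set (h := Rmin (h0 / 2) (Rmin ((x - l) / 4) (eta / 4))).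
  assert (Hh : 0 < h < h0 /\ h <= (x - l) / 4 /\ h <= eta / 4).
  { assert (A1 := Rmin_l (h0 / 2) (Rmin ((x - l) / 4) (eta / 4))).
    assert (A2 := Rmin_r (h0 / 2) (Rmin ((x - l) / 4) (eta / 4))).
    assert (A3 := Rmin_l ((x - l) / 4) (eta / 4)); assert (A4 := Rmin_r ((x - l) / 4) (eta / 4)).
    fold h in A1, A2; split; [split; [| lra] | lra].
    unfold h; repeat apply Rmin_pos; lra. }
  destruct Hh as [[Hhp Hhh0] [Hhl Hheta]].
  assert (Hdh : 0 < d * h /\ d * h <= h /\ 0 < d * (d * h)).
  { assert (0 < d * h) by (apply Rmult_lt_0_compat; lra).
    assert (d * h <= 1 * h) by (apply Rmult_le_compat_r; lra).
    assert (0 < d * (d * h)) by (apply Rmult_lt_0_compat; lra); lra. }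
  assert (Hxh := Hrad h ltac:(lra)); fold x in Hxh.
  set (xh := rad (g1 h, g2 h)) in *.
  assert (Hdqh : dist_m m q (g1 h, g2 h) = h).
  { rewrite <- Hg0, Hray by lra; rewrite Rabs_left1; lra. }
  assert (Hxh2 : Rabs (xh - x) <= h) by (rewrite <- Hdqh; apply dist_m_ge_rad; auto).
  apply Rabs_le_between in Hxh2.
  destruct (polar_form q) as [a Hqa]; fold x in Hqa.
  (* In time h the ray turns by at most about h / k2: a nearly minimal curve from q stays at radii
     above l, where m > k2, and is calibrated with k2. *)
  assert (Hth : exists th, (g1 h, g2 h) = pol xh (a + th) /\ k2 * Rabs th <= h * (1 + d / 4)).
  { destruct (dist_m_approx q (g1 h, g2 h) (h * (d / 4)) ltac:(lra)) as [c1 [c2 [HC [H0 [H1 HL]]]]].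
    destruct (polar_form (g1 h, g2 h)) as [b Hb]; fold xh in Hb.
    rewrite Hqa in H0; rewrite Hb in H1.
    destruct (curve_length_ge c1 c2 x a xh b Hx ltac:(lra) HC H0 H1)
      as [y [D [Hy [Hy' [HD Hlen]]]]].
    rewrite Hdqh in HL; assert (h * (d / 4) <= h) by lra.
    assert (Hlen0 := Hlen 0 (conj (Rle_refl 0) (profile_nonneg y ltac:(lra)))).
    rewrite 2!slope_int_0 in Hlen0.
    assert (Hly : l < y) by lra.
    exists D; split.
    - rewrite Hb; symmetry; now apply pol_congr.
    - assert (Hlen2 := Hlen k2 ltac:(assert (HK := Hlm y Hly); lra)).
      assert (S1 := slope_int_bounds k2 y x ltac:(lra) ltac:(lra)).
      assert (S2 := slope_int_bounds k2 y xh ltac:(lra) ltac:(lra)).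
      lra. }
  destruct Hth as [th [Hgh Hth]].
  destruct (euclidean_turn_large x (eta / c) Hx ltac:(apply Rdiv_lt_0_compat; lra))
    as [r0 [Hr0 Hlarge]].
  set (t := Rmax r0 r1 + x).
  assert (Ht : r0 + x <= t /\ r1 + x <= t).
  { unfold t; assert (A1 := Rmax_l r0 r1); assert (A2 := Rmax_r r0 r1); lra. }
  set (p := (g1 t, g2 t)); set (r := rad p).
  assert (Hdqp : dist_m m q p = t).
  { unfold p; rewrite <- Hg0, Hray by lra; rewrite Rabs_left1; lra. }
  assert (Hdhp : dist_m m (g1 h, g2 h) p = t - h).
  { unfold p; rewrite Hray by lra; rewrite Rabs_left1; lra. }
  assert (Hr : t <= x + r).
  { rewrite <- Hdqp; apply Rle_trans with (1 := dist_m_le_euclid q p), euclid_triangle. }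
  destruct (polar_relative a p) as [s [phi [Hs [Hphi Hp]]]]; fold r in Hp.
  assert (Hturn2 : PI <= turn k1 x r).
  { apply Rle_trans with (turn k1 x r1); [lra | apply turn_incr; auto; fold c; lra]. }
  destruct (turn_attained k1 x r phi Hx ltac:(fold c; lra) ltac:(lra) ltac:(lra)) as [K [HK HKphi]].
  assert (HJ : t <= K * phi + slope_int K x r).
  { rewrite <- Hdqp, Hqa, Hp, <- HKphi; apply dist_m_le_outward; auto; fold c; lra. }
  destruct (dist_m_approx (g1 h, g2 h) p (h * (d / 4)) ltac:(lra)) as [c1 [c2 [HC [H0 [H1 HL]]]]].
  rewrite Hdhp in HL; rewrite Hgh in H0; rewrite Hp in H1.
  destruct (curve_length_ge c1 c2 xh (a + th) r (a + s * phi) ltac:(lra) ltac:(lra) HC H0 H1)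
    as [y [D [Hy [Hy' [HD Hlen]]]]].
  assert (HDphi : phi - Rabs th <= Rabs D).
  { apply angle_lift_ge with s; auto; assert (E := HD a).
    replace (a + th + D - a) with (th + D) in E by ring.
    now replace (a + s * phi - a) with (s * phi) in E by ring. }
  assert (Hmy := profile_nonneg y ltac:(lra)).
  assert (Hthp := Rabs_pos th).
  assert (Hyk := fun k => profile_null_or_pos k y).
  destruct (Rle_lt_dec K (m y)) as [HKy | HKy].
  (* Calibration with K loses at most K |th| + d h against J, that is ((1 - 2 d) (1 + d / 4) + d) h,
     and adding d h / 4 still leaves less than h. *)
  - assert (Hl1 := Hlen K ltac:(lra)); assert (HKy0 := Hyk K ltac:(lra) ltac:(lra)).
    assert (C1 := slope_int_chasles K y x r ltac:(destruct HKy0; [auto | right; lra])).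
    assert (S1 := slope_int_bounds K y xh ltac:(auto) ltac:(lra)).
    assert (S2 : - (d * h) <= slope_int K y x).
    { destruct (Rle_lt_dec y x) as [Hyx | Hyx].
      - assert (S2 := slope_int_bounds K y x ltac:(auto) Hyx); lra.
      - rewrite slope_int_swap by (auto; right; lra).
        assert (S2 := slope_int_bounds K x y ltac:(auto) ltac:(lra)); lra. }
    assert (K * (phi - Rabs th) <= K * Rabs D) by (apply Rmult_le_compat_l; lra).
    assert (K * Rabs th <= (1 - 2 * d) * (h * (1 + d / 4))).
    { apply Rle_trans with (k1 / k2 * (k2 * Rabs th)).
      - replace (k1 / k2 * (k2 * Rabs th)) with (k1 * Rabs th) by (field; lra).
        apply Rmult_le_compat_r; lra.
      - replace (1 - 2 * d) with (k1 / k2) by (unfold d; lra).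
        apply Rmult_le_compat_l; lra. }
    lra.
  - set (k := m y) in *.
    assert (Hyx : y < x).
    { apply Rnot_le_lt; intros H; assert (c <= k); [| lra].
      apply profile_incr; lra. }
    assert (Hl1 := Hlen k ltac:(lra)); assert (Hky0 := Hyk k ltac:(lra) ltac:(lra)).
    assert (C1 := slope_int_chasles k y x r ltac:(destruct Hky0; [auto | right; lra])).
    assert (C2 := slope_int_chasles k y x xh ltac:(destruct Hky0; [auto | right; lra])).
    assert (S1 : - h <= slope_int k x xh).
    { destruct (Rle_lt_dec x xh).
      - assert (S1 := slope_int_bounds k x xh ltac:(auto) ltac:(lra)); lra.
      - rewrite slope_int_swap by (auto; right; lra).
        assert (S1 := slope_int_bounds k xh x ltac:(right; lra) ltac:(lra)); lra. }
    assert (S2 : flat_leg k c <= slope_int k y x).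
    { apply slope_int_ge_flat_leg; auto; try lra; fold c k; lra. }
    assert (S3 : k * Rabs th <= 2 * h).
    { apply Rle_trans with (k2 * Rabs th); [apply Rmult_le_compat_r; lra | lra]. }
    assert (S4 : k * (phi - Rabs th) <= k * Rabs D) by (apply Rmult_le_compat_l; lra).
    assert (G := flat_leg_gap k K k1 k2 c ltac:(lra) ltac:(lra) ltac:(lra) ltac:(lra)); fold eta in G.
    assert (Hti := outward_turning_inequality k K (2 + eta / c) x r Hx ltac:(lra)
      ltac:(fold c; lra) ltac:(lra) ltac:(assert (0 < eta / c) by (apply Rdiv_lt_0_compat; lra); lra)
      (Hlarge K r ltac:(fold c; lra) ltac:(lra) ltac:(lra))).
    rewrite HKphi in Hti.
    assert (Hfl : flat_leg k K <= c).
    { apply Rle_trans with (1 := flat_leg_le_self k K ltac:(lra)).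
      assert (H := clairaut_sqrt_le k K ltac:(lra)); lra. }
    assert (eta / c * flat_leg k K <= eta).
    { apply Rle_trans with (eta / c * c); [| right; field; lra].
      apply Rmult_le_compat_l; [apply Rlt_le, Rdiv_lt_0_compat |]; lra. }
    assert (h * (d / 4) <= h) by lra.
    lra.
Qed.

(** * The geodesic tangent to a parallel *)

Definition inverse_profile (n : R -> R) : Prop :=
  (forall v, m (n v) = v) /\ (forall x, n (m x) = x) /\
  (forall v, is_derive n v (/ Derive m (n v))) /\ (forall u v, u < v -> n u < n v) /\
  (forall x, 0 < Derive m x).

(** If m'(x) = 0 then m' <= 0 from x on and m is bounded; so unboundedness gives m' > 0 on the
    half-line, and oddness of m carries everything to the negative side. *)
Lemma inverse_profile_exists :
  (forall v, exists r, 0 <= r /\ v <= m r) -> exists n, inverse_profile n.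
Proof.
  intros Hunb.
  assert (Hp0 : forall x, 0 <= x -> 0 < Derive m x).
  { intros x Hx; destruct (profile_derive_pos x Hx) as [H | H]; auto; exfalso.
    destruct (Hunb (m x + 1)) as [r [Hr Hv]].
    destruct (Rle_lt_dec r x) as [Hrx | Hrx].
    - assert (H1 := profile_incr r x Hr Hrx); lra.
    - assert (- m x <= - m r); [| lra].
      apply (incr_of_derive_closed (fun t => - m t) (fun t => - Derive m t)); [lra | |].
      + intros t Ht; assert (Hd := profile_derive t); deriv.
      + intros t Ht; assert (H1 := profile_derive_decr x t Hx); lra. }
  assert (Hodd : forall x, m (- x) = - m x) by apply Hm.
  assert (Heven : forall x, Derive m (- x) = Derive m x).
  { intros x; symmetry; apply is_derive_unique.
    apply (is_derive_ext (fun t => - m (- t))).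
    { intros t; change (- m (- t) = m t); rewrite Hodd; ring. }
    assert (H := is_derive_Rcomp m Ropp x _ _ (profile_derive (- x))
                   (is_derive_Ropp _ _ _ (is_derive_Rid x))).
    deriv_eq; ring. }
  assert (Hp : forall x, 0 < Derive m x).
  { intros x; destruct (Rle_lt_dec 0 x); [auto | rewrite <- Heven; apply Hp0; lra]. }
  assert (Hs0 : forall v, 0 <= v -> exists x, m x = v).
  { intros v Hv; destruct (Hunb v) as [r [Hr Hvr]].
    destruct (IVT_gen m 0 r v) as [x [_ Hx]]; [| | now exists x].
    - intros t; apply continuity_pt_of, profile_continuous.
    - rewrite profile_0; rewrite Rmin_left, Rmax_right; lra. }
  destruct (inverse_function m (Derive m)) as [n [H1 [H2 [H3 H4]]]]; auto.
  - apply profile_derive; auto.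
  - apply profile_derive_continuous.
  - intros v; destruct (Rle_lt_dec 0 v) as [Hv | Hv]; auto.
    destruct (Hs0 (- v)) as [x Hx]; [lra |]; exists (- x); rewrite Hodd; lra.
  - exists n; exact (conj H1 (conj H2 (conj H3 (conj H4 Hp)))).
Qed.

Section Normal.
Context (n : R -> R) (Hn : inverse_profile n).

(** In the coordinate v = m(r) the metric is stretch(v)^2 dv^2 + v^2 dtheta^2; a constant value
    gives a flat cone. *)
Definition stretch (v : R) : R := / Derive m (n v).

Lemma m_n v : m (n v) = v.
Proof. apply Hn. Qed.
Lemma n_m x : n (m x) = x.
Proof. apply Hn. Qed.
Lemma n_derive v : is_derive n v (stretch v).
Proof. apply Hn. Qed.
Lemma n_lt u v : u < v -> n u < n v.
Proof. apply Hn. Qed.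
Lemma n_le u v : u <= v -> n u <= n v.
Proof. intros [H | <-]; [left; now apply n_lt | lra]. Qed.
Lemma n_0 : n 0 = 0.
Proof. rewrite <- (profile_0) at 1; apply n_m. Qed.
Lemma n_pos v : 0 < v -> 0 < n v.
Proof. intros H; rewrite <- n_0; now apply n_lt. Qed.
Lemma n_nonneg v : 0 <= v -> 0 <= n v.
Proof. intros H; rewrite <- n_0; now apply n_le. Qed.
Lemma m_lt x y : x < y -> m x < m y.
Proof.
  intros H; apply Rnot_le_lt; intros Hle; apply n_le in Hle; rewrite 2!n_m in Hle; lra.
Qed.

Lemma stretch_m r : stretch (m r) = / Derive m r.
Proof. unfold stretch; now rewrite n_m. Qed.

Lemma stretch_pos v : 0 < stretch v.
Proof. apply Rinv_0_lt_compat, Hn. Qed.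

Lemma stretch_continuous v : continuous stretch v.
Proof.
  assert (H1 := derive_continuous _ _ _ (n_derive v)).
  assert (H2 := continuous_comp n (Derive m) v H1 (profile_derive_continuous (n v))).
  apply continuous_Rinv_comp; [exact H2 | apply Rgt_not_eq, Hn].
Qed.

Lemma stretch_incr u v : 0 <= u -> u <= v -> stretch u <= stretch v.
Proof.
  intros Hu Huv; apply Rinv_le_contravar; [apply Hn |].
  apply profile_derive_decr; auto; [now apply n_nonneg | now apply n_le].
Qed.

Lemma stretch_gt_2 r v : 0 <= r -> Derive m r < 1 / 2 -> m r <= v -> 2 < stretch v.
Proof.
  intros Hr Hd Hv; apply Rlt_le_trans with (stretch (m r)).
  - rewrite stretch_m; assert (0 < Derive m r) by apply Hn.
    replace 2 with (/ (1 / 2)) by field.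
    apply Rinv_lt_contravar; [apply Rmult_lt_0_compat |]; lra.
  - apply stretch_incr; auto; now apply profile_nonneg.
Qed.

Lemma stretch_0 : stretch 0 = 1.
Proof. unfold stretch; rewrite n_0; replace (Derive m 0) with 1 by (symmetry; apply Hm); field. Qed.

Lemma stretch_ge_1 v : 0 <= v -> 1 <= stretch v.
Proof. intros Hv; rewrite <- stretch_0; apply stretch_incr; lra. Qed.

(* With the parameter s = sqrt (m^2 - c^2) / c the geodesic tangent to the parallel m = c is regular
   at its starting point s = 0, and m = level c s along it. *)
Definition level (c s : R) : R := c * sqrt (1 + s ^ 2).
Definition cone_turn_rate (c s : R) : R := stretch (level c s) / (1 + s ^ 2).
Definition cone_turn (c s : R) : R := RInt (cone_turn_rate c) 0 s.
Definition cone_length (c s : R) : R := RInt (fun u => c * stretch (level c u)) 0 s.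

Lemma hyp_pos s : 1 <= sqrt (1 + s ^ 2) /\ sqrt (1 + s ^ 2) ^ 2 = 1 + s ^ 2.
Proof.
  assert (0 <= s ^ 2) by apply pow2_ge_0; split.
  - rewrite <- sqrt_1 at 1; apply sqrt_le_1_alt; lra.
  - apply sqrt_sqr_eq; lra.
Qed.

Lemma level_incr c s t : 0 <= c -> 0 <= s -> s <= t -> level c s <= level c t.
Proof.
  intros Hc Hs Hst; apply Rmult_le_compat_l; auto; apply sqrt_le_1_alt.
  assert (s ^ 2 <= t ^ 2) by (apply pow_incr; lra); lra.
Qed.

Lemma level_ge c s : 0 <= c -> c <= level c s.
Proof. intros Hc; destruct (hyp_pos s) as [H _]; unfold level; nra. Qed.

Lemma level_sqr c s : level c s ^ 2 = c ^ 2 * (1 + s ^ 2).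
Proof. unfold level; rewrite Rpow_mult_distr; now rewrite (proj2 (hyp_pos s)). Qed.

Lemma level_derive c s : is_derive (level c) s (c * s / sqrt (1 + s ^ 2)).
Proof.
  destruct (hyp_pos s) as [H _]; assert (0 <= s ^ 2) by apply pow2_ge_0.
  unfold level; eapply is_derive_eq; [deriv; lra | field; lra].
Qed.

Lemma stretch_level_continuous c s : continuous (fun s => stretch (level c s)) s.
Proof.
  apply (continuous_comp (level c) stretch); [| apply stretch_continuous].
  apply derive_continuous with (1 := level_derive c s).
Qed.

Lemma cone_turn_rate_continuous c s : continuous (cone_turn_rate c) s.
Proof.
  assert (H := stretch_level_continuous c s); assert (0 <= s ^ 2) by apply pow2_ge_0.
  unfold cone_turn_rate; cont; lra.
Qed.

Lemma cone_turn_derive c s : is_derive (cone_turn c) s (cone_turn_rate c s).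
Proof.
  apply (is_derive_RInt_on (cone_turn_rate c) m_infty); try exact I.
  intros u _; apply cone_turn_rate_continuous.
Qed.

Lemma cone_turn_0 c : cone_turn c 0 = 0.
Proof. apply RInt_Rpoint. Qed.

Lemma cone_turn_rate_pos c s : 0 < cone_turn_rate c s.
Proof.
  assert (0 <= s ^ 2) by apply pow2_ge_0; apply Rdiv_lt_0_compat; [apply stretch_pos | lra].
Qed.

Lemma cone_turn_incr c s t : s <= t -> cone_turn c s <= cone_turn c t.
Proof.
  intros Hst; apply (incr_of_derive_closed (cone_turn c) (cone_turn_rate c)); auto.
  - intros; apply cone_turn_derive.
  - intros; left; apply cone_turn_rate_pos.
Qed.

Lemma cone_length_derive c s : is_derive (cone_length c) s (c * stretch (level c s)).
Proof.
  apply (is_derive_RInt_on (fun u => c * stretch (level c u)) m_infty); try exact I.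
  intros u _; assert (H := stretch_level_continuous c u); cont.
Qed.

(** The turn is convex as a function of atan s, since 1 / [stretch] is nonincreasing. Hence T(s) /
    atan s <= T(S) / atan S <= PI / atan S, and PI / atan S tends to 2. *)
Lemma cone_turn_le_atan c s : 0 <= c -> 0 <= s ->
  (forall t, 0 <= t -> cone_turn c t <= PI) -> cone_turn c s <= 2 * atan s.
Proof.
  intros Hc Hs Hb; apply Rnot_lt_le; intros Hlt.
  assert (HP := PI_RGT_0); assert (Has := atan_pos_bounds s Hs).
  set (T := cone_turn c s) in *; assert (HT : 0 < T) by lra.
  set (z := PI * atan s / T).
  assert (Hz : 0 <= z < PI / 2).
  { unfold z; split; [apply Rdiv_le_0_compat; nra | apply Rlt_div_l; nra]. }
  set (z' := (z + PI / 2) / 2).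
  set (S := Rmax s (tan z')).
  assert (HSs : s <= S) by apply Rmax_l; assert (HSz : tan z' <= S) by apply Rmax_r.
  assert (HaS : z' <= atan S).
  { rewrite <- (atan_tan z') by (unfold z'; lra).
    destruct HSz as [H | <-]; [left; now apply atan_increasing | lra]. }
  assert (Hch : cone_turn c s * atan S <= cone_turn c S * atan s).
  { apply (convex_chord (cone_turn c) atan (fun s => / stretch (level c s)) (cone_turn_rate c) 0 s S); auto.
    - intros t Ht; assert (Hp := stretch_pos (level c t)); assert (0 <= t ^ 2) by apply pow2_ge_0.
      split; [apply cone_turn_derive | split; [| left; apply cone_turn_rate_pos]].
      assert (Hd := is_derive_atan_comp (fun t => t) t 1 (is_derive_Rid t)).
      eapply is_derive_eq; [exact Hd | unfold cone_turn_rate; field; lra].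
    - intros t u Ht Htu _; apply Rinv_le_contravar; [apply stretch_pos |].
      apply stretch_incr; [| apply level_incr; auto].
      apply Rle_trans with c; auto; now apply level_ge.
    - apply cone_turn_0.
    - rewrite atan_0; lra. }
  fold T in Hch.
  assert (HbS := Hb S ltac:(lra)).
  assert (cone_turn c S * atan s <= PI * atan s) by (apply Rmult_le_compat_r; lra).
  assert (T * z' <= T * atan S) by (apply Rmult_le_compat_l; lra).
  assert (T * z = PI * atan s) by (unfold z; field; lra).
  assert (T * z < T * z') by (apply Rmult_lt_compat_l; unfold z'; lra).
  lra.
Qed.

Section Ray.
Context (x a e : R) (Hx : 0 < x) (He : e = 1 \/ e = -1)
  (Hbound : forall s, 0 <= s -> cone_turn (m x) s <= PI).
Let c := m x.

Definition geo_rad (s : R) : R := n (level c s).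
Definition geo_angle (s : R) : R := a + e * cone_turn c s.

Lemma ray_level_pos : 0 < c.
Proof. now apply profile_pos. Qed.

Lemma m_geo_rad s : m (geo_rad s) = level c s.
Proof. apply m_n. Qed.

Lemma geo_rad_ge s : x <= geo_rad s.
Proof.
  rewrite <- (n_m x) at 1; apply n_le; fold c; apply level_ge; assert (H := ray_level_pos); lra.
Qed.

Lemma geo_rad_incr s t : 0 <= s -> s <= t -> geo_rad s <= geo_rad t.
Proof. intros; apply n_le, level_incr; auto; assert (Hc := ray_level_pos); lra. Qed.

Definition geo_rad' (s : R) : R := c * s / sqrt (1 + s ^ 2) * stretch (level c s).

Lemma geo_rad_derive s : is_derive geo_rad s (geo_rad' s).
Proof. apply (is_derive_Rcomp n (level c) s); [apply n_derive | apply level_derive]. Qed.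

Lemma geo_angle_derive s : is_derive geo_angle s (e * cone_turn_rate c s).
Proof.
  assert (H := cone_turn_derive c s); unfold geo_angle; deriv_eq; ring.
Qed.

(** [f] is the sense in which the geodesic is run, 1 or -1. *)
Lemma geo_speed s f : f ^ 2 = 1 ->
  sqrt ((f * geo_rad' s) ^ 2 + (m (geo_rad s) * (f * (e * cone_turn_rate c s))) ^ 2) =
  c * stretch (level c s).
Proof.
  intros Hf; assert (He2 : e ^ 2 = 1) by (destruct He as [-> | ->]; ring).
  rewrite m_geo_rad; assert (Hc := ray_level_pos); assert (Hs := stretch_pos (level c s)).
  destruct (hyp_pos s) as [H1 H2]; assert (0 <= s ^ 2) by apply pow2_ge_0.
  rewrite <- (sqrt_pow2 (c * stretch (level c s))) by nra; f_equal.
  rewrite !Rpow_mult_distr, Hf, He2, level_sqr; unfold geo_rad', cone_turn_rate.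
  set (N := stretch (level c s)); set (h := sqrt (1 + s ^ 2)) in *.
  replace ((c * s / h * N) ^ 2) with (c ^ 2 * s ^ 2 * N ^ 2 / h ^ 2) by (field; lra).
  rewrite H2; field; lra.
Qed.

Lemma geo_regular s : continuous geo_rad' s /\ continuous (cone_turn_rate c) s.
Proof.
  split; [| apply cone_turn_rate_continuous].
  assert (H := stretch_level_continuous c s); destruct (hyp_pos s) as [H1 _].
  unfold geo_rad'; cont; lra.
Qed.

(** The distance in the other order comes from the path run backwards, with parameter -u. *)
Lemma geo_dist_le s t : s <= t ->
  dist_m m (pol (geo_rad s) (geo_angle s)) (pol (geo_rad t) (geo_angle t)) <=
    cone_length c t - cone_length c s /\
  dist_m m (pol (geo_rad t) (geo_angle t)) (pol (geo_rad s) (geo_angle s)) <=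
    cone_length c t - cone_length c s.
Proof.
  intros Hst; split.
  - apply (dist_m_le_polar geo_rad geo_angle geo_rad' (fun s => e * cone_turn_rate c s)
             (cone_length c) m_infty); [exact I | auto | |].
    + intros u _; destruct (geo_regular u) as [R1 R2].
      split; [apply geo_rad_derive | split; [apply geo_angle_derive | split]].
      * assert (H := geo_rad_ge u); lra.
      * split; [auto | cont].
    + intros u _; assert (E := geo_speed u 1 ltac:(ring)); rewrite !Rmult_1_l in E.
      rewrite E; apply cone_length_derive.
  - assert (H := dist_m_le_polar (fun u => geo_rad (- u)) (fun u => geo_angle (- u))
      (fun u => -1 * geo_rad' (- u)) (fun u => -1 * (e * cone_turn_rate c (- u)))
      (fun u => - cone_length c (- u)) m_infty (- t) (- s)).
    cbv beta in H; rewrite !Ropp_involutive in H.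
    replace (cone_length c t - cone_length c s) with (- cone_length c s - - cone_length c t) by ring.
    assert (Hopp : forall u, is_derive Ropp u (- 1))
      by (intros u; apply (is_derive_Ropp (fun t => t)), is_derive_Rid).
    apply H; clear H; [exact I | lra | |].
    + intros u _; destruct (geo_regular (- u)) as [R1 R2].
      assert (C := derive_continuous _ _ _ (Hopp u)).
      assert (C1 := continuous_comp Ropp _ u C R1); assert (C2 := continuous_comp Ropp _ u C R2).
      split; [| split; [| split; [| split]]].
      * apply (is_derive_Rcomp geo_rad Ropp); [apply geo_rad_derive | apply Hopp].
      * apply (is_derive_Rcomp geo_angle Ropp); [apply geo_angle_derive | apply Hopp].
      * assert (H := geo_rad_ge (- u)); lra.
      * cont.
      * cont.
    + intros u _; rewrite geo_speed by ring.
      assert (H := is_derive_Rcomp (cone_length c) Ropp u _ _ (cone_length_derive c (- u)) (Hopp u)).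
      deriv_eq; ring.
Qed.

Lemma slope_geo k s : 0 <= k <= c ->
  slope k (geo_rad s) = sqrt (c ^ 2 * (1 + s ^ 2) - k ^ 2) / level c s.
Proof.
  intros Hk; rewrite slope_eq by (auto; assert (H := geo_rad_ge s); lra).
  now rewrite m_geo_rad, level_sqr.
Qed.

Lemma slope_geo_c s : 0 <= s -> slope c (geo_rad s) = s / sqrt (1 + s ^ 2).
Proof.
  intros Hs; assert (Hc := ray_level_pos); rewrite slope_geo by lra.
  replace (c ^ 2 * (1 + s ^ 2) - c ^ 2) with ((c * s) ^ 2) by ring.
  rewrite sqrt_pow2 by nra; unfold level; destruct (hyp_pos s); field; lra.
Qed.

(** Calibration with the geodesic's own Clairaut constant c is exact. *)
Lemma geo_length s t : 0 <= s -> s <= t ->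
  cone_length c t - cone_length c s =
  c * (cone_turn c t - cone_turn c s) + slope_int c (geo_rad s) (geo_rad t).
Proof.
  intros Hs Hst; assert (Hc := ray_level_pos).
  assert (E : cone_length c t - c * cone_turn c t - slope_int c (geo_rad s) (geo_rad t) =
              cone_length c s - c * cone_turn c s - slope_int c (geo_rad s) (geo_rad s)).
  { apply (constant_of_derive (fun u => cone_length c u - c * cone_turn c u -
      slope_int c (geo_rad s) (geo_rad u))); auto.
    intros u Hu; assert (H1 := cone_length_derive c u); assert (H2 := cone_turn_derive c u).
    assert (H0 := geo_rad_ge u); assert (H0' := geo_rad_ge s).
    assert (H3 := is_derive_Rcomp _ geo_rad u _ _
      (slope_int_derive c (geo_rad s) (geo_rad u) ltac:(right; lra)) (geo_rad_derive u)).
    deriv_eq.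
    rewrite slope_geo_c by lra; unfold geo_rad', cone_turn_rate.
    set (N := stretch (level c u)); destruct (hyp_pos u) as [H4 H5]; set (h := sqrt (1 + u ^ 2)) in *.
    assert (0 <= u ^ 2) by apply pow2_ge_0.
    replace (c * u / h * N * (u / h)) with (c * N * u ^ 2 / h ^ 2) by (field; lra).
    rewrite H5; field; lra. }
  rewrite slope_int_self in E; lra.
Qed.

(* y, D, L stand for the least radius, the angle and the length of a competitor. *)
Lemma geo_length_le s t y D L : 0 <= s -> s <= t -> 0 <= y -> y <= geo_rad s ->
  cone_turn c t - cone_turn c s <= Rabs D ->
  (forall k, 0 <= k <= m y ->
     k * Rabs D + slope_int k y (geo_rad s) + slope_int k y (geo_rad t) <= L) ->
  cone_length c t - cone_length c s <= L.
Proof.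
  intros Hs Hst Hy Hys HD HL; assert (Hc := ray_level_pos).
  rewrite (geo_length s t Hs Hst).
  assert (Hst' := geo_rad_incr s t Hs Hst); assert (Hxs := geo_rad_ge s).
  set (r0 := geo_rad s) in *; set (r1 := geo_rad t) in *.
  set (T := cone_turn c t - cone_turn c s) in *.
  assert (Hmy := profile_nonneg y Hy).
  assert (Hyk := fun k => profile_null_or_pos k y).
  destruct (Rle_lt_dec c (m y)) as [Hcy | Hcy].
  - assert (Hl := HL c ltac:(lra)); assert (Hy0 := Hyk c ltac:(lra) ltac:(lra)).
    assert (C1 := slope_int_chasles c y r0 r1 ltac:(right; lra)).
    assert (S1 := slope_int_bounds c y r0 ltac:(right; lra) Hys).
    assert (c * T <= c * Rabs D) by (apply Rmult_le_compat_l; lra).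
    lra.
  - set (k := m y) in *; assert (Hl := HL k ltac:(lra)); assert (Hky0 := Hyk k ltac:(lra) ltac:(lra)).
    assert (Hyx : y < x).
    { apply Rnot_le_lt; intros H; assert (c <= k); [| lra]; apply profile_incr; lra. }
    assert (C1 := slope_int_chasles k y x r0 ltac:(destruct Hky0; [auto | right; lra])).
    assert (C2 := slope_int_chasles k y r0 r1 ltac:(destruct Hky0; [auto | right; lra])).
    assert (S1 := slope_int_bounds k x r0 ltac:(auto) Hxs).
    assert (S2 := slope_int_ge_flat_leg y x Hy ltac:(lra) ltac:(fold c k; lra)).
    fold k c in S2.
    assert (k * T <= k * Rabs D) by (apply Rmult_le_compat_l; lra).
    assert (HQ : (c - k) * T + slope_int c r0 r1 - slope_int k r0 r1 <= 2 * flat_leg k c).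
    { apply (turning_inequality k c ltac:(lra) 2 (fun u => u) (fun u => cone_turn c u - cone_turn c s)
        (fun u => (c - k) * (cone_turn c u - cone_turn c s) + slope_int c r0 (geo_rad u) -
                  slope_int k r0 (geo_rad u)) (fun _ => 1) (cone_turn_rate c) s t); auto; try lra.
      - intros u Hu; assert (H1 := cone_turn_derive c u); assert (H0 := geo_rad_ge u).
        assert (D1 := is_derive_Rcomp _ geo_rad u _ _
          (slope_int_derive c r0 (geo_rad u) ltac:(right; lra)) (geo_rad_derive u)).
        assert (D2 := is_derive_Rcomp _ geo_rad u _ _
          (slope_int_derive k r0 (geo_rad u) ltac:(right; lra)) (geo_rad_derive u)).
        split; [deriv | split; [deriv_eq; ring |]].
        deriv_eq.
        rewrite slope_geo_c, slope_geo by lra; unfold gap_rate, geo_rad', cone_turn_rate.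
        set (N := stretch (level c u)); destruct (hyp_pos u) as [H4 H5].
        unfold level; set (h := sqrt (1 + u ^ 2)) in *.
        set (A := sqrt (c ^ 2 * (1 + u ^ 2) - k ^ 2)); rewrite <- H5; field; lra.
      - intros u Hu; assert (H1 := cone_turn_le_atan c u ltac:(lra) ltac:(lra) Hbound).
        assert (H2 := cone_turn_incr c 0 s Hs); rewrite cone_turn_0 in H2; lra.
      - fold r0; rewrite 2!slope_int_self; ring. }
    lra.
Qed.

Lemma geo_dist s t : 0 <= s -> s <= t ->
  dist_m m (pol (geo_rad s) (geo_angle s)) (pol (geo_rad t) (geo_angle t)) =
    cone_length c t - cone_length c s /\
  dist_m m (pol (geo_rad t) (geo_angle t)) (pol (geo_rad s) (geo_angle s)) =
    cone_length c t - cone_length c s.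
Proof.
  intros Hs Hst; destruct (geo_dist_le s t Hst) as [U1 U2].
  assert (Hxs := geo_rad_ge s); assert (Hxt := geo_rad_ge t).
  assert (Hst' := geo_rad_incr s t Hs Hst).
  set (T := cone_turn c t - cone_turn c s).
  assert (HT : 0 <= T <= PI).
  { assert (H1 := cone_turn_incr c s t Hst); assert (H2 := cone_turn_incr c 0 s Hs).
    assert (H3 := Hbound t ltac:(lra)); fold c in H3; rewrite cone_turn_0 in H2; unfold T; lra. }
  split; apply Rle_antisym; auto; apply dist_m_ge; intros c1 c2 HC H0 H1.
  - destruct (curve_length_ge c1 c2 (geo_rad s) (geo_angle s) (geo_rad t) (geo_angle t) ltac:(lra) ltac:(lra) HC H0 H1)
      as [y [D [Hy [Hy' [HD Hlen]]]]].
    apply (geo_length_le s t y D); auto; try lra.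
    assert (HE := HD (geo_angle s)).
    assert (HG := angle_lift_ge 0 D T e He HT); rewrite Rabs_R0, Rminus_0_r in HG; apply HG.
    replace (geo_angle s + D - geo_angle s) with (0 + D) in HE by ring; rewrite HE.
    f_equal; unfold geo_angle, T; ring.
  - destruct (curve_length_ge c1 c2 (geo_rad t) (geo_angle t) (geo_rad s) (geo_angle s) ltac:(lra) ltac:(lra) HC H0 H1)
      as [y [D [Hy [Hy' [HD Hlen]]]]].
    apply (geo_length_le s t y D); auto; try lra.
    + assert (HE := HD (geo_angle t)).
      assert (He' : - e = 1 \/ - e = -1) by (destruct He; lra).
      assert (HG := angle_lift_ge 0 D T (- e) He' HT); rewrite Rabs_R0, Rminus_0_r in HG; apply HG.
      replace (geo_angle t + D - geo_angle t) with (0 + D) in HE by ring; rewrite HE.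
      f_equal; unfold geo_angle, T; ring.
    + intros k Hk; assert (H := Hlen k Hk); lra.
Qed.
End Ray.
End Normal.

(** * Rays and the set C_m *)

Lemma is_derive_right_quotient (f : R -> R) (l : R) :
  is_derive f 0 l -> filterlim (fun h => (f h - f 0) / h) (at_right 0) (locally l).
Proof.
  intros Hd; apply is_derive_Reals in Hd; apply (proj2 (filterlim_locally _ l)); intros [eps He].
  destruct (Hd eps He) as [d Hdd]; exists d; intros h Hh Hh0.
  change (Rabs (h - 0) < d) in Hh; rewrite Rminus_0_r in Hh.
  assert (H := Hdd h ltac:(lra) Hh); rewrite Rplus_0_l in H; exact H.
Qed.

(** [acos] is PI for arguments below -1 and 0 for arguments above 1, so the equivalence extends to
    every real z. *)
Lemma acos_le_half (z : R) : acos z <= PI / 2 <-> 0 <= z.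
Proof.
  assert (HP := PI_RGT_0); split; intros H.
  - destruct (Rle_lt_dec z (-1)) as [H1 | H1].
    { unfold acos in H; destruct (Rle_dec z (-1)); lra. }
    destruct (Rle_lt_dec z 1) as [H2 | H2]; [| lra].
    assert (Hb := acos_bound z); rewrite <- (cos_acos z) by lra; apply cos_ge_0; lra.
  - destruct (Rle_lt_dec z 1) as [H2 | H2].
    + apply Rnot_lt_le; intros H3; assert (Hb := acos_bound z).
      assert (H4 := cos_lt_0 (acos z) H3 ltac:(lra)); rewrite cos_acos in H4; lra.
    + unfold acos; destruct (Rle_dec z (-1)); [lra |]; destruct (Rle_dec 1 z); lra.
Qed.

(** The Euclidean length of the segment bounds the distance above, the difference of radii bounds it
    below, and the two agree. *)
Lemma radial_ray x a : 0 <= x ->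
  is_ray m (pol x a) (fun t => (x + t) * cos a) (fun t => (x + t) * sin a) /\
  init_velocity (fun t => (x + t) * cos a) (fun t => (x + t) * sin a) (cos a, sin a).
Proof.
  intros Hx; split; [split |].
  - unfold pol; f_equal; ring.
  - intros s t Hs Ht.
    change (dist_m m (pol (x + s) a) (pol (x + t) a) = Rabs (s - t)).
    apply Rle_antisym.
    + apply Rle_trans with (1 := dist_m_le_euclid _ _); unfold pol; cbn [fst snd].
      replace (((x + t) * cos a - (x + s) * cos a) ^ 2 + ((x + t) * sin a - (x + s) * sin a) ^ 2)
        with ((s - t)² * ((sin a)² + (cos a)²)) by (unfold Rsqr; ring).
      rewrite sin2_cos2, Rmult_1_r, sqrt_Rsqr_abs; lra.
    + assert (H := dist_m_ge_rad (pol (x + s) a) (pol (x + t) a)).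
      rewrite 2!rad_pol in H by lra.
      replace (s - t) with (- (x + t - (x + s))) by ring; now rewrite Rabs_Ropp.
  - split; apply (is_derive_right_quotient (fun t => (x + t) * _)); cbn [fst snd];
      (deriv_eq; ring).
Qed.

(** The geodesic is run by arc length through the inverse [W] of [L], which exists on the whole line
    because L' >= c > 0. The stated velocity is the unit tangent of the parallel, of Euclidean
    length x / m(x). *)
Lemma parallel_ray n x a e : inverse_profile n -> 0 < x -> (e = 1 \/ e = -1) ->
  (forall s, 0 <= s -> cone_turn n (m x) s <= PI) ->
  exists g1 g2, is_ray m (pol x a) g1 g2 /\
    init_velocity g1 g2 (- (e * (x / m x) * sin a), e * (x / m x) * cos a).
Proof.
  intros Hn Hx He Hb; set (c := m x).
  assert (Hc : 0 < c) by now apply profile_pos.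
  assert (Hlev : forall s, c <= level c s) by (intros; apply level_ge; lra).
  set (L := cone_length n c); set (dL := fun s => c * stretch n (level c s)).
  assert (HdL : forall s, is_derive L s (dL s)) by (intros; apply cone_length_derive; auto).
  assert (HdLc : forall s, c <= dL s).
  { intros s; assert (H := stretch_ge_1 n Hn (level c s) ltac:(assert (H := Hlev s); lra)).
    unfold dL; nra. }
  assert (L0 : L 0 = 0) by apply RInt_Rpoint.
  assert (HLinc : forall s t, s <= t -> c * (t - s) <= L t - L s).
  { intros s t Hst; assert (L s - c * s <= L t - c * t); [| lra].
    apply (incr_of_derive_closed (fun s => L s - c * s) (fun s => dL s - c)); auto.
    - intros u _; assert (H := HdL u); deriv_eq; ring.
    - intros u _; assert (H := HdLc u); lra. }
  assert (HLc : continuity L).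
  { intros s; apply continuity_pt_of, derive_continuous with (1 := HdL s). }
  destruct (inverse_function L dL) as [W [HLW [HWL [HdW HWinc]]]].
  { apply HdL. }
  { intros s; assert (H := stretch_level_continuous n Hn c s); unfold dL; cont. }
  { intros s; assert (H := HdLc s); lra. }
  { intros v; set (z := Rabs v / c); assert (Hz : 0 <= z) by (apply Rdiv_le_0_compat; [apply Rabs_pos | lra]).
    assert (Ez : c * z = Rabs v) by (unfold z; field; lra).
    assert (H1 := HLinc 0 z Hz); assert (H2 := HLinc (- z) 0 ltac:(lra)).
    assert (H3 := Rle_abs v); assert (H4 := Rle_abs (- v)); rewrite Rabs_Ropp in H4.
    destruct (IVT_gen L (- z) z v HLc) as [s [_ Hs]]; [rewrite Rmin_left, Rmax_right; lra |].
    now exists s. }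
  assert (W0 : W 0 = 0) by (rewrite <- L0 at 1; apply HWL).
  assert (HWpos : forall t, 0 <= t -> 0 <= W t).
  { intros t [Ht | <-]; [rewrite <- W0; left; now apply HWinc | lra]. }
  set (Rr := geo_rad n x); set (Th := geo_angle n x a e).
  exists (fun t => Rr (W t) * cos (Th (W t))), (fun t => Rr (W t) * sin (Th (W t))).
  assert (R0 : Rr 0 = x).
  { unfold Rr, geo_rad, level; replace (1 + 0 ^ 2) with 1 by ring; rewrite sqrt_1, Rmult_1_r.
    now apply n_m. }
  assert (T0 : Th 0 = a) by (unfold Th, geo_angle; rewrite cone_turn_0; auto; ring).
  split; [split |].
  - now rewrite W0, R0, T0.
  - intros s t Hs Ht.
    change (dist_m m (pol (Rr (W s)) (Th (W s))) (pol (Rr (W t)) (Th (W t))) = Rabs (s - t)).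
    destruct (Rle_lt_dec s t) as [Hst | Hst].
    + assert (HW : W s <= W t) by (destruct Hst as [H | <-]; [left; now apply HWinc | lra]).
      destruct (geo_dist n Hn x a e Hx He Hb (W s) (W t) (HWpos s Hs) HW) as [H _].
      unfold Rr, Th; rewrite H; fold c L; rewrite 2!HLW, Rabs_left1; lra.
    + assert (HW : W t <= W s) by (left; now apply HWinc).
      destruct (geo_dist n Hn x a e Hx He Hb (W t) (W s) (HWpos t Ht) HW) as [_ H].
      unfold Rr, Th; rewrite H; fold c L; rewrite 2!HLW, Rabs_pos_eq; lra.
  - assert (DW : is_derive W 0 (/ dL 0)) by (rewrite <- W0 at 2; apply HdW).
    assert (E1 : level c 0 = c).
    { unfold level; replace (1 + 0 ^ 2) with 1 by ring; rewrite sqrt_1; ring. }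
    assert (DR : is_derive (fun t => Rr (W t)) 0 0).
    { assert (H := geo_rad_derive n Hn x (W 0)).
      assert (H1 := is_derive_Rcomp Rr W 0 _ _ H DW).
      eapply is_derive_eq; [exact H1 |]; unfold geo_rad'; rewrite W0.
      replace (1 + 0 ^ 2) with 1 by ring; rewrite sqrt_1; field.
      assert (H2 := HdLc 0); lra. }
    assert (DT : is_derive (fun t => Th (W t)) 0 (e / c)).
    { assert (H := geo_angle_derive n Hn x a e (W 0)).
      assert (H1 := is_derive_Rcomp Th W 0 _ _ H DW).
      eapply is_derive_eq; [exact H1 |]; rewrite W0; unfold cone_turn_rate, dL; fold c; rewrite E1.
      assert (H2 := stretch_pos n Hn c); field; lra. }
    split; apply (is_derive_right_quotient (fun t => Rr (W t) * _ (Th (W t)))); cbn [fst snd];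
      (eapply is_derive_eq; [deriv |]); cbv beta; rewrite W0, R0, T0; fold c; field; lra.
Qed.

Lemma gm_polar x a v w : 0 < x ->
  gm m (pol x a) v w =
  (fst v * cos a + snd v * sin a) * (fst w * cos a + snd w * sin a) +
  (m x / x) ^ 2 * ((snd v * cos a - fst v * sin a) * (snd w * cos a - fst w * sin a)).
Proof.
  intros Hx; unfold gm; fold (rad (pol x a)); rewrite rad_pol by lra.
  destruct (Req_EM_T x 0); [lra |]; unfold pol; cbn [fst snd]; field; lra.
Qed.

Lemma in_Cm_at_origin q : rad q = 0 -> in_Cm m q.
Proof.
  intros Hq v Hv; assert (E := rad_sqr q); rewrite Hq in E.
  assert (Eq : q = pol 0 0).
  { destruct q as [q1 q2]; cbn [fst snd] in E; unfold pol; f_equal; nra. }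
  destruct (polar_form v) as [a Ha].
  rewrite gm_self_origin in Hv by auto; rewrite <- rad_sqr in Hv.
  assert (Hr : rad v = 1) by (assert (H := rad_pos v); nra).
  rewrite Hr in Ha.
  destruct (radial_ray 0 a ltac:(lra)) as [H1 H2].
  exists (fun t => (0 + t) * cos a), (fun t => (0 + t) * sin a), (cos a, sin a).
  split; [| split; auto].
  - rewrite Eq; replace (pol 0 0) with (pol 0 a) by (unfold pol; f_equal; ring); exact H1.
  - unfold angle_m; apply acos_le_half; rewrite Ha; unfold pol.
    rewrite 2!Rmult_1_l; rewrite gm_self_origin by auto.
    apply Rplus_le_le_0_compat; apply pow2_ge_0.
Qed.

(** The definition is tested on the inward radial unit vector: the ray it provides has initial
    velocity with nonpositive radial component. *)
Lemma in_Cm_turn_bounded q : 0 < rad q -> in_Cm m q -> turn_bounded (rad q).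
Proof.
  intros Hx HC; set (x := rad q) in *; destruct (polar_form q) as [a Ha]; fold x in Ha.
  assert (Hsc := sin2_cos2 a); unfold Rsqr in Hsc.
  destruct (HC (- cos a, - sin a)) as [g1 [g2 [w [Hray [Hw Hang]]]]].
  { rewrite Ha, gm_polar by auto; cbn [fst snd].
    transitivity ((sin a * sin a + cos a * cos a) ^ 2); [ring | rewrite Hsc; ring]. }
  apply acos_le_half in Hang; rewrite Ha, gm_polar in Hang by auto; cbn [fst snd] in Hang.
  apply ray_turn_bounded with g1 g2 w; auto.
  rewrite Ha; unfold pol; cbn [fst snd].
  assert (HW : fst w * cos a + snd w * sin a <= 0).
  { replace (- cos a * cos a + - sin a * sin a) with (- (sin a * sin a + cos a * cos a)) in Hang by ring.
    replace (- sin a * cos a - - cos a * sin a) with 0 in Hang by ring; rewrite Hsc in Hang; lra. }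
  replace (fst w * (x * cos a) + snd w * (x * sin a)) with (x * (fst w * cos a + snd w * sin a)) by ring.
  nra.
Qed.

(** A vector with nonnegative radial component is served by the outward radial ray. Any other is
    served by the tangential ray whose sense e agrees with the sign of its angular component. *)
Lemma in_Cm_of_cone_turn n q : inverse_profile n -> 0 < rad q ->
  (forall s, 0 <= s -> cone_turn n (m (rad q)) s <= PI) -> in_Cm m q.
Proof.
  intros Hn Hx Hb v Hv; set (x := rad q) in *.
  destruct (polar_form q) as [a Ha]; fold x in Ha.
  assert (Hsc := sin2_cos2 a); unfold Rsqr in Hsc.
  assert (Hc := profile_pos x Hx).
  destruct (Rle_lt_dec 0 (fst v * cos a + snd v * sin a)) as [Hout | Hin].
  - destruct (radial_ray x a ltac:(lra)) as [H1 H2].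
    exists (fun t => (x + t) * cos a), (fun t => (x + t) * sin a), (cos a, sin a).
    split; [now rewrite Ha | split; auto].
    unfold angle_m; apply acos_le_half; rewrite Ha, gm_polar by auto; cbn [fst snd].
    replace (cos a * cos a + sin a * sin a) with 1 by lra.
    replace (sin a * cos a - cos a * sin a) with 0 by ring; lra.
  - assert (He : exists e, (e = 1 \/ e = -1) /\ 0 <= e * (snd v * cos a - fst v * sin a)).
    { destruct (Rle_lt_dec 0 (snd v * cos a - fst v * sin a)); [exists 1 | exists (-1)]; lra. }
    destruct He as [e [He Hev]].
    destruct (parallel_ray n x a e Hn Hx He Hb) as [g1 [g2 [H1 H2]]].
    exists g1, g2, (- (e * (x / m x) * sin a), e * (x / m x) * cos a).
    split; [now rewrite Ha | split; auto].
    unfold angle_m; apply acos_le_half; rewrite Ha, gm_polar by auto; cbn [fst snd].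
    replace (- (e * (x / m x) * sin a) * cos a + e * (x / m x) * cos a * sin a) with 0 by ring.
    replace (e * (x / m x) * cos a * cos a - - (e * (x / m x) * sin a) * sin a)
      with (e * (x / m x) * (sin a * sin a + cos a * cos a)) by ring.
    rewrite Hsc, Rmult_0_r, Rplus_0_l, Rmult_1_r.
    replace ((m x / x) ^ 2 * ((snd v * cos a - fst v * sin a) * (e * (x / m x))))
      with (m x / x * (e * (snd v * cos a - fst v * sin a))) by (field; lra).
    apply Rmult_le_pos; auto; apply Rlt_le, Rdiv_lt_0_compat; lra.
Qed.

(** * The turn as a function of the radius and of the parameter s *)

Section Reparametrize.
Context (n : R -> R) (Hn : inverse_profile n).

Lemma level_clairaut_par c r : 0 < c <= m r -> level c (clairaut_par c r) = m r.
Proof.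
  intros H; unfold level; rewrite clairaut_par_sqr by auto.
  rewrite sqrt_div_alt by nra; rewrite 2!sqrt_pow2 by lra; field; lra.
Qed.

Lemma cone_turn_clairaut_derive c r : 0 < c < m r ->
  is_derive (fun r => cone_turn n c (clairaut_par c r)) r (turn_rate c r).
Proof.
  intros H; assert (H1 := clairaut_par_derive c r H).
  assert (H2 := cone_turn_derive n Hn c (clairaut_par c r)).
  assert (H3 := is_derive_Rcomp _ (clairaut_par c) r _ _ H2 H1).
  eapply is_derive_eq; [exact H3 |]; unfold cone_turn_rate.
  rewrite level_clairaut_par, clairaut_par_sqr, stretch_m by (auto; lra).
  destruct (clairaut_pos c (m r)) as [H4 H5]; [lra |].
  assert (Hp : 0 < Derive m r) by apply Hn.
  unfold turn_rate; field; lra.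
Qed.

Lemma turn_cone_turn c a b : 0 < a -> 0 < c < m a -> a <= b ->
  turn c a b = cone_turn n c (clairaut_par c b) - cone_turn n c (clairaut_par c a).
Proof.
  intros Ha Hc Hab; apply is_RInt_unique.
  apply (is_RInt_derive (V := R_CompleteNormedModule) (fun r => cone_turn n c (clairaut_par c r)));
    intros r Hr; rewrite Rmin_left, Rmax_right in Hr by lra;
    assert (H := profile_incr a r ltac:(lra) ltac:(lra)).
  - apply cone_turn_clairaut_derive; lra.
  - apply turn_rate_continuous; auto; lra.
Qed.

Lemma clairaut_par_continuous c r : 0 < c -> continuous (clairaut_par c) r.
Proof.
  intros Hc; assert (H := profile_continuous r); unfold clairaut_par; cont; lra.
Qed.

Lemma clairaut_par_level c s : 0 < c -> 0 <= s -> clairaut_par c (n (level c s)) = s.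
Proof.
  intros Hc Hs; unfold clairaut_par; rewrite (m_n n Hn), level_sqr.
  replace (c ^ 2 * (1 + s ^ 2) - c ^ 2) with ((c * s) ^ 2) by ring.
  rewrite sqrt_pow2 by nra; field; lra.
Qed.

(** Forwards: if the tangential geodesic turns by more than PI, it still does after removing a short
    initial piece; on the rest the turn is Lipschitz in the Clairaut constant up to c, so a constant
    slightly below c exceeds PI too. Backwards: [turn_rate] is nondecreasing in the constant. *)
Lemma turn_bounded_iff x : 0 < x ->
  (turn_bounded x <-> forall s, 0 <= s -> cone_turn n (m x) s <= PI).
Proof.
  intros Hx; set (c := m x); assert (Hc : 0 < c) by now apply profile_pos.
  split; intros Hb.
  - intros s [Hs | <-]; [| rewrite cone_turn_0; assert (H := PI_RGT_0); lra].
    apply Rnot_lt_le; intros Hlt.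
    assert (Hct := derive_continuous _ _ _ (cone_turn_derive n Hn c 0)).
    destruct (continuous_eps _ _ (cone_turn n c s - PI) Hct ltac:(lra)) as [d [Hd Hdd]].
    set (s0 := Rmin (s / 2) (d / 2)).
    assert (Hs0 : 0 < s0 < d /\ s0 < s).
    { unfold s0; split; [split; [apply Rmin_pos; lra |] |];
        eapply Rle_lt_trans; [apply Rmin_r | lra | apply Rmin_l | lra]. }
    assert (H0 := Hdd s0 ltac:(rewrite Rabs_pos_eq; lra)); rewrite cone_turn_0, Rminus_0_r in H0.
    apply Rabs_def2 in H0.
    set (r0 := n (level c s0)); set (r1 := n (level c s)).
    assert (Hl0 : c < level c s0).
    { apply Rsqr_incrst_0; [| lra | apply Rle_trans with c; [lra | apply level_ge; lra]].
      replace ((level c s0)²) with (level c s0 ^ 2) by (unfold Rsqr; ring).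
      assert (0 < (c * s0) ^ 2) by (apply pow_lt, Rmult_lt_0_compat; lra).
      rewrite level_sqr; unfold Rsqr; lra. }
    assert (Hr0 : x < r0) by (rewrite <- (n_m n Hn x); apply (n_lt n Hn); auto).
    assert (Hr01 : r0 <= r1) by (apply (n_le n Hn), level_incr; lra).
    assert (Hm0 : m r0 = level c s0) by apply (m_n n Hn).
    assert (Et : turn c r0 r1 > PI).
    { rewrite turn_cone_turn by (auto; lra); unfold r0, r1; rewrite 2!clairaut_par_level; lra. }
    set (K := (c + m r0) / 2).
    set (C := (r1 - r0) * (m r1 / sqrt (m r0 ^ 2 - c ^ 2) ^ 3)).
    assert (HC : 0 <= C).
    { destruct (clairaut_pos c (m r0)) as [_ Hp]; [lra |].
      apply Rmult_le_pos; [lra | apply Rdiv_le_0_compat; [apply profile_nonneg; lra | now apply pow_lt]]. }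
    set (e := turn c r0 r1 - PI); assert (Hepos : 0 < e) by (unfold e; lra).
    (* Chosen so that 0 < k < c and the Lipschitz loss C (c - k) is less than the excess e. *)
    set (k := Rmax (c / 2) (c - e / (2 * (C + 1)))).
    assert (He2 : 0 < e / (2 * (C + 1))) by (apply Rdiv_lt_0_compat; lra).
    assert (Hk : c / 2 <= k /\ c - e / (2 * (C + 1)) <= k /\ k < c).
    { unfold k; split; [apply Rmax_l | split; [apply Rmax_r | apply Rmax_lub_lt; lra]]. }
    destruct (turn_lipschitz k c c r0 r1) as [_ Hlip]; try lra.
    fold C in Hlip.
    assert (C * (c - k) < e).
    { apply Rle_lt_trans with (C * (e / (2 * (C + 1)))); [apply Rmult_le_compat_l; lra |].
      replace (C * (e / (2 * (C + 1)))) with (e * (C / (2 * (C + 1)))) by (field; lra).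
      rewrite <- (Rmult_1_r e) at 2; apply Rmult_lt_compat_l; auto; apply Rlt_div_l; lra. }
    assert (H1 := Hb k r1 ltac:(fold c; lra) ltac:(lra)).
    assert (H2 := turn_chasles k x r0 r1 Hx ltac:(fold c; lra) ltac:(lra) Hr01).
    assert (H3 := turn_nonneg k x r0 Hx ltac:(fold c; lra) ltac:(lra)).
    unfold e in *; lra.
  - intros k r Hk Hr; fold c in Hk.
    apply Rle_trans with (2 := Hb _ (clairaut_par_nonneg c r Hc)).
    assert (H : cone_turn n c (clairaut_par c x) - turn k x x <=
                cone_turn n c (clairaut_par c r) - turn k x r).
    { apply (incr_of_derive (fun r => cone_turn n c (clairaut_par c r) - turn k x r)
        (fun r => turn_rate c r - turn_rate k r)); [lra | | |].
      - intros u Hu; assert (Hmu : c < m u) by (apply (m_lt n Hn); lra).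
        assert (D1 := cone_turn_clairaut_derive c u ltac:(lra)).
        assert (D2 := turn_derive k x u Hx ltac:(fold c; lra) ltac:(lra)).
        deriv.
      - intros u Hu; assert (Hmu : c < m u) by (apply (m_lt n Hn); lra).
        destruct (turn_rate_lipschitz k c c u u) as [H1 _]; lra.
      - intros u Hu.
        assert (D2 := derive_continuous _ _ _
          (turn_derive k x u Hx ltac:(fold c; lra) ltac:(lra))).
        assert (D1 : continuous (fun r => cone_turn n c (clairaut_par c r)) u).
        { apply (continuous_comp (clairaut_par c) (cone_turn n c)).
          - now apply clairaut_par_continuous.
          - apply derive_continuous with (1 := cone_turn_derive n Hn c _). }
        cont. }
    assert (Ex : clairaut_par c x = 0).
    { unfold clairaut_par; fold c; rewrite Rminus_diag, sqrt_0; unfold Rdiv; ring. }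
    rewrite Ex, cone_turn_0, turn_self in H; lra.
Qed.
End Reparametrize.

Lemma in_Cm_iff q : 0 < rad q -> (in_Cm m q <-> turn_bounded (rad q)).
Proof.
  intros Hx; split; [now apply in_Cm_turn_bounded |]; intros HT.
  destruct (inverse_profile_exists (turn_bounded_unbounded _ Hx HT)) as [n Hn].
  apply (in_Cm_of_cone_turn n q Hn Hx), (turn_bounded_iff n Hn); auto.
Qed.

(** * The critical radius *)

Lemma atan_exceeds z S : z < PI / 2 -> exists s, S <= s /\ 1 <= s /\ z < atan s.
Proof.
  intros Hz; assert (HP := PI_RGT_0); set (z' := (Rmax z 0 + PI / 2) / 2).
  assert (H1 := Rmax_l z 0); assert (H2 := Rmax_r z 0).
  assert (H3 : Rmax z 0 < PI / 2) by (apply Rmax_lub_lt; lra).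
  set (s := Rmax (Rmax S 1) (tan z')); exists s.
  assert (Hs1 : Rmax S 1 <= s) by apply Rmax_l.
  assert (Hs2 : tan z' <= s) by apply Rmax_r.
  split; [apply Rle_trans with (2 := Hs1), Rmax_l | split; [apply Rle_trans with (2 := Hs1), Rmax_r |]].
  apply Rlt_le_trans with z'; [unfold z'; lra |].
  rewrite <- (atan_tan z') by (unfold z'; lra).
  destruct Hs2 as [H | <-]; [left; now apply atan_increasing | lra].
Qed.

Section WithInverse.
Context (n : R -> R) (Hn : inverse_profile n).

(** At a higher level [stretch] is evaluated further out, so the turn accumulates faster at every s.
    Growth of the difference, not only its sign, is what the uniqueness argument needs. *)
Lemma cone_turn_level_incr c c' s t : 0 <= c -> c <= c' -> 0 <= s -> s <= t ->
  cone_turn n c' s - cone_turn n c s <= cone_turn n c' t - cone_turn n c t.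
Proof.
  intros Hc Hcc Hs Hst.
  apply (incr_of_derive_closed (fun u => cone_turn n c' u - cone_turn n c u)
    (fun u => cone_turn_rate n c' u - cone_turn_rate n c u)); auto.
  - intros u _; assert (H1 := cone_turn_derive n Hn c u);
      assert (H2 := cone_turn_derive n Hn c' u); deriv.
  - intros u Hu; unfold cone_turn_rate; assert (0 <= u ^ 2) by apply pow2_ge_0.
    assert (Hlv := level_ge c u Hc); destruct (hyp_pos u) as [H1 _].
    assert (stretch n (level c u) <= stretch n (level c' u)).
    { apply stretch_incr; auto; [lra | apply Rmult_le_compat_r; lra]. }
    assert (0 < / (1 + u ^ 2)) by (apply Rinv_0_lt_compat; lra).
    unfold Rdiv; rewrite <- Rmult_minus_distr_r; apply Rmult_le_pos; lra.
Qed.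

Lemma cone_turn_level_le c c' s : 0 <= c -> c <= c' -> 0 <= s ->
  cone_turn n c s <= cone_turn n c' s.
Proof.
  intros Hc Hcc Hs; assert (H := cone_turn_level_incr c c' 0 s Hc Hcc (Rle_refl 0) Hs).
  rewrite 2!cone_turn_0 in H; lra.
Qed.

Lemma cone_turn_minus_atan_derive c M u :
  is_derive (fun u => cone_turn n c u - M * atan u) u ((stretch n (level c u) - M) / (1 + u ^ 2)).
Proof.
  assert (H1 := cone_turn_derive n Hn c u); assert (0 <= u ^ 2) by apply pow2_ge_0.
  eapply is_derive_eq; [deriv; apply is_derive_Rid | unfold cone_turn_rate; field; lra].
Qed.

Lemma cone_turn_ge_atan c M s t : s <= t ->
  (forall u, s < u < t -> M <= stretch n (level c u)) ->
  M * (atan t - atan s) <= cone_turn n c t - cone_turn n c s.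
Proof.
  intros Hst HM.
  assert (cone_turn n c s - M * atan s <= cone_turn n c t - M * atan t); [| lra].
  apply (incr_of_derive (fun u => cone_turn n c u - M * atan u) _ s t Hst
           (fun u _ => cone_turn_minus_atan_derive c M u)).
  - intros u Hu; specialize (HM u Hu).
    apply Rdiv_le_0_compat; [lra | assert (H := pow2_ge_0 u); lra].
  - intros u _; apply derive_continuous with (1 := cone_turn_minus_atan_derive c M u).
Qed.

Lemma cone_turn_le_stretch c M s : 0 <= s ->
  (forall u, 0 < u < s -> stretch n (level c u) <= M) -> cone_turn n c s <= M * atan s.
Proof.
  intros Hs HM.
  assert (- (cone_turn n c 0 - M * atan 0) <= - (cone_turn n c s - M * atan s));
    [| rewrite atan_0, cone_turn_0 in H; lra].
  apply (incr_of_derive (fun u => - (cone_turn n c u - M * atan u)) _ 0 s Hs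
           (fun u _ => is_derive_Ropp _ _ _ (cone_turn_minus_atan_derive c M u))).
  - intros u Hu; specialize (HM u Hu).
    replace (- ((stretch n (level c u) - M) / (1 + u ^ 2)))
      with ((M - stretch n (level c u)) / (1 + u ^ 2)) by (unfold Rdiv; ring).
    apply Rdiv_le_0_compat; [lra | assert (H := pow2_ge_0 u); lra].
  - intros u _; apply derive_continuous
      with (1 := is_derive_Ropp _ _ _ (cone_turn_minus_atan_derive c M u)).
Qed.

(** With [stretch] identically 2 the turn would just fail to reach PI. Here it is at least 2 on
    [0, 1] and at least M > 2 afterwards; since atan 1 = PI / 4, the bound passes PI once atan s >
    PI / 4 + PI / (2 M). *)
Lemma cone_turn_exceeds c : 0 < c -> (forall s, 0 < s -> 2 <= stretch n (level c s)) ->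
  2 < stretch n (level c 1) -> exists s, 0 <= s /\ PI < cone_turn n c s.
Proof.
  intros Hc H2 H1; assert (HP := PI_RGT_0).
  set (M := stretch n (level c 1)) in *.
  assert (Hz : PI / 2 - (M - 2) * (PI / 4) / M < PI / 2).
  { assert (0 < (M - 2) * (PI / 4) / M); [| lra].
    apply Rdiv_lt_0_compat; [apply Rmult_lt_0_compat |]; lra. }
  destruct (atan_exceeds _ 1 Hz) as [s [_ [Hs1 Hs]]].
  exists s; split; [lra |].
  assert (G1 := cone_turn_ge_atan c 2 0 1 ltac:(lra) ltac:(intros; apply H2; lra)).
  assert (G2 := cone_turn_ge_atan c M 1 s Hs1 ltac:(intros u Hu; apply stretch_incr; auto;
    [apply Rle_trans with c; [lra | apply level_ge; lra] | apply level_incr; lra])).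
  rewrite atan_0, cone_turn_0 in G1; rewrite atan_1 in G1, G2.
  assert (M * (PI / 2 - (M - 2) * (PI / 4) / M) < M * atan s) by (apply Rmult_lt_compat_l; lra).
  replace (M * (PI / 2 - (M - 2) * (PI / 4) / M)) with (M * (PI / 2) - (M - 2) * (PI / 4)) in H
    by (field; lra).
  lra.
Qed.

Lemma turn_bounded_level c : 0 < c ->
  (turn_bounded (n c) <-> forall s, 0 <= s -> cone_turn n c s <= PI).
Proof.
  intros Hc; rewrite (turn_bounded_iff n Hn (n c) (n_pos n Hn c Hc)).
  now rewrite (m_n n Hn).
Qed.

(* If the total turn at level c is strictly less than PI, then it stays so at slightly larger
   levels: on compact sets by uniform continuity, and the tails are controlled by the substitution
   s -> 2 s + 2. *)
Lemma cone_turn_open c e : 0 < c -> 0 < e -> (forall s, 0 <= s -> cone_turn n c s <= PI - e) ->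
  exists c1, c < c1 /\ forall s, 0 <= s -> cone_turn n c1 s <= PI.
Proof.
  intros Hc He Hb.
  destruct (completeness (fun y => exists s, 0 <= s /\ y = cone_turn n c s)) as [sup [Hub Hlub]].
  { exists (PI - e); intros y [s [Hs ->]]; now apply Hb. }
  { exists (cone_turn n c 0), 0; split; [lra | auto]. }
  assert (Hs0 : exists s0, 0 <= s0 /\ sup - e / 16 < cone_turn n c s0).
  { apply NNPP; intros HN; assert (sup <= sup - e / 16); [| lra].
    apply Hlub; intros y [s [Hs ->]]; apply Rnot_lt_le; intros Hlt; apply HN; exists s; auto. }
  destruct Hs0 as [s0 [Hs0 Hsup]].
  set (S := Rmax 1 s0); assert (HS1 : 1 <= S) by apply Rmax_l; assert (HS0 : s0 <= S) by apply Rmax_r.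
  assert (Htail : forall s, S <= s -> cone_turn n c (2 * s + 2) - cone_turn n c (2 * S + 2) <= e / 16).
  { intros s Hs; assert (H1 := cone_turn_incr n Hn c s0 (2 * S + 2) ltac:(lra)).
    assert (H2 : cone_turn n c (2 * s + 2) <= sup) by (apply Hub; exists (2 * s + 2); split; [lra | auto]).
    lra. }
  destruct (hyp_pos S) as [Hh1 _]; set (h := sqrt (1 + S ^ 2)) in *.
  assert (He4 : 0 < e / (4 * S)) by (apply Rdiv_lt_0_compat; lra).
  destruct (Heine (stretch n) (fun v => 0 <= v <= 2 * c * h) (compact_P3 0 (2 * c * h))
    (fun v _ => continuity_pt_of _ _ (stretch_continuous n Hn v))
    (mkposreal _ He4)) as [d Hd].
  assert (Hdp := cond_pos d); cbn [pos] in Hd.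
  set (c1 := c + Rmin c (d / (2 * h))).
  assert (Hmin : 0 < Rmin c (d / (2 * h))).
  { apply Rmin_pos; auto; apply Rdiv_lt_0_compat; lra. }
  assert (Hc1 : c < c1 /\ c1 <= 2 * c /\ (c1 - c) * h < d).
  { assert (A1 := Rmin_l c (d / (2 * h))); assert (A2 := Rmin_r c (d / (2 * h))).
    unfold c1; split; [lra | split; [lra |]].
    apply Rle_lt_trans with (d / (2 * h) * h); [apply Rmult_le_compat_r; lra |].
    replace (d / (2 * h) * h) with (d / 2) by (field; lra); lra. }
  destruct Hc1 as [Hcc1 [Hc12 Hc1d]].
  exists c1; split; auto.
  assert (HSb : cone_turn n c1 S <= PI - e + e / 4).
  { assert (e / (4 * S) * 0 - (cone_turn n c1 0 - cone_turn n c 0) <=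
            e / (4 * S) * S - (cone_turn n c1 S - cone_turn n c S)).
    { apply (incr_of_derive_closed
        (fun u => e / (4 * S) * u - (cone_turn n c1 u - cone_turn n c u))
        (fun u => e / (4 * S) - (cone_turn_rate n c1 u - cone_turn_rate n c u))); [lra | |].
      - intros u _; assert (D1 := cone_turn_derive n Hn c u);
          assert (D2 := cone_turn_derive n Hn c1 u); deriv_eq; ring.
      - intros u Hu; destruct (hyp_pos u) as [Hu1 _].
        assert (Huh : sqrt (1 + u ^ 2) <= h).
        { apply sqrt_le_1_alt; assert (u ^ 2 <= S ^ 2) by (apply pow_incr; lra); lra. }
        assert (K : Rabs (stretch n (level c1 u) - stretch n (level c u)) < e / (4 * S)).
        { apply Hd; unfold level; try (split; nra).
          rewrite <- Rmult_minus_distr_r, Rabs_pos_eq by nra.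
          apply Rle_lt_trans with (2 := Hc1d); apply Rmult_le_compat_l; lra. }
        apply Rabs_def2 in K; unfold cone_turn_rate; assert (0 <= u ^ 2) by apply pow2_ge_0.
        unfold Rdiv at 2 3; rewrite <- Rmult_minus_distr_r.
        assert (Hi : 0 < / (1 + u ^ 2) <= 1).
        { split; [apply Rinv_0_lt_compat; lra |].
          rewrite <- Rinv_1; apply Rinv_le_contravar; lra. }
        set (w := stretch n (level c1 u) - stretch n (level c u)) in *.
        destruct (Rle_lt_dec w 0); nra. }
    rewrite 2!cone_turn_0 in H; replace (e / (4 * S) * S) with (e / 4) in H by (field; lra).
    assert (HbS := Hb S ltac:(lra)); lra. }
  intros s Hs; destruct (Rle_lt_dec s S) as [HsS | HsS].
  { assert (H := cone_turn_incr n Hn c1 s S HsS); lra. }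
  (* For u >= 0 one has level c1 u <= level c (2 u + 2), as c1 <= 2 c, and 1 + (2 u + 2)^2 <= 16 (1
     + u^2). The tail at c1 is thus at most 8 times e / 16; with the e / 4 added on [0, S] the total
     stays below PI. *)
  assert (HF : 8 * cone_turn n c (2 * S + 2) - cone_turn n c1 S <=
               8 * cone_turn n c (2 * s + 2) - cone_turn n c1 s).
  { apply (incr_of_derive_closed (fun u => 8 * cone_turn n c (2 * u + 2) - cone_turn n c1 u)
      (fun u => 16 * cone_turn_rate n c (2 * u + 2) - cone_turn_rate n c1 u)); [lra | |].
    - intros u _; assert (D2 := cone_turn_derive n Hn c1 u).
      assert (Dl : is_derive (fun u => 2 * u + 2) u 2) by (deriv_eq; ring).
      assert (D1 := is_derive_Rcomp (cone_turn n c) (fun u => 2 * u + 2) u _ _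
        (cone_turn_derive n Hn c (2 * u + 2)) Dl).
      deriv_eq; ring.
    - intros u Hu; unfold cone_turn_rate.
      assert (Hl : level c1 u <= level c (2 * u + 2)).
      { unfold level; apply Rle_trans with (c * (2 * sqrt (1 + u ^ 2))).
        - destruct (hyp_pos u); nra.
        - apply Rmult_le_compat_l; [lra |].
          rewrite <- (sqrt_pow2 2) at 1 by lra; rewrite <- sqrt_mult_alt by lra.
          apply sqrt_le_1_alt; nra. }
      assert (Hst : stretch n (level c1 u) <= stretch n (level c (2 * u + 2))).
      { apply stretch_incr; auto; apply Rle_trans with c1; [lra | apply level_ge; lra]. }
      assert (Hp := stretch_pos n Hn (level c1 u)).
      assert (Hq : / (1 + u ^ 2) <= 16 * / (1 + (2 * u + 2) ^ 2)).
      { replace (16 * / (1 + (2 * u + 2) ^ 2)) with (/ ((1 + (2 * u + 2) ^ 2) / 16)) by (field; nra).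
        apply Rinv_le_contravar; nra. }
      assert (0 < / (1 + u ^ 2)) by (apply Rinv_0_lt_compat; nra).
      unfold Rdiv.
      assert (stretch n (level c1 u) * / (1 + u ^ 2) <=
        stretch n (level c (2 * u + 2)) * (16 * / (1 + (2 * u + 2) ^ 2))); [| lra].
      apply Rmult_le_compat; lra. }
  assert (HT := Htail s ltac:(lra)); lra.
Qed.
End WithInverse.

Lemma turn_bounded_down x y : 0 < x -> x <= y -> turn_bounded y -> turn_bounded x.
Proof.
  intros Hx Hxy HT.
  destruct (inverse_profile_exists (turn_bounded_unbounded y ltac:(lra) HT)) as [n Hn].
  apply (turn_bounded_iff n Hn x Hx); intros s Hs.
  apply Rle_trans with (cone_turn n (m y) s).
  - apply cone_turn_level_le; auto; [apply profile_nonneg | apply profile_incr]; auto; lra.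
  - apply (turn_bounded_iff n Hn y); auto; lra.
Qed.

(** For fixed K < m(x) some y < x still has K < m(y), and starting at y only increases the turn up
    to r. *)
Lemma turn_bounded_closed x : 0 < x -> (forall y, 0 < y < x -> turn_bounded y) -> turn_bounded x.
Proof.
  intros Hx Hy K r HK Hr; destruct (level_nbhd K x Hx ltac:(lra)) as [l [Hl Hlm]].
  set (y := (l + x) / 2); assert (Hly : l < y < x) by (unfold y; lra).
  assert (HKy := Hlm y ltac:(lra)).
  apply Rle_trans with (turn K y r); [| apply Hy; lra].
  rewrite <- (turn_chasles K y x r) by lra.
  assert (H := turn_nonneg K y x ltac:(lra) ltac:(lra) ltac:(lra)); lra.
Qed.

(** Adjoining 0 keeps the supremum nonnegative when no positive radius has bounded turn. *)
Definition critical_radius : Rbar := Lub_Rbar (fun x => x = 0 \/ 0 < x /\ turn_bounded x).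

Lemma critical_radius_nonneg : Rbar_le 0 critical_radius.
Proof. apply (proj1 (Lub_Rbar_correct _) 0); auto. Qed.

Lemma turn_bounded_radius x : 0 < x -> (turn_bounded x <-> Rbar_le x critical_radius).
Proof.
  intros Hx; unfold critical_radius; set (E := fun x => _); destruct (Lub_Rbar_correct E) as [Hub Hlub].
  split; intros H.
  - apply Hub; right; auto.
  - apply turn_bounded_closed; auto; intros y Hy; apply NNPP; intros HN.
    assert (Hle : Rbar_le (Lub_Rbar E) y).
    { apply Hlub; intros z [-> | [Hz HT]]; simpl; [lra |].
      apply Rnot_lt_le; intros Hlt; apply HN, turn_bounded_down with z; auto; lra. }
    assert (Hxy := Rbar_le_trans _ _ _ H Hle); simpl in Hxy; lra.
Qed.

Lemma critical_radius_witness : Rbar_lt 0 critical_radius ->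
  exists x, 0 < x <= 1 /\ turn_bounded x.
Proof.
  intros H; destruct critical_radius as [R | |] eqn:E; simpl in H; try contradiction.
  - exists (Rmin R 1).
    assert (H0 : 0 < Rmin R 1) by (apply Rmin_pos; lra).
    split; [split; [auto | apply Rmin_r] |].
    apply turn_bounded_radius; auto; rewrite E; apply Rmin_l.
  - exists 1; split; [lra |]; apply turn_bounded_radius; [lra | now rewrite E].
Qed.

Lemma derive_limit : exists l : R, is_lim (Derive m) p_infty l /\
  (forall r, 0 <= r -> l <= Derive m r) /\
  (forall e, 0 < e -> exists r, 0 <= r /\ Derive m r < l + e).
Proof.
  destruct (completeness (fun y => exists r, 0 <= r /\ y = - Derive m r)) as [s [Hub Hlub]].
  { exists 0; intros y [r [Hr ->]]; assert (H := profile_derive_pos r Hr); lra. }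
  { exists (- Derive m 0), 0; split; [lra | auto]. }
  assert (Hle : forall r, 0 <= r -> - s <= Derive m r).
  { intros r Hr; assert (- Derive m r <= s) by (apply Hub; exists r; auto); lra. }
  assert (Hex : forall e, 0 < e -> exists r, 0 <= r /\ Derive m r < - s + e).
  { intros e He; apply NNPP; intros HN; assert (s <= s - e); [| lra].
    apply Hlub; intros y [r [Hr ->]]; apply Rnot_lt_le; intros Hlt; apply HN; exists r; split; auto; lra. }
  exists (- s); split; [| auto].
  apply is_lim_spec; intros [e He]; destruct (Hex e He) as [r [Hr Hre]].
  exists r; intros t Ht; cbn [pos].
  assert (H1 := Hle t ltac:(lra)); assert (H2 := profile_derive_decr r t Hr ltac:(lra)).
  rewrite Rabs_pos_eq; lra.
Qed.

(** * Improper integrals *)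

Lemma inv_sqr_continuous r : 0 < r -> continuous (fun r => / (m r ^ 2)) r.
Proof.
  intros Hr; assert (H := profile_continuous r); assert (Hp := profile_pos r Hr).
  cont; apply Rgt_not_eq, pow_lt; auto.
Qed.

Lemma inv_sqr_ex_RInt a b : 0 < a -> 0 < b -> ex_RInt (fun r => / (m r ^ 2)) a b.
Proof.
  intros Ha Hb; apply ex_RInt_continuous_on with 0; auto; intros u Hu; now apply inv_sqr_continuous.
Qed.

Definition inv_sqr_int (a b : R) : R := RInt (fun r => / (m r ^ 2)) a b.

Lemma inv_sqr_int_derive a u : 0 < a -> 0 < u -> is_derive (inv_sqr_int a) u (/ (m u ^ 2)).
Proof.
  intros Ha Hu; apply (is_derive_RInt_on (fun r => / (m r ^ 2)) 0 a u); auto.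
  intros v Hv; now apply inv_sqr_continuous.
Qed.

Lemma inv_sqr_int_self a : inv_sqr_int a a = 0.
Proof. apply RInt_Rpoint. Qed.

Lemma inv_sqr_chasles a b c : 0 < a -> 0 < b -> 0 < c ->
  inv_sqr_int a b + inv_sqr_int b c = inv_sqr_int a c.
Proof.
  intros; apply (RInt_Rchasles (fun r => / (m r ^ 2)));
    now apply inv_sqr_ex_RInt.
Qed.

Lemma inv_sqr_nonneg a b : 0 < a -> a <= b -> 0 <= inv_sqr_int a b.
Proof.
  intros Ha Hab; apply RInt_pos_le; auto; [apply inv_sqr_ex_RInt; lra |].
  intros r Hr; left; apply Rinv_0_lt_compat, pow_lt, profile_pos; auto; lra.
Qed.

Lemma inv_sqr_improper_iff :
  ex_RInt_gen (fun r => / (m r ^ 2)) (at_point 1) (Rbar_locally p_infty) <->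
  exists B, forall b, 1 <= b -> inv_sqr_int 1 b <= B.
Proof.
  split.
  - intros [l Hl].
    destruct (Hl (fun y => Rabs (y - l) < 1)) as [Q P HQ [M HM] HP].
    { exists (mkposreal 1 Rlt_0_1); intros y Hy; exact Hy. }
    exists (l + 1); intros b Hb.
    set (b' := Rmax b (M + 1)); assert (Hb1 : b <= b') by apply Rmax_l.
    assert (Hb2 : M + 1 <= b') by apply Rmax_r.
    destruct (HP 1 b' HQ (HM b' ltac:(lra))) as [y [Hy Hyl]]; cbn [fst snd] in Hy.
    apply (is_RInt_unique (V := R_CompleteNormedModule)) in Hy; fold (inv_sqr_int 1 b') in Hy; apply Rabs_def2 in Hyl.
    rewrite <- (inv_sqr_chasles 1 b b') in Hy by lra.
    assert (H := inv_sqr_nonneg b b' ltac:(lra) Hb1); lra.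
  - intros [B HB].
    destruct (completeness (fun y => exists b, 1 <= b /\ y = inv_sqr_int 1 b)) as [l [Hub Hlub]].
    { exists B; intros y [b [Hb ->]]; auto. }
    { exists (inv_sqr_int 1 1), 1; split; [lra | auto]. }
    exists l; intros P [e He].
    assert (Hex : exists b0, 1 <= b0 /\ l - e < inv_sqr_int 1 b0).
    { apply NNPP; intros HN; assert (Hep := cond_pos e); assert (l <= l - e); [| lra].
      apply Hlub; intros y [b [Hb ->]]; apply Rnot_lt_le; intros Hlt; apply HN; exists b; auto. }
    destruct Hex as [b0 [Hb0 Hlb0]].
    exists (fun a => a = 1) (fun b => b0 < b); [easy | now exists b0 |].
    intros a b -> Hb; cbn [fst snd]; exists (inv_sqr_int 1 b); split.
    + apply (RInt_correct (V := R_CompleteNormedModule)), inv_sqr_ex_RInt; lra.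
    + apply He; change (Rabs (inv_sqr_int 1 b - l) < e).
      assert (H1 := inv_sqr_chasles 1 b0 b ltac:(lra) ltac:(lra) ltac:(lra)).
      assert (H2 := inv_sqr_nonneg b0 b ltac:(lra) ltac:(lra)).
      assert (H3 : inv_sqr_int 1 b <= l) by (apply Hub; exists b; split; [lra | auto]).
      apply Rabs_def1; assert (Hep := cond_pos e); lra.
Qed.

Lemma turn_ge_inv_sqr K x r : 0 < x -> 0 <= K < m x -> x <= r -> K * inv_sqr_int x r <= turn K x r.
Proof.
  intros Hx HK Hr.
  assert (turn K x x - K * inv_sqr_int x x <= turn K x r - K * inv_sqr_int x r).
  { apply (incr_of_derive_closed (fun r => turn K x r - K * inv_sqr_int x r)
      (fun r => turn_rate K r - K * / (m r ^ 2))); auto.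
    - intros u Hu; assert (D1 := turn_derive K x u Hx HK ltac:(lra)).
      assert (D2 := inv_sqr_int_derive x u Hx ltac:(lra)).
      deriv_eq; ring.
    - intros u Hu; assert (Hmu := profile_incr x u ltac:(lra) ltac:(lra)).
      destruct (clairaut_pos K (m u)) as [H1 H2]; [lra |].
      assert (H3 := clairaut_sqrt_le K (m u) ltac:(lra)).
      assert (/ (m u ^ 2) <= / (m u * sqrt (m u ^ 2 - K ^ 2))).
      { apply Rinv_le_contravar; [apply Rmult_lt_0_compat; lra | nra]. }
      unfold turn_rate, Rdiv; rewrite <- Rmult_minus_distr_l; apply Rmult_le_pos; lra. }
  rewrite turn_self, inv_sqr_int_self in H; lra.
Qed.

(** If 2 K <= m then sqrt (m^2 - K^2) >= m / 2. *)
Lemma turn_le_inv_sqr K x r : 0 < x -> 0 <= K -> 2 * K <= m x -> x <= r ->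
  turn K x r <= 2 * K * inv_sqr_int x r.
Proof.
  intros Hx HK HKx Hr; assert (Hmx := profile_pos x Hx).
  assert (2 * K * inv_sqr_int x x - turn K x x <= 2 * K * inv_sqr_int x r - turn K x r).
  { apply (incr_of_derive_closed (fun r => 2 * K * inv_sqr_int x r - turn K x r)
      (fun r => 2 * K * / (m r ^ 2) - turn_rate K r)); auto.
    - intros u Hu; assert (D1 := turn_derive K x u Hx ltac:(lra) ltac:(lra)).
      assert (D2 := inv_sqr_int_derive x u Hx ltac:(lra)).
      deriv_eq; ring.
    - intros u Hu; assert (Hmu := profile_incr x u ltac:(lra) ltac:(lra)).
      destruct (clairaut_pos K (m u)) as [H1 H2]; [lra |].
      assert (H3 : m u / 2 <= sqrt (m u ^ 2 - K ^ 2)).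
      { rewrite <- (sqrt_pow2 (m u / 2)) by lra; apply sqrt_le_1_alt; nra. }
      assert (/ (m u * sqrt (m u ^ 2 - K ^ 2)) <= / (m u ^ 2 / 2)).
      { apply Rinv_le_contravar; nra. }
      replace (/ (m u ^ 2 / 2)) with (2 * / (m u ^ 2)) in H by (field; lra).
      replace (2 * K * / (m u ^ 2)) with (K * (2 * / (m u ^ 2))) by ring.
      unfold turn_rate, Rdiv; rewrite <- Rmult_minus_distr_l; apply Rmult_le_pos; lra. }
  rewrite turn_self, inv_sqr_int_self in H; lra.
Qed.

(** Forwards, a turn bound at some x <= 1, with K = m(x) / 2, bounds the integral of m^-2.
    Backwards, a level v is fixed below which [stretch] is at most 3/2: the turn up to v is at most
    3/2 times PI / 2, and beyond it at most 2 c B' <= PI / 4 for c small, which adds up to PI. *)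
Lemma critical_radius_pos_iff : Rbar_lt 0 (critical_radius) <->
  ex_RInt_gen (fun r => / (m r ^ 2)) (at_point 1) (Rbar_locally p_infty).
Proof.
  assert (HP := PI_RGT_0); rewrite inv_sqr_improper_iff; split.
  - intros H; destruct (critical_radius_witness H) as [x [Hx HT]].
    assert (Hmx := profile_pos x ltac:(lra)).
    exists (PI / (m x / 2)); intros b Hb.
    assert (H1 := turn_ge_inv_sqr (m x / 2) x b ltac:(lra) ltac:(lra) ltac:(lra)).
    assert (H2 : turn (m x / 2) x b <= PI).
    { destruct (Req_dec x b) as [<- | E]; [rewrite turn_self; lra | apply HT; lra]. }
    assert (H3 := inv_sqr_chasles x 1 b ltac:(lra) ltac:(lra) ltac:(lra)).
    assert (H4 := inv_sqr_nonneg x 1 ltac:(lra) ltac:(lra)).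
    apply Rle_div_r; [lra |].
    assert (m x / 2 * inv_sqr_int 1 b <= m x / 2 * inv_sqr_int x b)
      by (apply Rmult_le_compat_l; lra).
    lra.
  - intros [B HB].
    assert (HB0 : 0 <= B) by (apply Rle_trans with (2 := HB 1 ltac:(lra)), inv_sqr_nonneg; lra).
    (* A bounded m would make the integral of m^-2 grow linearly; b is chosen to reach B + 1. *)
    assert (Hunb : forall v, exists r, 0 <= r /\ v <= m r).
    { intros v; apply NNPP; intros HN.
      assert (Hv : forall r, 0 <= r -> m r < v).
      { intros r Hr; apply Rnot_le_lt; intros H; apply HN; exists r; auto. }
      assert (Hv0 := Hv 0 ltac:(lra)); rewrite profile_0 in Hv0.
      set (b := 1 + (B + 1) * v ^ 2); assert (Hb : 1 <= b) by (unfold b; nra).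
      assert (RInt (fun _ => / (v ^ 2)) 1 b <= inv_sqr_int 1 b).
      { apply RInt_le; auto; [apply ex_RInt_const | apply inv_sqr_ex_RInt; lra |].
        intros r Hr; assert (H1 := Hv r ltac:(lra)); assert (H2 := profile_pos r ltac:(lra)).
        apply Rinv_le_contravar; [now apply pow_lt | apply pow_incr; lra]. }
      rewrite RInt_Rconst in H.
      replace ((b - 1) * / (v ^ 2)) with (B + 1) in H by (unfold b; field; lra).
      assert (H1 := HB b Hb); lra. }
    destruct (inverse_profile_exists Hunb) as [n Hn].
    destruct (continuous_eps (stretch n) 0 (1 / 2) (stretch_continuous n Hn 0) ltac:(lra))
      as [d [Hd Hdd]].
    set (v := d / 2); assert (Hv : stretch n v <= 3 / 2).
    { assert (H := Hdd v ltac:(unfold v; rewrite Rabs_pos_eq; lra)).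
      rewrite stretch_0 in H by auto; apply Rabs_def2 in H; lra. }
    assert (Hv0 : 0 < v) by (unfold v; lra).
    set (r0 := n v); assert (Hr0 : 0 < r0) by (apply n_pos; auto).
    assert (Hmr0 : m r0 = v) by (apply m_n; auto).
    set (B' := Rabs (inv_sqr_int r0 1) + B + 1).
    assert (HB'1 : 1 <= B') by (assert (H := Rabs_pos (inv_sqr_int r0 1)); unfold B'; lra).
    assert (HB' : forall r, r0 <= r -> inv_sqr_int r0 r <= B').
    { intros r Hr; set (r' := Rmax r 1).
      assert (Hr1 : r <= r') by apply Rmax_l; assert (Hr2 : 1 <= r') by apply Rmax_r.
      assert (H1 := inv_sqr_chasles r0 r r' Hr0 ltac:(lra) ltac:(lra)).
      assert (H2 := inv_sqr_nonneg r r' ltac:(lra) Hr1).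
      assert (H3 := inv_sqr_chasles r0 1 r' Hr0 ltac:(lra) ltac:(lra)).
      assert (H4 := HB r' Hr2); assert (H5 := Rle_abs (inv_sqr_int r0 1)); unfold B'; lra. }
    set (c := Rmin (v / 2) (PI / (8 * B'))).
    assert (Hc : 0 < c /\ 2 * c <= v /\ 8 * (c * B') <= PI).
    { assert (A1 := Rmin_l (v / 2) (PI / (8 * B'))); assert (A2 := Rmin_r (v / 2) (PI / (8 * B'))).
      fold c in A1, A2; split; [| split; [lra |]].
      - apply Rmin_pos; [lra | apply Rdiv_lt_0_compat; lra].
      - apply Rle_div_r in A2; lra. }
    destruct Hc as [Hc [Hcv HcB]].
    set (S := clairaut_par c r0); assert (HS := clairaut_par_nonneg c r0 Hc); fold S in HS.
    assert (HlS : level c S = v) by (unfold S; rewrite level_clairaut_par; lra).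
    assert (Hhead : cone_turn n c S <= 3 / 2 * atan S).
    { apply cone_turn_le_stretch; auto; intros u Hu.
      apply Rle_trans with (2 := Hv), stretch_incr; auto.
      - apply Rle_trans with c; [lra | apply level_ge; lra].
      - rewrite <- HlS; apply level_incr; lra. }
    assert (HaS := atan_pos_bounds S HS).
    apply Rbar_lt_le_trans with (n c); [simpl; apply n_pos; auto |].
    apply turn_bounded_radius; [apply n_pos; auto |].
    apply turn_bounded_level; auto; intros s Hs.
    destruct (Rle_lt_dec s S) as [HsS | HsS].
    { assert (H := cone_turn_incr n Hn c s S HsS); lra. }
    set (r := n (level c s)).
    assert (Hr : r0 <= r) by (unfold r0, r; rewrite <- HlS; apply n_le; auto; apply level_incr; lra).
    assert (E := turn_cone_turn n Hn c r0 r Hr0 ltac:(lra) Hr).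
    fold S in E; unfold r in E; rewrite (clairaut_par_level n Hn) in E by lra; fold r in E.
    assert (H1 := turn_le_inv_sqr c r0 r Hr0 ltac:(lra) ltac:(lra) Hr).
    assert (c * inv_sqr_int r0 r <= c * B') by (apply Rmult_le_compat_l; [lra | now apply HB']).
    lra.
Qed.

(** If m' >= 1/2 throughout, then [stretch] <= 2 and the turn from any radius is at most 2 atan s <
    PI. If m' < 1/2 at x, then [stretch] > 2 from there on and the turn from x exceeds PI. *)
Lemma critical_radius_finite_iff (l : R) :
  (forall r, 0 <= r -> l <= Derive m r) -> (forall e, 0 < e -> exists r, 0 <= r /\ Derive m r < l + e) ->
  (Rbar_lt (critical_radius) p_infty <-> l < 1 / 2).
Proof.
  intros Hle Hex; assert (HP := PI_RGT_0); split.
  - intros HR; apply Rnot_le_lt; intros Hl.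
    assert (Hd : forall r, 0 <= r -> 1 / 2 <= Derive m r) by (intros r Hr; specialize (Hle r Hr); lra).
    assert (Hunb : forall v, exists r, 0 <= r /\ v <= m r).
    { intros v; exists (2 * Rmax v 0); assert (H1 := Rmax_l v 0); assert (H2 := Rmax_r v 0).
      split; [lra |].
      assert (m 0 - 1 / 2 * 0 <= m (2 * Rmax v 0) - 1 / 2 * (2 * Rmax v 0)).
      { apply (incr_of_derive_closed (fun t => m t - 1 / 2 * t) (fun t => Derive m t - 1 / 2)); [lra | |].
        - intros t _; assert (H := profile_derive t); deriv_eq; ring.
        - intros t Ht; assert (H := Hd t ltac:(lra)); lra. }
      rewrite profile_0 in H; lra. }
    destruct (inverse_profile_exists Hunb) as [n Hn].
    assert (HT : forall x, 0 < x -> turn_bounded x).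
    { intros x Hx; apply (turn_bounded_iff n Hn x Hx); intros s Hs.
      assert (Hmx := profile_pos x Hx).
      apply Rle_trans with (2 * atan s); [| assert (H := atan_bound s); lra].
      apply cone_turn_le_stretch; auto; intros u Hu.
      replace 2 with (/ (1 / 2)) by field.
      apply Rinv_le_contravar; [lra |]; apply Hd, n_nonneg; auto.
      apply Rle_trans with (m x); [lra | apply level_ge; lra]. }
    destruct (critical_radius) as [R | |] eqn:ER; [| exact HR |].
    + assert (HR1 : 0 < Rabs R + 1) by (assert (H := Rabs_pos R); lra).
      assert (H := proj1 (turn_bounded_radius (Rabs R + 1) HR1) (HT _ HR1)).
      rewrite ER in H; simpl in H; assert (H1 := Rle_abs R); lra.
    + assert (H := critical_radius_nonneg); rewrite ER in H; contradiction.
  - intros Hl; destruct (Hex (1 / 2 - l) ltac:(lra)) as [r [Hr Hdr]].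
    set (x := Rmax r 1); assert (Hx1 : r <= x) by apply Rmax_l; assert (Hx2 : 1 <= x) by apply Rmax_r.
    assert (HN : ~ turn_bounded x).
    { intros HT.
      destruct (inverse_profile_exists (turn_bounded_unbounded x ltac:(lra) HT)) as [n Hn].
      assert (Hmx := profile_pos x ltac:(lra)).
      assert (Hst : forall s, 2 < stretch n (level (m x) s)).
      { intros s; apply stretch_gt_2 with x; auto; [lra | | apply level_ge; lra].
        assert (H := profile_derive_decr r x Hr Hx1); lra. }
      destruct (cone_turn_exceeds n Hn (m x) Hmx) as [s [Hs Hs2]].
      { intros s _; left; apply Hst. }
      { apply Hst. }
      assert (H := proj1 (turn_bounded_iff n Hn x ltac:(lra)) HT s Hs); lra. }
    apply Rbar_not_le_lt; intros Hle'; apply HN.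
    apply turn_bounded_radius; auto; [lra |].
    apply Rbar_le_trans with (2 := Hle'); exact I.
Qed.

(** Otherwise the turn at R stays below PI by a margin, and [cone_turn_open] produces a larger
    radius with bounded turn. *)
Lemma turn_total_attained n R l : inverse_profile n -> critical_radius = Finite R -> 0 < R ->
  l < PI -> exists s, 0 <= s /\ l < cone_turn n (m R) s.
Proof.
  intros Hn HR HR0 Hl; apply NNPP; intros HN.
  assert (Hc := profile_pos R HR0).
  destruct (cone_turn_open n Hn (m R) (PI - l) Hc ltac:(lra)) as [c1 [Hc1 Hb]].
  { intros s Hs; apply Rnot_lt_le; intros Hlt; apply HN; exists s; split; auto; lra. }
  assert (HT : turn_bounded (n c1)) by (apply turn_bounded_level; auto; lra).
  assert (H := proj1 (turn_bounded_radius (n c1) ltac:(apply n_pos; auto; lra)) HT).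
  rewrite HR in H; simpl in H.
  assert (m R < c1 -> R < n c1).
  { intros H1; rewrite <- (n_m n Hn R) at 1; apply n_lt; auto. }
  lra.
Qed.

(** * The integral equation for the critical radius *)

Definition total_turn_is_PI (x : R) : Prop :=
  is_RInt_gen (fun r => m x / (m r * sqrt (m r ^ 2 - m x ^ 2))) (at_right x) (Rbar_locally p_infty) PI.

Lemma turn_from_right n x a b : inverse_profile n -> 0 < x -> x < a -> a <= b ->
  is_RInt (turn_rate (m x)) a b
    (cone_turn n (m x) (clairaut_par (m x) b) - cone_turn n (m x) (clairaut_par (m x) a)).
Proof.
  intros Hn Hx Ha Hab; assert (Hc := profile_pos x Hx).
  assert (Hma : m x < m a) by (apply m_lt with n; auto).
  rewrite <- turn_cone_turn by (auto; lra).
  apply (RInt_correct (V := R_CompleteNormedModule)), turn_ex_RInt with a; auto; lra.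
Qed.

Lemma cone_turn_start_small n x e : inverse_profile n -> 0 < x -> 0 < e ->
  exists d, 0 < d /\ forall a, x < a < x + d ->
    0 <= cone_turn n (m x) (clairaut_par (m x) a) < e.
Proof.
  intros Hn Hx He; assert (Hc := profile_pos x Hx).
  assert (C : continuous (fun a => cone_turn n (m x) (clairaut_par (m x) a)) x).
  { apply (continuous_comp (clairaut_par (m x)) (cone_turn n (m x))).
    - apply clairaut_par_continuous; auto.
    - apply derive_continuous with (1 := cone_turn_derive n Hn _ _). }
  destruct (continuous_eps _ _ e C He) as [d [Hd Hdd]]; exists d; split; auto; intros a Ha.
  assert (H := Hdd a ltac:(rewrite Rabs_pos_eq; lra)).
  assert (Ex : clairaut_par (m x) x = 0).
  { unfold clairaut_par; rewrite Rminus_diag, sqrt_0; unfold Rdiv; ring. }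
  rewrite Ex, cone_turn_0, Rminus_0_r in H.
  assert (H1 := cone_turn_incr n Hn (m x) 0 _ (clairaut_par_nonneg (m x) a Hc)).
  rewrite cone_turn_0 in H1; apply Rabs_def2 in H; lra.
Qed.

Lemma clairaut_par_ge n x s b : inverse_profile n -> 0 < x -> 0 <= s -> n (level (m x) s) <= b ->
  s <= clairaut_par (m x) b.
Proof.
  intros Hn Hx Hs Hb; assert (Hc := profile_pos x Hx).
  rewrite <- (clairaut_par_level n Hn (m x) s Hc Hs) at 1; unfold clairaut_par, Rdiv.
  apply Rmult_le_compat_r; [left; now apply Rinv_0_lt_compat |]; apply sqrt_le_1_alt.
  assert (H1 := level_ge (m x) s ltac:(lra)).
  assert (H2 := n_nonneg n Hn (level (m x) s) ltac:(lra)).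
  assert (H3 := profile_incr _ _ H2 Hb).
  rewrite (m_n n Hn) in H3 |- *; assert (level (m x) s ^ 2 <= m b ^ 2) by (apply pow_incr; lra); lra.
Qed.

(** The integral over [a, b] is a difference of values of [cone_turn]. The lower value tends to 0 as
    a tends to x, and the upper one is nondecreasing in b, so the improper integral is PI exactly
    when PI is the supremum. *)
Lemma total_turn_iff n x : inverse_profile n -> 0 < x ->
  (total_turn_is_PI x <->
   (forall s, 0 <= s -> cone_turn n (m x) s <= PI) /\
   (forall l, l < PI -> exists s, 0 <= s /\ l < cone_turn n (m x) s)).
Proof.
  intros Hn Hx; assert (Hc := profile_pos x Hx); split.
  - intros HI.
    assert (Hlim : forall e, 0 < e -> exists d M, 0 < d /\ forall a b, x < a < x + d -> M < b -> a <= b ->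
      Rabs (cone_turn n (m x) (clairaut_par (m x) b) -
            cone_turn n (m x) (clairaut_par (m x) a) - PI) < e).
    { intros e He.
      destruct (HI (fun y => Rabs (y - PI) < e)) as [Q P [d HQ] [M HM] HP].
      { exists (mkposreal e He); intros y Hy; exact Hy. }
      exists d, M; split; [apply cond_pos |]; intros a b Ha Hb Hab.
      destruct (HP a b) as [y [Hy Hye]].
      { apply HQ; [change (Rabs (a - x) < d); rewrite Rabs_pos_eq |]; lra. }
      { apply HM, Hb. }
      cbn [fst snd] in Hy.
      assert (E := is_RInt_unique (V := R_CompleteNormedModule) _ _ _ _ (turn_from_right n x a b Hn Hx ltac:(lra) Hab)).
      apply (is_RInt_unique (V := R_CompleteNormedModule)) in Hy; unfold turn_rate in E; rewrite E in Hy; now rewrite Hy. }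
    split.
    + intros s Hs; apply Rnot_lt_le; intros Hlt.
      set (e := (cone_turn n (m x) s - PI) / 2); assert (He : 0 < e) by (unfold e; lra).
      destruct (Hlim e He) as [d [M [Hd HL]]].
      destruct (cone_turn_start_small n x e Hn Hx He) as [d' [Hd' HS]].
      set (a := x + Rmin d d' / 2).
      assert (Hmin : 0 < Rmin d d') by (apply Rmin_pos; auto).
      assert (A1 := Rmin_l d d'); assert (A2 := Rmin_r d d').
      set (b := Rmax (Rmax a (M + 1)) (n (level (m x) s))).
      assert (B1 : Rmax a (M + 1) <= b) by apply Rmax_l.
      assert (B2 : n (level (m x) s) <= b) by apply Rmax_r.
      assert (B3 := Rmax_l a (M + 1)); assert (B4 := Rmax_r a (M + 1)).
      assert (H1 := HL a b ltac:(unfold a; lra) ltac:(lra) ltac:(lra)).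
      assert (H2 := HS a ltac:(unfold a; lra)).
      assert (H3 := cone_turn_incr n Hn (m x) _ _ (clairaut_par_ge n x s b Hn Hx Hs B2)).
      apply Rabs_def2 in H1; unfold e in *; lra.
    + intros l Hl; destruct (Hlim (PI - l) ltac:(lra)) as [d [M [Hd HL]]].
      set (a := x + d / 2); set (b := Rmax a (M + 1)).
      assert (B3 := Rmax_l a (M + 1)); assert (B4 := Rmax_r a (M + 1)); fold b in B3, B4.
      assert (H1 := HL a b ltac:(unfold a; lra) ltac:(lra) ltac:(lra)).
      assert (H2 := cone_turn_incr n Hn (m x) 0 _ (clairaut_par_nonneg (m x) a Hc)).
      rewrite cone_turn_0 in H2; apply Rabs_def2 in H1.
      exists (clairaut_par (m x) b); split; [now apply clairaut_par_nonneg | lra].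
  - intros [Hb Ha] P [e He]; assert (Hep := cond_pos e).
    destruct (cone_turn_start_small n x (e / 2) Hn Hx ltac:(lra)) as [d [Hd HS]].
    destruct (Ha (PI - e / 2) ltac:(lra)) as [s [Hs Hsl]].
    exists (fun a => x < a < x + d) (fun b => Rmax (x + d) (n (level (m x) s)) < b).
    + exists (mkposreal d Hd); intros y Hy Hy2; change (Rabs (y - x) < d) in Hy.
      rewrite Rabs_pos_eq in Hy; lra.
    + now exists (Rmax (x + d) (n (level (m x) s))).
    + intros a b Hab Hbb; cbn [fst snd].
      assert (B3 := Rmax_l (x + d) (n (level (m x) s))); assert (B4 := Rmax_r (x + d) (n (level (m x) s))).
      exists (cone_turn n (m x) (clairaut_par (m x) b) - cone_turn n (m x) (clairaut_par (m x) a)).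
      split; [apply turn_from_right; auto; lra |]; apply He.
      match goal with |- ball _ _ ?y => change (Rabs (y - PI) < e) end.
      assert (H1 := cone_turn_incr n Hn (m x) _ _ (clairaut_par_ge n x s b Hn Hx Hs ltac:(lra))).
      assert (H2 := Hb _ (clairaut_par_nonneg (m x) b Hc)); assert (H3 := HS a Hab).
      apply Rabs_def1; lra.
Qed.

Section Uniqueness.
Context (n : R -> R) (Hn : inverse_profile n).

(** The difference of the turns is nonnegative and nondecreasing. If it were positive at some s it
    would persist, and the turn at c' would exceed PI once the turn at c comes close enough to PI.
    So it vanishes, and so does its derivative. *)
Lemma equal_turn_stretch c c' : 0 < c -> c <= c' ->
  (forall s, 0 <= s -> cone_turn n c' s <= PI) ->
  (forall l, l < PI -> exists s, 0 <= s /\ l < cone_turn n c s) ->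
  forall s, 0 < s -> stretch n (level c s) = stretch n (level c' s).
Proof.
  intros Hc Hcc Hb Ha.
  assert (HD : forall s, 0 <= s -> cone_turn n c' s - cone_turn n c s = 0).
  { intros s Hs; assert (H1 := cone_turn_level_le n Hn c c' s ltac:(lra) Hcc Hs).
    apply Rle_antisym; [| lra]; apply Rnot_lt_le; intros Hlt.
    destruct (Ha (PI - (cone_turn n c' s - cone_turn n c s))) as [t [Ht Htl]]; [lra |].
    set (w := Rmax s t); assert (Hsw : s <= w) by apply Rmax_l; assert (Htw : t <= w) by apply Rmax_r.
    assert (H2 := cone_turn_level_incr n Hn c c' s w ltac:(lra) Hcc Hs Hsw).
    assert (H3 := cone_turn_incr n Hn c t w Htw); assert (H4 := Hb w ltac:(lra)); lra. }
  intros s Hs.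
  assert (D1 := cone_turn_derive n Hn c s); assert (D2 := cone_turn_derive n Hn c' s).
  assert (D := is_derive_Rminus _ _ s _ _ D2 D1).
  assert (D0 : is_derive (fun t => cone_turn n c' t - cone_turn n c t) s 0).
  { apply (is_derive_ext_loc (fun _ => 0)); [| apply is_derive_Rconst].
    apply (filter_imp (F := locally s) (fun t => 0 < t)); [| now apply open_gt].
    intros t Ht; symmetry; apply HD; lra. }
  apply is_derive_unique in D; apply is_derive_unique in D0; rewrite D0 in D.
  assert (0 <= s ^ 2) by apply pow2_ge_0; unfold cone_turn_rate in D.
  apply Rmult_eq_reg_r with (/ (1 + s ^ 2)); [unfold Rdiv in D; lra |].
  apply Rinv_neq_0_compat; lra.
Qed.

(** Passing from [level c s] to [level c' s] multiplies by q = c' / c > 1, so [stretch] has equal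
    values at v, q v, q^2 v, and so on; these eventually exceed m(r), where [stretch] > 2. *)
Lemma stretch_scale c c' r : 0 < c -> c < c' -> 0 <= r -> Derive m r < 1 / 2 ->
  (forall s, 0 < s -> stretch n (level c s) = stretch n (level c' s)) ->
  forall v, c < v -> 2 < stretch n v.
Proof.
  intros Hc Hcc Hr Hd Heq.
  set (q := c' / c); assert (Hq : 1 < q) by (apply Rlt_div_r; lra).
  assert (H1 : forall v, c < v -> stretch n v = stretch n (q * v)).
  { intros v Hv; set (s := sqrt ((v / c) ^ 2 - 1)).
    assert (Hvc : 1 < v / c) by (apply Rlt_div_r; lra).
    assert (Hs : 0 < s) by (apply sqrt_lt_R0; nra).
    assert (E : sqrt (1 + s ^ 2) = v / c).
    { unfold s; rewrite sqrt_sqr_eq by nra.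
      replace (1 + ((v / c) ^ 2 - 1)) with ((v / c) ^ 2) by ring; apply sqrt_pow2; lra. }
    assert (H := Heq s Hs); unfold level in H; rewrite E in H.
    replace (c * (v / c)) with v in H by (field; lra).
    replace (c' * (v / c)) with (q * v) in H by (unfold q; field; lra); exact H. }
  intros v Hv.
  assert (H2 : forall k, v <= q ^ k * v /\ stretch n v = stretch n (q ^ k * v)).
  { induction k as [| k [IH1 IH2]]; [split; [simpl; lra | now rewrite pow_O, Rmult_1_l] |].
    replace (q ^ S k * v) with (q * (q ^ k * v)) by (simpl; ring).
    split; [nra | rewrite <- H1; [auto | lra]]. }
  destruct (Pow_x_infinity q ltac:(rewrite Rabs_pos_eq; lra) (m r / v)) as [N HN].
  specialize (HN N (le_n N)); rewrite Rabs_pos_eq in HN by (apply pow_le; lra).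
  destruct (H2 N) as [_ ->]; apply stretch_gt_2 with r; auto.
  apply Rge_le in HN; apply Rle_div_l in HN; lra.
Qed.
End Uniqueness.
End Profile.

(** * Von Mangoldt planes *)

Lemma second_derive (m : R -> R) : smooth m -> forall x, is_derive (Derive m) x (Derive_n m 2 x).
Proof. intros Hs x; exact (Derive_correct _ _ (Hs 1%nat x)). Qed.

Lemma second_derive_le_0 (m : R -> R) : rot_sym_profile m -> nonneg_curvature m ->
  forall r, 0 < r -> Derive_n m 2 r <= 0.
Proof.
  intros [_ [_ [_ [_ Hp]]]] HG r Hr; assert (H := HG r Hr); assert (Hmr := Hp r Hr); unfold Gm in H.
  apply Rnot_lt_le; intros Hlt.
  assert (- Derive_n m 2 r / m r < 0); [| lra].
  apply Rlt_div_l; lra.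
Qed.

Lemma concave_profile_of (m : R -> R) : rot_sym_profile m -> nonneg_curvature m -> concave_profile m.
Proof.
  intros Hrot HG; assert (Hneg := second_derive_le_0 m Hrot HG).
  destruct Hrot as [Hs [Hodd [H0 [H1 Hp]]]]; assert (Hd2 := second_derive m Hs).
  assert (Hd : forall x, is_derive m x (Derive m x)) by (intros x; exact (Derive_correct _ _ (Hs 0%nat x))).
  assert (Hdec : forall r s, 0 <= r -> r <= s -> Derive m s <= Derive m r).
  { intros r s Hr Hrs; assert (- Derive m r <= - Derive m s); [| lra].
    apply (incr_of_derive (fun t => - Derive m t) (fun t => - Derive_n m 2 t)); auto.
    - intros t Ht; assert (H := Hd2 t); deriv.
    - intros t Ht; assert (H := Hneg t ltac:(lra)); lra.
    - intros t Ht; assert (H := derive_continuous _ _ _ (Hd2 t)); cont. }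
  assert (Hdp : forall r, 0 <= r -> 0 <= Derive m r).
  { intros r Hr; apply Rnot_lt_le; intros Hlt.
    set (s := r + (Rabs (m r) + 1) / - Derive m r).
    assert (Ha := Rabs_pos (m r)).
    assert (Hsr : 0 < (Rabs (m r) + 1) / - Derive m r) by (apply Rdiv_lt_0_compat; lra).
    assert (Hms := Hp s ltac:(unfold s; lra)).
    assert (Derive m r * r - m r <= Derive m r * s - m s).
    { apply (incr_of_derive_closed (fun t => Derive m r * t - m t)
               (fun t => Derive m r - Derive m t)); [unfold s; lra | |].
      - intros t Ht; assert (H := Hd t); deriv_eq; ring.
      - intros t Ht; assert (H := Hdec r t Hr ltac:(lra)); lra. }
    assert (E : Derive m r * s = Derive m r * r - (Rabs (m r) + 1)) by (unfold s; field; lra).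
    assert (Hab := Rle_abs (m r)); lra. }
  exact (conj Hd (conj (fun x => derive_continuous _ _ _ (Hd2 x))
    (conj Hodd (conj H0 (conj H1 (conj Hp (conj Hdec Hdp))))))).
Qed.

Section VonMangoldt.
Context (m : R -> R) (Hrot : rot_sym_profile m) (HG : nonneg_curvature m) (HvM : von_Mangoldt m).

(** If [Gm] vanished at p, monotonicity would make it vanish from p on; m' would then stay equal to
    1/2, against m'(r) < 1/2. *)
Lemma half_slope_curved p r : 0 < p -> Derive m p = 1 / 2 -> 0 <= r -> Derive m r < 1 / 2 ->
  0 < Gm m p.
Proof.
  intros Hp Hdp Hr Hdr; assert (Hm := concave_profile_of m Hrot HG).
  assert (Hd2 := second_derive m (proj1 Hrot)).
  apply Rnot_le_lt; intros HGp.
  assert (Hpr : p < r).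
  { apply Rnot_le_lt; intros H; assert (H1 := profile_derive_decr m Hm r p Hr H); lra. }
  assert (E : Derive m r = Derive m p); [| lra].
  apply constant_of_derive; [lra |]; intros t Ht.
  apply is_derive_eq with (Derive_n m 2 t); [apply Hd2 |].
  assert (H1 := HG t ltac:(lra)); assert (H2 := HvM p t Hp ltac:(lra)).
  assert (H3 := profile_pos m Hm t ltac:(lra)).
  assert (E0 : Gm m t = 0) by lra; unfold Gm in E0.
  apply (f_equal (fun z => z * m t)) in E0; field_simplify in E0; lra.
Qed.

(** Between two solutions m'' has a zero, hence so does [Gm]; but [Gm] is positive at the later
    solution and nonincreasing. *)
Lemma half_slope_unique p1 p2 r : 0 < p1 -> p1 < p2 -> Derive m p1 = 1 / 2 -> Derive m p2 = 1 / 2 ->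
  0 <= r -> Derive m r < 1 / 2 -> False.
Proof.
  intros Hp1 Hp12 H1 H2 Hr Hdr; assert (Hm := concave_profile_of m Hrot HG).
  assert (Hd2 := second_derive m (proj1 Hrot)).
  assert (Hpos := half_slope_curved p2 r ltac:(lra) H2 Hr Hdr).
  destruct (MVT_everywhere (Derive m) (Derive_n m 2) p1 p2 Hd2) as [z [Hz Ez]].
  rewrite Rmin_left, Rmax_right in Hz by lra.
  assert (HGz := HvM z p2 ltac:(lra) ltac:(lra)); assert (Hmz := profile_pos m Hm z ltac:(lra)).
  assert (Ez0 : Derive_n m 2 z = 0).
  { assert (Derive_n m 2 z * (p2 - p1) = 0) by lra.
    apply Rmult_integral in H; lra. }
  unfold Gm at 2 in HGz; rewrite Ez0 in HGz; unfold Rdiv in HGz.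
  rewrite Ropp_0, Rmult_0_l in HGz; lra.
Qed.

(** On the geodesic tangent to the parallel at p, [stretch] starts at exactly 2 and is larger
    afterwards, so the total turn exceeds PI; this puts p strictly beyond the critical radius. *)
Lemma half_slope_solution r : 0 <= r -> Derive m r < 1 / 2 ->
  exists p, 0 < p /\ Derive m p = 1 / 2 /\
    (forall t, 0 <= t -> Derive m t = 1 / 2 -> t = p) /\ 0 < Gm m p /\ ~ turn_bounded m p.
Proof.
  intros Hr Hdr; assert (Hm := concave_profile_of m Hrot HG).
  assert (Hd0 : Derive m 0 = 1) by apply Hrot.
  destruct (IVT_gen (Derive m) 0 r (1 / 2)) as [p [Hp Ep]].
  { intros t; apply continuity_pt_of, profile_derive_continuous; auto. }
  { rewrite Hd0, Rmin_right, Rmax_left; lra. }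
  rewrite Rmin_left, Rmax_right in Hp by lra.
  assert (Hpos : forall t, 0 <= t -> Derive m t = 1 / 2 -> 0 < t).
  { intros t [Ht | <-] E; [auto | lra]. }
  assert (Hp0 := Hpos p ltac:(lra) Ep).
  assert (Huniq : forall t, 0 <= t -> Derive m t = 1 / 2 -> t = p).
  { intros t Ht Et; assert (Ht0 := Hpos t Ht Et).
    destruct (Rtotal_order t p) as [H | [H | H]]; auto; exfalso;
      [apply (half_slope_unique t p r) | apply (half_slope_unique p t r)]; auto. }
  exists p; repeat (split; [now auto |]); split; [now apply half_slope_curved with r |].
  intros HT; destruct (inverse_profile_exists m Hm (turn_bounded_unbounded m Hm p Hp0 HT)) as [n Hn].
  assert (Hmp := profile_pos m Hm p Hp0).
  assert (Est : stretch m n (m p) = 2) by (rewrite stretch_m, Ep by auto; field).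
  destruct (cone_turn_exceeds m Hm n Hn (m p) Hmp) as [s [Hs Hs2]].
  - intros s Hs; rewrite <- Est; apply stretch_incr; auto; [lra | apply level_ge; lra].
  - assert (H1 : 2 <= stretch m n (level (m p) 1)).
    { rewrite <- Est; apply stretch_incr; auto; [lra | apply level_ge; lra]. }
    (* Equality would make m' = 1/2 at a radius larger than p, against uniqueness of the
       solution. *)
    destruct H1 as [H1 | H1]; auto; exfalso.
    assert (Hlt : m p < level (m p) 1).
    { assert (E := level_sqr (m p) 1); assert (H2 := level_ge (m p) 1 ltac:(lra)); nra. }
    apply (n_lt m n Hn) in Hlt; rewrite (n_m m n Hn) in Hlt.
    assert (n (level (m p) 1) = p); [| lra].
    apply Huniq; [lra |].
    unfold stretch in H1; rewrite <- (Rinv_inv (Derive m (n (level (m p) 1)))), <- H1; field.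
  - assert (H := proj1 (turn_bounded_iff m Hm n Hn p Hp0) HT s Hs); lra.
Qed.
End VonMangoldt.

Theorem theorem1p3 (m : R -> R) :
  rot_sym_profile m -> nonneg_curvature m ->
  exists Rm : Rbar,
    Rbar_le (Finite 0) Rm /\
    (* (i) *)
    (forall q : pt, in_Cm m q <-> Rbar_le (Finite (dist_m m origin q)) Rm) /\
    (* (ii) *)
    (Rbar_lt (Finite 0) Rm <->
       ex_RInt_gen (fun r => / (m r ^ 2)) (at_point 1) (Rbar_locally p_infty)) /\
    (* (iii) *)
    (Rbar_lt Rm p_infty <-> Rbar_lt (Lim (Derive m) p_infty) (Finite (1 / 2))) /\
    (* (iv) *)
    (von_Mangoldt m -> Rbar_lt Rm p_infty ->
       exists rho : R,
         (0 <= rho /\ Derive m rho = 1 / 2 /\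
          (forall r, 0 <= r -> Derive m r = 1 / 2 -> r = rho)) /\
         Rbar_lt Rm (Finite rho) /\ 0 < Gm m rho) /\
    (* (v) *)
    (von_Mangoldt m -> Rbar_lt (Finite 0) Rm -> Rbar_lt Rm p_infty ->
       is_RInt_gen (fun r => m (real Rm) / (m r * sqrt (m r ^ 2 - m (real Rm) ^ 2)))
                   (at_right (real Rm)) (Rbar_locally p_infty) PI /\
       (forall x : R, 0 < x ->
          is_RInt_gen (fun r => m x / (m r * sqrt (m r ^ 2 - m x ^ 2)))
                      (at_right x) (Rbar_locally p_infty) PI ->
          Finite x = Rm)).
Proof.
  intros Hrot HG; assert (Hm := concave_profile_of m Hrot HG).
  destruct (derive_limit m Hm) as [l [Hlim [Hle Hex]]].
  assert (Hfin := critical_radius_finite_iff m Hm l Hle Hex).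
  exists (critical_radius m); split; [apply critical_radius_nonneg |].
  split; [| split; [now apply critical_radius_pos_iff | split; [| split]]].
  - intros q; rewrite dist_m_origin by auto.
    destruct (Req_dec (rad q) 0) as [E | E].
    + rewrite E; split; intros _; [apply critical_radius_nonneg | now apply in_Cm_at_origin].
    + assert (Hq : 0 < rad q) by (assert (H := rad_pos q); lra).
      rewrite in_Cm_iff by auto; now apply turn_bounded_radius.
  - rewrite (is_lim_unique _ _ _ Hlim); exact Hfin.
  - intros HvM HR; assert (Hl := proj1 Hfin HR); clear HR.
    destruct (Hex (1 / 2 - l) ltac:(lra)) as [r [Hr Hdr]].
    destruct (half_slope_solution m Hrot HG HvM r Hr ltac:(lra)) as [p [Hp [Ep [Hu [HGp HT]]]]].
    exists p; split; [split; [lra | auto] | split; [| auto]].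
    apply Rbar_not_le_lt; intros H; apply HT; now apply turn_bounded_radius.
  - intros _ H0 HR; assert (Hl := proj1 Hfin HR).
    destruct (Hex (1 / 2 - l) ltac:(lra)) as [r [Hr Hdr]].
    destruct (critical_radius m) as [R | |] eqn:ER; [| contradiction HR | contradiction H0].
    simpl in H0; cbn [real].
    assert (HT : turn_bounded m R) by (apply turn_bounded_radius; auto; rewrite ER; apply Rbar_le_refl).
    destruct (inverse_profile_exists m Hm (turn_bounded_unbounded m Hm R H0 HT)) as [n Hn].
    assert (Hb := proj1 (turn_bounded_iff m Hm n Hn R H0) HT).
    assert (Hc := profile_pos m Hm R H0).
    split.
    + apply (proj2 (total_turn_iff m Hm n R Hn H0)); split; [exact Hb |].
      intros y Hy; now apply turn_total_attained.
    + intros x Hx HI; apply (proj1 (total_turn_iff m Hm n x Hn Hx)) in HI; destruct HI as [Hbx Hax].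
      assert (Hcx := profile_pos m Hm x Hx).
      assert (HxR : x <= R).
      { assert (H := proj1 (turn_bounded_radius m Hm x Hx) (proj2 (turn_bounded_iff m Hm n Hn x Hx) Hbx)).
        now rewrite ER in H. }
      (* If x < R, both radii have total turn PI; then [stretch] > 2 at all levels above m(x), and
         the turn from x would exceed PI. *)
      destruct HxR as [HxR | ->]; [exfalso | auto].
      assert (Hmx : m x < m R) by (apply m_lt with n; auto).
      assert (Heq := equal_turn_stretch m Hm n Hn (m x) (m R) Hcx ltac:(lra) Hb Hax).
      assert (H2 := stretch_scale m Hm n Hn (m x) (m R) r Hcx Hmx Hr ltac:(lra) Heq).
      assert (Hlev : forall s, 0 < s -> m x < level (m x) s).
      { intros s Hs; assert (E := level_sqr (m x) s); assert (H3 := level_ge (m x) s ltac:(lra)).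
        assert (0 < (m x * s) ^ 2) by (apply pow_lt, Rmult_lt_0_compat; auto); nra. }
      destruct (cone_turn_exceeds m Hm n Hn (m x) Hcx) as [s [Hs Hs2]].
      { intros s Hs; left; apply H2, Hlev, Hs. }
      { apply H2, Hlev; lra. }
      assert (H3 := Hbx s Hs); lra.
Qed.
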